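(* Let $d=1$, let $\alpha\in(0,1)$, and let $\phi\in\{\varphi_1,\varphi_2,\varphi_3^{\alpha}\}$. For $u\in W^{1,1}(\mathbb{R})$ let $u^{*}(x)=\sup_{t>0}(|u|*\phi_t)(x)$ be the associated maximal function. Then the map $u\mapsto (u^{*})'$ is continuous from $W^{1,1}(\mathbb{R})$ to $L^{1}(\mathbb{R})$; that is, if $u_j\to u$ in $W^{1,1}(\mathbb{R})$, then $\|(u_j^{*})'-(u^{*})'\|_{L^1(\mathbb{R})}\to 0$.
   Context: Kernels on $\mathbb{R}$: $\varphi_1(x)=\frac{1}{\pi}\frac{1}{x^2+1}$ (Poisson kernel), $\varphi_2(x)=\frac{1}{(4\pi)^{1/2}}e^{-x^2/4}$ (heat kernel), and $\varphi_3^{\alpha}(x)=C^{\alpha}\frac{1}{(x^2+1)^{(2-\alpha)/2}}$ for $0<\alpha<1$, where $C^{\alpha}>0$ is the constant with $\|\varphi_3^{\alpha}\|_{1}=1$ (fractional Poisson kernel). For a kernel $\phi$ and $t>0$, $\phi_t(x)=\frac1t\phi\left(\frac{x}{t}\right)$. $W^{1,1}(\mathbb{R})$ is the Sobolev space of real-valued functions with norm $\|u\|_{1,1}=\|u\|_1+\|u'\|_1$; its elements are identified with their continuous representatives. For these kernels and $u\in W^{1,1}(\mathbb{R})$, $u^{*}$ is continuous and weakly differentiable with $(u^* )'\in L^1(\mathbb{R})$; $(u^{*})'$ denotes the weak derivative. *)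

(* Defs.v *)
From HB Require Import structures.
From mathcomp Require Export all_boot all_order all_algebra.
From mathcomp Require Export all_classical all_reals all_analysis.
Set Implicit Arguments.
Unset Strict Implicit.
Unset Printing Implicit Defensive.
Export Order.TTheory GRing.Theory Num.Theory.
Export numFieldNormedType.Exports.
Local Open Scope classical_set_scope.
Local Open Scope ring_scope.

Section defs.
Context {R : realType}.
Local Notation mu := (@lebesgue_measure R).
Implicit Types (f g u phi : R -> R) (t x : R).

Definition L1norm f : \bar R := Lnorm mu 1%:E (EFin \o f).

Definition test_function (eta : R -> R) : Prop :=
  (forall n x, derivable (derive1n n eta) x 1) /\
  compact (closure [set x | eta x != 0]).

Definition is_weak_derivative f g : Prop :=
  [/\ locally_integrable [set: R] f, locally_integrable [set: R] g &
      forall eta, test_function eta ->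
        \int[mu]_x (f x * derive1 eta x) = - \int[mu]_x (g x * eta x)].

(* Weak derivatives are unique only up to null sets, so one is chosen; the value
   is the zero function if f has no weak derivative. *)
Definition weak_derivative f : R -> R :=
  xget (cst 0) [set g | is_weak_derivative f g].

(* W^{1,1}(R), each class being represented by its continuous member. *)
Definition sobolev11 u : Prop :=
  [/\ continuous u,
      mu.-integrable [set: R] (EFin \o u) &
      exists2 g, is_weak_derivative u g & mu.-integrable [set: R] (EFin \o g)].

Definition sobolev11_norm u : \bar R :=
  (L1norm u + L1norm (weak_derivative u))%E.

Definition poisson_kernel x : R := pi^-1 * (x ^+ 2 + 1)^-1.

Definition heat_kernel x : R :=
  (Num.sqrt (4 * pi))^-1 * expR (- (x ^+ 2 / 4)).

Definition is_fractional_poisson_kernel (alpha : R) phi : Prop :=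
  exists C : R, [/\ 0 < C,
    phi = (fun x => C * ((x ^+ 2 + 1) `^ ((2 - alpha) / 2))^-1) &
    L1norm phi = 1%E].

Definition dilation phi t x : R := t^-1 * phi (x / t).

Definition convolution f g x : R := \int[mu]_y (f y * g (x - y)).

(* The elements of W^{1,1}(R) are bounded and the kernels have integral 1, so
   for them this is the supremum of a nonempty bounded set of reals. *)
Definition maximal_function phi u x : R :=
  sup [set convolution (fun y => `|u y|) (dilation phi t) x | t in [set t | 0 < t]].

End defs.

(* Main.v *)
(* Write f = |u| and F for the maximal function of u. The kernel phi_t(x), as a
   function of (x, t), solves the elliptic (or, for the heat kernel, parabolic)
   equation K_xx + a K_tt + (b / t) K_t = 0. At a point where F > f the supremum
   over t is attained, so the maximum principle makes F convex on every component
   of {F > f}. Let g = F - f.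

   Since F is convex where g > 0, for every constant c the derivative of min(g, eps)
   is bounded, up to boundary terms of size eps, by twice the variation of f - c x.
   This gives F' in L^1. Approximating f' in L^1 by step functions, it also shows
   that |F' - f'| has small integral over {0 < g < eps} when eps is small, uniformly
   for all obstacles f_j with f_j' close to f' in L^1. On {g >= eps}, which is bounded
   because F vanishes at infinity, the difference quotients of the convex functions
   F_j squeeze F_j', and F_j' -> F' by dominated convergence. On the rest F_j' and
   F' are compared with f_j' and f', and |u_j|' -> |u|' in L^1. *)

From HB Require Import structures.
From mathcomp Require Import ring lra measurable_realfun.
Require Import Defs.
Set Implicit Arguments.
Unset Strict Implicit.
Unset Printing Implicit Defensive.
Local Open Scope classical_set_scope.
Local Open Scope ring_scope.

(** The difficulty is the free boundary of {F > f}: uniform convergence F_j -> F says nothing about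
    F_j' where the gap is small, and the contact sets of F_j and F need not be close. The loss there
    must be bounded uniformly in j, by f' alone. The variation of f itself would only give a bound
    of order one. Subtracting c x keeps convexity and replaces f' by f' - c, which is small in L^1
    on each step of a step function close to f'. Every step costs 2 eps of boundary terms, so the
    step function is fixed first, independently of j, and eps afterwards, against the number of
    steps.

    Derivatives are handled through increments: an inequality is proved on short intervals by
    uniform continuity, telescoped, and its error sent to 0. Pointwise derivatives are read along
    the steps 1/(n+1) and enter by Lebesgue differentiation, Fatou's lemma and dominated
    convergence. The weak derivatives of the statement are exchanged for such increments at the
    start and recovered at the end by uniqueness almost everywhere. *)

Notation integrableR v :=
  (lebesgue_measure.-integrable [set: _] (EFin \o v)).

(** * Absolutely continuous functions through their increments *)

Definition unifc {R : realType} (f : R -> R) : Prop :=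
  forall e : R, 0 < e -> exists2 d : R, 0 < d &
    forall x y, `|x - y| < d -> `|f x - f y| <= e.

Definition cumul {R : realType} (v : R -> R) (x : R) : R :=
  \int[lebesgue_measure]_(z in `]-oo, x]) v z.

(** Absolute continuity with an integrable derivative. Integrability of [F] is not part of it,
    because the maximal function of a nonzero [u] decays only like 1/|x|. Differences of [cumul]
    make the formula valid for either order of [x] and [y]. *)
Definition primitive {R : realType} (F v : R -> R) : Prop :=
  integrableR v /\ forall x y, F y - F x = cumul v y - cumul v x.

Section cumul.
Context {R : realType}.
Local Notation mu := (@lebesgue_measure R).
Implicit Types (f g v w F G : R -> R) (x y : R).

Lemma integrableRS v (D : set R) : measurable D -> integrableR v ->
  mu.-integrable D (EFin \o v).
Proof. by move=> mD; apply: integrableS. Qed.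

Lemma integrableR_norm v : integrableR v -> integrableR (fun x => `|v x|).
Proof. exact: integrable_norm. Qed.

Lemma integrableRD v w : integrableR v -> integrableR w ->
  integrableR (fun x => v x + w x).
Proof.
move=> iv iw; rewrite (_ : _ \o _ = (EFin \o v) \+ (EFin \o w))%E//.
exact: integrableD.
Qed.

Lemma integrableRB v w : integrableR v -> integrableR w ->
  integrableR (fun x => v x - w x).
Proof.
move=> iv iw; rewrite (_ : _ \o _ = (EFin \o v) \- (EFin \o w))%E//.
exact: integrableB.
Qed.

Lemma integrableRZ k v : integrableR v -> integrableR (fun x => k * v x).
Proof.
move=> iv; rewrite (_ : _ \o _ = (fun x => k%:E * (EFin \o v) x))%E//.
exact: integrableZl.
Qed.

Lemma integrableR_meas v : integrableR v -> measurable_fun setT v.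
Proof. by move=> /integrableP[/measurable_EFinP]. Qed.

Lemma integrableR_le v w : measurable_fun setT v -> integrableR w ->
  (forall x, `|v x| <= w x) -> integrableR v.
Proof.
move=> mv iw vw; apply: le_integrable iw => //; first exact/measurable_EFinP.
by move=> x _; rewrite lee_fin (le_trans (vw x))// ler_norm.
Qed.

Lemma integrableRMb v w (C : R) : measurable_fun setT w -> integrableR v ->
  (forall x, `|w x| <= C) -> integrableR (fun x => v x * w x).
Proof.
move=> mw iv wC; apply: (@integrableR_le _ (fun x => C * `|v x|)).
- by apply: measurable_funM => //; exact: integrableR_meas.
- exact/integrableRZ/integrableR_norm.
- by move=> x; rewrite normrM mulrC ler_wpM2r.
Qed.

Lemma integrableR_indic v (A : set R) : measurable A -> integrableR v ->
  integrableR (fun x => v x * \1_A x).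
Proof.
move=> mA iv; apply: (@integrableRMb _ _ 1) => // x.
by rewrite indicE; case: (_ \in _); rewrite ?normr1 ?normr0.
Qed.

Lemma cumulB v x y : integrableR v -> x <= y ->
  cumul v y - cumul v x = \int[mu]_(z in `]x, y]) v z.
Proof.
by move=> iv xy; rewrite /cumul Rintegral_itvB//; exact: integrableRS.
Qed.

Lemma cumulD v w x : integrableR v -> integrableR w ->
  cumul (fun z => v z + w z) x = cumul v x + cumul w x.
Proof. by move=> iv iw; rewrite /cumul RintegralD//; exact: integrableRS. Qed.

Lemma cumulN v w x : integrableR v -> integrableR w ->
  cumul (fun z => v z - w z) x = cumul v x - cumul w x.
Proof. by move=> iv iw; rewrite /cumul RintegralB//; exact: integrableRS. Qed.

Lemma cumulZ v k x : integrableR v ->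
  cumul (fun z => k * v z) x = k * cumul v x.
Proof. by move=> iv; rewrite /cumul RintegralZl//; exact: integrableRS. Qed.

Lemma le_cumul v w x y : integrableR v -> integrableR w -> x <= y ->
  (forall z, x <= z <= y -> v z <= w z) ->
  cumul v y - cumul v x <= cumul w y - cumul w x.
Proof.
move=> iv iw xy vw; rewrite !cumulB// le_Rintegral//; try exact: integrableRS.
by move=> z /=; rewrite in_itv/= => /andP[/ltW xz zy]; apply: vw; rewrite xz.
Qed.

Lemma eq_cumul v w x y : integrableR v -> integrableR w -> x <= y ->
  (forall z, x <= z <= y -> v z = w z) ->
  cumul v y - cumul v x = cumul w y - cumul w x.
Proof.
by move=> iv iw xy vw; apply/eqP; rewrite eq_le !le_cumul// => z /vw ->.
Qed.

Lemma cumul_nd v x y : integrableR v -> x <= y -> (forall z, 0 <= v z) ->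
  cumul v x <= cumul v y.
Proof.
by move=> iv xy v0; rewrite -subr_ge0 cumulB// Rintegral_ge0.
Qed.

Lemma norm_cumul v x y : integrableR v -> x <= y ->
  `|cumul v y - cumul v x| <=
  cumul (fun z => `|v z|) y - cumul (fun z => `|v z|) x.
Proof.
move=> iv xy; rewrite !cumulB//; last exact: integrableR_norm.
by rewrite le_normr_Rintegral//; exact: integrableRS.
Qed.

Lemma bounded_integrable (D : set R) v (C : R) : measurable D ->
  (mu D < +oo)%E -> measurable_fun D v -> (forall x, D x -> `|v x| <= C) ->
  mu.-integrable D (EFin \o v).
Proof.
move=> mD Dy mv vC; apply: measurable_bounded_integrable => //.
exists C; split; first exact: num_real.
by move=> M CM x Dx /=; rewrite (le_trans (vC x Dx))// ltW.
Qed.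

Lemma mu_itvoc x y : x <= y -> mu [set` `]x, y]] = (y - x)%:E.
Proof.
move=> xy; rewrite lebesgue_measure_itv/= lte_fin.
by case: ltgtP xy => // -> _; rewrite subrr.
Qed.

Lemma cumul_cst_le v (c x y : R) : integrableR v -> x <= y ->
  (forall z, x <= z <= y -> v z <= c) ->
  cumul v y - cumul v x <= c * (y - x).
Proof.
move=> iv xy vc; rewrite cumulB//.
have mxy := mu_itvoc xy.
have -> : c * (y - x) = \int[mu]_(z in `]x, y]) c.
  by rewrite Rintegral_cst//= mxy.
apply: le_Rintegral => //; first exact: integrableRS.
- apply: (@bounded_integrable _ (cst c) `|c|) => //.
  by have := ltry (y - x); rewrite -mxy.
- by move=> z /=; rewrite in_itv/= => /andP[/ltW xz zy]; apply: vc; rewrite xz.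
Qed.

Lemma cumul_unif v e : integrableR v -> 0 < e -> exists2 d : R, 0 < d &
  forall x y, x <= y -> y - x < d ->
  cumul (fun z => `|v z|) y - cumul (fun z => `|v z|) x <= e.
Proof.
move=> iv e0; have [d [d0 dP]] := integral_normr_continuous iv e0.
exists d => // x y xy yx; rewrite cumulB//; last exact: integrableR_norm.
by apply/ltW/dP => //; rewrite [X in (X < _)%E](mu_itvoc xy) lte_fin.
Qed.

Lemma cumul_le_total v x y : integrableR v -> x <= y -> (forall z, 0 <= v z) ->
  cumul v y - cumul v x <= \int[mu]_z v z.
Proof.
move=> iv xy v0; rewrite cumulB// -lee_fin.
rewrite /Rintegral !fineK; try exact: integrable_fin_num (integrableRS _ _).
apply: ge0_subset_integral => //.
- exact: measurable_int iv.
- by move=> z _; rewrite lee_fin.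
Qed.

Lemma aeS (P Q : R -> Prop) : (forall x, P x -> Q x) ->
  {ae mu, forall x, P x} -> {ae mu, forall x, Q x}.
Proof. by move=> PQ; apply: filterS PQ; exact: (ae_filter_ringOfSetsType mu). Qed.

Lemma aeI (P Q : R -> Prop) : {ae mu, forall x, P x} ->
  {ae mu, forall x, Q x} -> {ae mu, forall x, P x /\ Q x}.
Proof. move=> aP aQ; apply: filterI aP aQ; exact: (ae_filter_ringOfSetsType mu). Qed.

Lemma dominated_cvgR (f_ : nat -> R -> R) f g :
  (forall n, measurable_fun setT (f_ n)) -> measurable_fun setT f ->
  {ae mu, forall x, f_ ^~ x @ \oo --> f x} -> integrableR g ->
  {ae mu, forall x n, `|f_ n x| <= g x} ->
  integrableR f /\ \int[mu]_x f_ n x @[n --> \oo] --> \int[mu]_x f x.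
Proof.
move=> mf_ mf ff ig fg.
have [intf _ cf] := @dominated_convergence _ _ _ mu setT measurableT
  (fun n x => (f_ n x)%:E) (EFin \o f) (EFin \o g)
  (fun n => (measurable_EFinP _ _).2 (mf_ n)) ((measurable_EFinP _ _).2 mf)
  ltac:(by apply: aeS ff => x fx _; apply: cvg_EFin; [exact: nearW|exact: fx])
  ig ltac:(by apply: aeS fg => x fx n _; rewrite lee_fin; exact: fx).
split=> //; apply: fine_cvg; rewrite fineK; last exact: integrable_fin_num.
exact: cf.
Qed.

Lemma primitive_unifc F v : primitive F v -> unifc F.
Proof.
move=> [iv Fv] e e0; have [d d0 dP] := cumul_unif iv e0.
have H x y : x <= y -> y - x < d -> `|F y - F x| <= e.
  by move=> xy yx; rewrite Fv (le_trans (norm_cumul iv xy))// dP.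
exists d => // x y; have [xy|/ltW yx] := leP x y.
  by move=> xyd; rewrite distrC H// -(ger0_norm (_ : 0 <= y - x)) ?subr_ge0// distrC.
by move=> xyd; rewrite H// -(ger0_norm (_ : 0 <= x - y)) ?subr_ge0.
Qed.

Lemma unifc_continuous F : unifc F -> continuous F.
Proof.
move=> uF x; apply/cvgrPdist_le => /= e e0; have [d d0 dP] := uF _ e0.
by exists d => // y /=; exact: dP.
Qed.

Lemma primitive_continuous F v : primitive F v -> continuous F.
Proof. by move=> /primitive_unifc/unifc_continuous. Qed.

Lemma primitive_cumul v : integrableR v -> primitive (cumul v) v.
Proof. by []. Qed.

Lemma primitiveD F v G w : primitive F v -> primitive G w ->
  primitive (fun x => F x + G x) (fun x => v x + w x).
Proof.
move=> [iv Fv] [iw Gw]; split; first exact: integrableRD.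
by move=> x y; rewrite !cumulD//; have := Fv x y; have := Gw x y; lra.
Qed.

Lemma primitiveB F v G w : primitive F v -> primitive G w ->
  primitive (fun x => F x - G x) (fun x => v x - w x).
Proof.
move=> [iv Fv] [iw Gw]; split; first exact: integrableRB.
by move=> x y; rewrite !cumulN//; have := Fv x y; have := Gw x y; lra.
Qed.

Lemma primitive_derive F v : primitive F v ->
  {ae mu, forall x, derivable F x 1 /\ derive1 F x = v x}.
Proof.
move=> [iv Fv]; have lv : locally_integrable [set: R] v.
  exact: open_integrable_locally openT iv.
have FE : F = (fun x => cumul v x + (F 0 - cumul v 0)).
  by apply/funext => x; have := Fv 0 x; lra.
have := FTC1Ny (fun y => integrableRS (measurable_itv _) iv) lv.
apply: aeS => x []; rewrite -/(cumul v) => dv vx.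
have d2 : is_derive x 1 F (v x).
  rewrite FE -[v x]addr0; apply: is_deriveD.
  by apply: (DeriveDef dv); rewrite -derive1E.
by split; [exact: ex_derive|rewrite derive1E; exact: derive_val].
Qed.

(** Increments add up, so a bound at scale [r] propagates to all scales by the triangle inequality.
    With [W] a small multiple of a fixed function, this makes a local error estimate global. *)
Lemma chain_increment (G W : R -> R) (r : R) : 0 < r ->
  (forall x y, x <= y -> y - x < r -> `|G y - G x| <= W y - W x) ->
  forall x y, x <= y -> `|G y - G x| <= W y - W x.
Proof.
move=> r0 H x y xy; pose s := r / 2; have s0 : 0 < s by rewrite /s; lra.
have [n nr] : exists n : nat, y - x < n%:R * s.
  exists (Num.truncn ((y - x) / s)).+1.
  by rewrite -ltr_pdivrMr//; exact: truncnS_gt.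
elim: n x xy nr => [|n IH] x xy; first by rewrite mul0r; have := xy; lra.
rewrite -natr1 mulrDl mul1r => nr.
have [yx|yx] := ltP (y - x) r; first exact: H.
have h : `|G (x + s) - G x| <= W (x + s) - W x.
  by apply: H; rewrite /s in s0 *; lra.
have k : `|G y - G (x + s)| <= W y - W (x + s) by apply: IH; rewrite /s in nr *; lra.
have := ler_normD (G y - G (x + s)) (G (x + s) - G x).
by rewrite addrA subrK; lra.
Qed.

End cumul.

Lemma scale_E {R : realType} (k x : R) : k *: (x : R^o) = k * x.
Proof. by []. Qed.

(** * Calculus rules for derivatives of real functions *)

Section real_derivatives.
Context {R : realType}.
Implicit Types (f g : R -> R) (x a b k : R).

Lemma is_derive1_add f g x a b : is_derive x 1 f a -> is_derive x 1 g b ->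
  is_derive x 1 (fun z => f z + g z) (a + b).
Proof. exact: is_deriveD. Qed.

Lemma is_derive1_sub f g x a b : is_derive x 1 f a -> is_derive x 1 g b ->
  is_derive x 1 (fun z => f z - g z) (a - b).
Proof. exact: is_deriveB. Qed.

Lemma is_derive1_scale f k x a : is_derive x 1 f a ->
  is_derive x 1 (fun z => k * f z) (k * a).
Proof. exact: is_deriveZ. Qed.

Lemma is_derive1_mul f g x a b : is_derive x 1 f a -> is_derive x 1 g b ->
  is_derive x 1 (fun z => f z * g z) (a * g x + f x * b).
Proof.
move=> fa gb; apply: is_derive_eq (is_deriveM fa gb) _.
by rewrite !scale_E addrC [a * _]mulrC.
Qed.

Lemma is_derive1_compose f g x a b : is_derive x 1 f a -> is_derive (f x) 1 g b ->
  is_derive x 1 (fun z => g (f z)) (b * a).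
Proof. by move=> fa gb; exact: (is_derive1_comp gb fa). Qed.

Lemma is_derive1_inv f x a : f x != 0 -> is_derive x 1 f a ->
  is_derive x 1 (fun z => (f z)^-1) (- a / (f x) ^+ 2).
Proof.
move=> f0 fa; apply: is_derive_eq (is_deriveV f0 fa) _.
by rewrite scale_E mulrC mulNr mulrN.
Qed.

Lemma is_derive1_pow f n x a : is_derive x 1 f a ->
  is_derive x 1 (fun z => f z ^+ n) (n%:R * f x ^+ n.-1 * a).
Proof.
by move=> fa; rewrite -exprfctE; exact: is_deriveX.
Qed.

Lemma is_derive1_affine (s a x : R) : is_derive x 1 (fun z => s * (z - a)) s.
Proof.
rewrite -[X in is_derive _ _ _ X]mulr1; apply: is_derive1_scale.
by rewrite -[X in is_derive _ _ _ X](subr0 1); exact: is_derive1_sub.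
Qed.

Lemma is_derive1_near f g x a : (\near x, f x = g x) ->
  is_derive x 1 f a -> is_derive x 1 g a.
Proof. exact: near_eq_is_derive. Qed.

Lemma derive1_eq f f' : (forall x, is_derive x 1 f (f' x)) -> derive1 f = f'.
Proof. by move=> ff'; apply/funext => x; rewrite derive1E; exact: derive_val. Qed.

Lemma is_derive1_continuous f f' : (forall x, is_derive x 1 f (f' x)) ->
  continuous f.
Proof.
move=> ff' x; apply/differentiable_continuous/derivable1_diffP.
by case: (ff' x).
Qed.

End real_derivatives.

(** * Smooth bump functions *)

Section smooth_functions.
Context {R : realType}.
Local Notation mu := (@lebesgue_measure R).
Implicit Types (f g : R -> R) (x y z a b k s : R).

Definition smooth f := forall n x, derivable (derive1n n f) x 1.

Lemma smooth_derivative f f' : (forall x, is_derive x 1 f (f' x)) ->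
  smooth f' -> smooth f.
Proof.
move=> ff' sf' [|n] x; first by case: (ff' x).
by rewrite derive1Sn (derive1_eq ff').
Qed.

(** The classical flat function exp(-k/z), with powers of 1/z added so that the linear span of the
    family is closed under differentiation. *)
Definition flat k n z : R := if 0 < z then (z^-1) ^+ n * expR (- (k / z)) else 0.

(** With m = n + 1, the inequality 1 + s <= exp s at s = k y / m gives k y / m <= exp(k y / m);
    raise this to the power m. *)
Lemma expRN_powM_le k n y : 0 < k -> 0 <= y ->
  y ^+ n.+1 * expR (- (k * y)) <= (n.+1%:R / k) ^+ n.+1.
Proof.
move=> k0 y0; have n0 : 0 < n.+1%:R :> R by [].
have -> : - (k * y) = n.+1%:R * - (k * y / n.+1%:R).
  by rewrite mulrN [X in - X = _]mulrC [X in _ = - X]mulrC divfK ?gt_eqF// mulrC.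
rewrite expRM_natl -exprMn lerXn2r ?nnegrE ?mulr_ge0 ?expR_ge0 ?divr_ge0 ?invr_ge0 ?(ltW k0)//.
rewrite expRN ler_pdivrMr ?expR_gt0//.
rewrite [leLHS](_ : y = n.+1%:R / k * (k * y / n.+1%:R)); last first.
  by field; rewrite !gt_eqF// nat1r.
rewrite ler_wpM2l ?divr_ge0 ?(ltW k0)//.
by apply: le_trans (expR_ge1Dx _); rewrite lerDr.
Qed.

Lemma norm_flat_le k n z : 0 < k ->
  `|flat k n z| <= (n.+1%:R / k) ^+ n.+1 * `|z|.
Proof.
move=> k0; rewrite /flat; case: ltP => z0; last first.
  by rewrite normr0 mulr_ge0// exprn_ge0// divr_ge0// ltW.
rewrite ger0_norm ?mulr_ge0 ?expR_ge0 ?exprn_ge0 ?invr_ge0 ?(ltW z0)//.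
rewrite gtr0_norm//.
have := @expRN_powM_le k n z^-1 k0; rewrite invr_ge0 (ltW z0) => /(_ isT).
rewrite -(ler_pM2r z0); apply: le_trans; rewrite exprSr.
move: (_ ^+ n) (expR _) => p e.
by rewrite mulrAC -!mulrA [z^-1 * _]mulrA mulVf ?gt_eqF// mul1r mulrC.
Qed.

Lemma is_derive_flat k n z : 0 < k ->
  is_derive z 1 (flat k n) (k * flat k n.+2 z - n%:R * flat k n.+1 z).
Proof.
move=> k0; have [z0|z0|->] := ltgtP z 0.
- have -> : k * flat k n.+2 z - n%:R * flat k n.+1 z = 0.
    by rewrite /flat ltNge (ltW z0)/= !mulr0 subrr.
  apply: (@is_derive1_near _ (cst 0)).
  near=> w; rewrite /flat ifF//; apply/negbTE; rewrite -leNgt ltW//.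
  by near: w; exact: lt_nbhsl.
- have zn0 : z != 0 by rewrite gt_eqF.
  apply: (@is_derive1_near _ (fun w => (w^-1) ^+ n * expR (- k * w^-1))).
    near=> w; rewrite /flat ifT ?mulNr//.
    by near: w; exact: lt_nbhsr.
  have dV : is_derive z 1 (fun w : R => w^-1) (- 1 / z ^+ 2).
    exact: (@is_derive1_inv _ id).
  have dE : is_derive z 1 (fun w => expR (- k * w^-1))
      (expR (- k * z^-1) * (- k * (- 1 / z ^+ 2))).
    exact: (is_derive1_compose (is_derive1_scale (- k) dV)).
  apply: is_derive_eq (is_derive1_mul (is_derive1_pow n dV) dE) _.
  rewrite /flat z0 -exprVn !mulNr.
  case: n => [|n]; first by rewrite !mul0r !expr0; ring.
  by rewrite !exprS/=; ring.
(* At 0 the difference quotient of [flat k n] is [flat k n.+1], which tends to 0 by the linear bound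
   [norm_flat_le]. *)
- have -> : k * flat k n.+2 0 - n%:R * flat k n.+1 0 = 0.
    by rewrite /flat ltxx !mulr0 subrr.
  apply/is_derive1_caratheodory; exists (flat k n.+1); split.
  + move=> y; rewrite /flat ltxx !subr0; case: ltP => y0; last by rewrite mul0r.
    by rewrite exprSr [RHS]mulrAC -[X in _ = X * _]mulrA mulVf ?mulr1// gt_eqF.
  + have f0 : flat k n.+1 0 = 0 by rewrite /flat ltxx.
    apply/cvgrPdist_le => /= e e0.
    have C0 : 0 < (n.+2%:R / k) ^+ n.+2 by rewrite exprn_gt0 ?divr_gt0.
    exists (((n.+2%:R / k) ^+ n.+2)^-1 * e); first by rewrite /= mulr_gt0 ?invr_gt0.
    move=> w /=; rewrite f0 !sub0r !normrN => /ltW; rewrite ler_pdivlMl// => wC.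
    exact: le_trans (norm_flat_le _ _ k0) wC.
  + by rewrite /flat ltxx.
Unshelve. all: by end_near. Qed.

(** The class contains a derivative of each of its members, so all members are smooth by induction
    on the order, without formulas for higher derivatives. *)
Inductive flat_algebra : (R -> R) -> Prop :=
| flat_algebra_flat k n s a : 0 < k -> flat_algebra (fun z => flat k n (s * (z - a)))
| flat_algebra_scale c f : flat_algebra f -> flat_algebra (fun z => c * f z)
| flat_algebra_add f g :
    flat_algebra f -> flat_algebra g -> flat_algebra (fun z => f z + g z)
| flat_algebra_mul f g :
    flat_algebra f -> flat_algebra g -> flat_algebra (fun z => f z * g z).

Lemma flat_algebra_derive f : flat_algebra f ->
  exists2 f', flat_algebra f' & forall x, is_derive x 1 f (f' x).
Proof.
elim=> {f} [k n s a k0|c f _ [f' af' ff']|f g _ [f' af' ff'] _ [g' ag' gg']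
           |f g af [f' af' ff'] ag [g' ag' gg']].
- exists (fun z => s * (k * flat k n.+2 (s * (z - a))
    + (- n%:R) * flat k n.+1 (s * (z - a)))).
    by apply/flat_algebra_scale/flat_algebra_add;
      apply/flat_algebra_scale/flat_algebra_flat.
  move=> x; rewrite mulNr mulrC.
  exact: (is_derive1_compose (is_derive1_affine s a x) (is_derive_flat _ _ k0)).
- exists (fun z => c * f' z); first exact: flat_algebra_scale.
  by move=> x; exact: is_derive1_scale.
- exists (fun z => f' z + g' z); first exact: flat_algebra_add.
  by move=> x; exact: is_derive1_add.
- exists (fun z => f' z * g z + f z * g' z).
    by apply: flat_algebra_add; exact: flat_algebra_mul.
  by move=> x; exact: is_derive1_mul.
Qed.

Lemma flat_algebra_smooth f : flat_algebra f -> smooth f.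
Proof.
move=> af n; elim: n f af => [|n IH] f /flat_algebra_derive[f' af' ff'] x.
  by case: (ff' x).
by rewrite derive1Sn (derive1_eq ff'); exact: IH.
Qed.

(** The parameter [k] controls sharpness: as k -> 0 the bump tends to 1 on the whole open interval,
    which lets test functions approach indicators. *)
Definition bump k a b z : R := flat k 0 (1 * (z - a)) * flat k 0 (-1 * (z - b)).

Lemma bump_smooth k a b : 0 < k -> flat_algebra (bump k a b).
Proof. by move=> k0; apply: flat_algebra_mul; exact: flat_algebra_flat. Qed.

Lemma bump_gt0 k a b z : a < z < b -> 0 < bump k a b z.
Proof.
move=> /andP[az zb]; rewrite /bump /flat !expr0 !mul1r mulN1r opprB !subr_gt0.
by rewrite az zb mulr_gt0// expR_gt0.
Qed.

Lemma bump_eq0 k a b z : ~~ (a < z < b) -> bump k a b z = 0.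
Proof.
rewrite negb_and /bump /flat mul1r mulN1r opprB !subr_gt0.
by move=> /orP[]/negbTE ->; rewrite ?mul0r ?mulr0.
Qed.

Lemma bump_ge0 k a b z : 0 <= bump k a b z.
Proof.
have [/bump_gt0/ltW//|/bump_eq0->//] := boolP (a < z < b).
Qed.

Lemma flat_le1 k z : 0 < k -> 0 <= flat k 0 z <= 1.
Proof.
move=> k0; rewrite /flat; case: ltP => z0; last by rewrite lexx ler01.
by rewrite expr0 mul1r expR_ge0/= expRN invf_le1 ?expR_gt0// -expR0 ler_expR divr_ge0 ?ltW.
Qed.

Lemma bump_le1 k a b z : 0 < k -> bump k a b z <= 1.
Proof.
move=> k0; rewrite /bump.
have /andP[? ?] := flat_le1 (1 * (z - a)) k0.
have /andP[? ?] := flat_le1 (-1 * (z - b)) k0.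
by rewrite mulr_ile1.
Qed.

Lemma bump_continuous k a b : 0 < k -> continuous (bump k a b).
Proof.
move=> k0; have [f' _ ff'] := flat_algebra_derive (bump_smooth a b k0).
exact: is_derive1_continuous ff'.
Qed.

Lemma bump_cvg a b z : 0 < z - a -> 0 < b - z ->
  bump n.+1%:R^-1 a b z @[n --> \oo] --> (1 : R).
Proof.
move=> az zb; rewrite (_ : (fun n : nat => _) = (fun n =>
    expR (- (((z - a)^-1 + (b - z)^-1) * n.+1%:R^-1)))); last first.
  apply/funext => n; rewrite /bump /flat mul1r mulN1r opprB az zb.
  by rewrite !expr0 !mul1r -expRD; congr expR; ring.
suff : expR (- (((z - a)^-1 + (b - z)^-1) * n.+1%:R^-1)) @[n --> \oo] -->
    expR (- (((z - a)^-1 + (b - z)^-1) * 0)) by rewrite mulr0 oppr0 expR0.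
apply: cvg_comp; last exact: continuous_expR.
by apply: cvgN; apply: cvgM; [exact: cvg_cst|exact: cvg_harmonic].
Qed.

End smooth_functions.

(** * From increments to weak derivatives *)

Section weak_derivatives.
Context {R : realType}.
Local Notation mu := (@lebesgue_measure R).
Implicit Types (f g u v w F eta : R -> R) (x y z a b : R).

Lemma le0_mul_small (a D : R) : (forall e : R, 0 < e -> a <= e * D) -> a <= 0.
Proof.
move=> H; rewrite leNgt; apply/negP => a0.
have D0 : 0 < `|D| + 1 by have := normr_ge0 D; lra.
have := H (a / 2 / (`|D| + 1)) ltac:(by rewrite !divr_gt0).
rewrite leNgt => /negP; apply.
apply: (@le_lt_trans _ _ (a / 2 / (`|D| + 1) * (`|D| + 1))).
  by rewrite ler_wpM2l ?divr_ge0 ?(ltW a0) ?(ltW D0)// (le_trans (ler_norm _))// lerDl.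
by rewrite divfK ?gt_eqF//; lra.
Qed.

Lemma cumul_is_derive v x : integrableR v -> continuous v ->
  is_derive x 1 (cumul v) (v x).
Proof.
move=> iv cv; have xx1 : x < x + 1 by rewrite ltrDl.
have [] := @continuous_FTC1 R v -oo%O x (x + 1) xx1 (integrableRS (measurable_itv _) iv)
  (ltNyr _) (cv x).
rewrite -/(cumul v) => dx vx.
by apply: (DeriveDef dx); rewrite -derive1E vx.
Qed.

Lemma C1_primitive f f' : (forall x, is_derive x 1 f (f' x)) ->
  continuous f' -> integrableR f' -> primitive f f'.
Proof.
move=> ff' cf' if'; split=> // x y.
have d0 z : is_derive z 1 (fun t => f t - cumul f' t) 0.
  rewrite -[X in is_derive _ _ _ X](subrr (f' z)).
  by apply: is_derive1_sub => //; exact: cumul_is_derive.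
by have := is_derive_0_is_cst x y d0; lra.
Qed.

Lemma primitive_bounded F v : primitive F v -> exists C : R, forall x, `|F x| <= C.
Proof.
move=> [iv Fv]; exists (`|F 0| + \int[mu]_z `|v z|) => x.
have ->  : F x = F 0 + (cumul v x - cumul v 0) by rewrite -Fv; ring.
rewrite (le_trans (ler_normD _ _))// lerD2l.
have [x0|/ltW x0] := leP 0 x.
  rewrite (le_trans (norm_cumul iv x0))// cumul_le_total//.
  exact: integrableR_norm.
rewrite distrC (le_trans (norm_cumul iv x0))// cumul_le_total//.
exact: integrableR_norm.
Qed.

(** With [G] frozen at the right end and [F] at the left end of an interval the product rule for
    increments is exact. On short intervals unfreezing costs at most [e] times the increment of
    [cumul D], by uniform continuity; telescope and let e -> 0. *)
Lemma primitive_mul F v G w : primitive F v -> primitive G w ->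
  primitive (fun x => F x * G x) (fun x => v x * G x + F x * w x).
Proof.
move=> pF pG; have [[iv Fv] [iw Gw]] := (pF, pG).
have [A FA] := primitive_bounded pF; have [B GB] := primitive_bounded pG.
have mF : measurable_fun setT F.
  by apply: continuous_measurable_fun; exact: primitive_continuous pF.
have mG : measurable_fun setT G.
  by apply: continuous_measurable_fun; exact: primitive_continuous pG.
have i1 : integrableR (fun x => v x * G x) by exact: integrableRMb GB.
have i2 : integrableR (fun x => F x * w x).
  under eq_fun do rewrite mulrC; exact: integrableRMb FA.
have iq := integrableRD i1 i2; split=> //.
have [q qE] : {q : R -> R | q = fun x => v x * G x + F x * w x} by eexists.
rewrite -qE in iq *.
pose D z : R := `|v z| + `|w z|.
have iD : integrableR D by apply: integrableRD; exact: integrableR_norm.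
suff H x y : x <= y -> F y * G y - F x * G x = cumul q y - cumul q x.
  move=> x y; have [/H//|/ltW/H] := leP x y; lra.
move=> xy; apply/eqP; rewrite -subr_eq0 -normr_le0.
have -> : F y * G y - F x * G x - (cumul q y - cumul q x)
   = (F y * G y - cumul q y) - (F x * G x - cumul q x) by ring.
apply: (@le0_mul_small _ (cumul D y - cumul D x)) => e e0.
have [d1 d10 Fd] := primitive_unifc pF e0.
have [d2 d20 Gd] := primitive_unifc pG e0.
pose d := Num.min d1 d2; have d0 : 0 < d by rewrite lt_min d10.
rewrite mulrBr; pose W z := e * cumul D z; rewrite -/(W y) -/(W x).
apply: (@chain_increment _ (fun z => F z * G z - cumul q z) W d) => // {xy} {}x {}y xy yx.
have i3 : integrableR (fun z => G y * v z + F x * w z).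
  by apply: integrableRD; exact: integrableRZ.
pose p z := (G y * v z + F x * w z) - q z.
have ip : integrableR p.
  exact: integrableRB.
have -> : F y * G y - cumul q y - (F x * G x - cumul q x) = cumul p y - cumul p x.
  rewrite /p !cumulN// ?cumulD ?cumulZ//; try exact: integrableRZ.
  transitivity ((F y - F x) * G y + F x * (G y - G x) - (cumul q y - cumul q x)).
    by ring.
  by rewrite Fv Gw; ring.
rewrite (le_trans (norm_cumul ip xy))// /W -!cumulZ//.
apply: le_cumul => //; [exact: integrableR_norm|exact: integrableRZ|].
move=> z /andP[xz zy]; rewrite /D mulrDr.
have -> : p z = (G y - G z) * v z + (F x - F z) * w z by rewrite /p qE; ring.
have yz : `|y - z| < d by rewrite ger0_norm ?subr_ge0//; lra.
have xz' : `|x - z| < d by rewrite distrC ger0_norm ?subr_ge0//; lra.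
rewrite (le_trans (ler_normD _ _))// !normrM lerD// ler_wpM2r//.
  by apply: Gd; apply: lt_le_trans yz _; rewrite ge_min lexx orbT.
by apply: Fd; apply: lt_le_trans xz' _; rewrite ge_min lexx.
Qed.

Lemma compact_support_integral w a b : a <= b -> integrableR w ->
  (forall z, ~~ (a < z <= b) -> w z = 0) ->
  \int[mu]_z w z = cumul w b - cumul w a.
Proof.
move=> ab iw w0; rewrite cumulB// [RHS]Rintegral_mkcond; apply: eq_Rintegral => z _.
rewrite patchE; case: ifPn => //; rewrite notin_setE/= in_itv/= => /negP.
exact: w0.
Qed.

Lemma locally_integrable_itv g a b : locally_integrable [set: R] g ->
  integrableR (fun z => g z * \1_(`[a, b]%classic) z).
Proof.
move=> [mg _ ig]; have cab : compact `[a, b] by exact: segment_compact.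
apply/integrableP; split.
  by apply/measurable_EFinP; apply: measurable_funM.
have := ig _ (@subsetT _ _) cab; rewrite integral_mkcond.
apply: le_lt_trans; rewrite le_eqVlt; apply/orP; left; apply/eqP.
apply: eq_integral => z _ /=; rewrite patchE indicE.
by case: ifPn => zab; rewrite /= ?mulr1 ?mulr0 ?normr0.
Qed.

Lemma locally_integrable_mul g f a b : locally_integrable [set: R] g ->
  continuous f -> (forall z, ~~ (a <= z <= b) -> f z = 0) ->
  integrableR (fun z => g z * f z).
Proof.
move=> lg cf f0; have [mg _ _] := lg; have mf : measurable_fun setT f by exact: continuous_measurable_fun.
have cab : compact `[a, b] by exact: segment_compact.
have [C fC] : exists C : R, forall z, `|f z| <= C.
  have [C [_ CP]] : bounded_set (f @` `[a, b]).
    apply: compact_bounded; apply: continuous_compact => //.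
    exact: continuous_subspaceT.
  exists (`|C| + 1) => z; have [zab|zab] := boolP (a <= z <= b).
    apply: (CP (`|C| + 1)); last by exists z => //=; rewrite in_itv.
    by rewrite ltr_pwDr// ler_norm.
  by rewrite f0// normr0 addr_ge0.
have iab := @locally_integrable_itv g a b lg.
apply: (@integrableR_le _ _ (fun z => C * `|g z * \1_(`[a, b]%classic) z|)).
- exact: measurable_funM.
- exact/integrableRZ/integrableR_norm.
- move=> z; rewrite indicE; have [zab|zab] := boolP (a <= z <= b).
    by rewrite mem_set/= ?in_itv//= mulr1 normrM mulrC ler_wpM2r.
  by rewrite f0// mulr0 normr0 mulr_ge0// (le_trans _ (fC z)).
Qed.

Lemma continuous_locally_integrable f : continuous f ->
  locally_integrable [set: R] f.
Proof.
move=> cf; split; [exact: continuous_measurable_fun|exact: openT|move=> K _ cK].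
have /integrableP[_] := continuous_compact_integrable cK (continuous_subspaceT cf).
by [].
Qed.

Lemma cc_integrable f a b : continuous f ->
  (forall z, ~~ (a <= z <= b) -> f z = 0) -> integrableR f.
Proof.
move=> cf f0; have := @locally_integrable_mul (cst 1) f a b.
rewrite /= (_ : (fun z => cst 1 z * f z) = f); last by apply/funext => z; rewrite /= mul1r.
by apply => //; apply: continuous_locally_integrable => z; exact: cvg_cst.
Qed.

Lemma test_function_support eta : test_function eta ->
  exists2 M, 0 < M & forall z, ~~ (- M < z < M) -> eta z = 0.
Proof.
move=> [_ /compact_bounded[C [_ CP]]]; exists (`|C| + 1).
  by rewrite ltr_wpDl.
move=> z; rewrite -ltr_norml -leNgt => zM; apply/eqP; apply: contraTT zM => ez.
rewrite -ltNge; have CC : C < `|C| + 2^-1 by rewrite ltr_pwDr// ?invr_gt0// ler_norm.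
have := CP _ CC z (@subset_closure _ [set x | eta x != 0] z ez).
by move=> /le_lt_trans; apply; lra.
Qed.

Lemma test_function_derive eta : test_function eta ->
  [/\ forall x, is_derive x 1 eta (derive1 eta x),
      continuous eta & continuous (derive1 eta)].
Proof.
move=> [te _]; have d1 x : is_derive x 1 eta (derive1 eta x).
  by apply: DeriveDef; [exact: (te 0%N)|rewrite derive1E].
split=> //; first exact: is_derive1_continuous d1.
apply: (@is_derive1_continuous _ _ (derive1 (derive1 eta))) => x.
by apply: DeriveDef; [exact: (te 1%N)|rewrite [in RHS]derive1E].
Qed.

Lemma test_function_derive_support eta M : test_function eta ->
  (forall z, ~~ (- M < z < M) -> eta z = 0) ->
  forall z, ~~ (- M <= z <= M) -> derive1 eta z = 0.
Proof.
move=> /test_function_derive[d1 _ _] e0 z zM.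
have dz : is_derive z 1 eta 0.
  apply: (@is_derive1_near _ (cst 0)); move: zM; rewrite negb_and -!ltNge => /orP[zM|zM].
    near=> w; rewrite e0//= negb_and -!leNgt ltW//.
    by near: w; exact: lt_nbhsl.
  near=> w; rewrite e0//= negb_and -!leNgt orbC ltW//.
  by near: w; exact: lt_nbhsr.
by rewrite derive1E; exact: derive_val.
Unshelve. all: by end_near. Qed.

(** Integration by parts: [F * eta] is the primitive given by the product rule, and it vanishes at
    both ends of a window around the support. *)
Lemma primitive_is_weak_derivative F v : primitive F v -> is_weak_derivative F v.
Proof.
move=> pF; have cF := primitive_continuous pF; split.
- exact: continuous_locally_integrable.
- by case: pF => iv _; exact: open_integrable_locally openT iv.
move=> eta teta; have [M M0 e0] := test_function_support teta.
have [d1 c0 c1] := test_function_derive teta.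
have e0' := test_function_derive_support teta e0.
have pe : primitive eta (derive1 eta).
  by apply: C1_primitive => //; exact: (cc_integrable c1 e0').
have [iq Fe] := primitive_mul pF pe.
have i1 : integrableR (fun z => v z * eta z).
  have [B eB] := primitive_bounded pe; apply: integrableRMb eB.
    exact: continuous_measurable_fun.
  by case: pF.
have i2 : integrableR (fun z => F z * derive1 eta z).
  exact: locally_integrable_mul (continuous_locally_integrable cF) c1 e0'.
apply/eqP; rewrite -addr_eq0 addrC -RintegralD//.
(* One unit of margin: [derive1 eta] is known to vanish only outside the closed interval [-M, M],
   whereas the window of [compact_support_integral] excludes its left end. *)
rewrite (@compact_support_integral _ (- M - 1) (M + 1)) //; first last.
- move=> z; rewrite negb_and -leNgt -ltNge => zM.
  rewrite e0 ?e0' ?mulr0 ?addr0// negb_and -?leNgt -?ltNge; case/orP: zM; lra.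
- lra.
rewrite -Fe !e0 ?mulr0 ?subrr// negb_and -!leNgt; lra.
Qed.

End weak_derivatives.

(** * Uniqueness of weak derivatives *)

Section uniqueness_of_weak_derivatives.
Context {R : realType}.
Local Notation mu := (@lebesgue_measure R).
Implicit Types (f g u v w F eta : R -> R) (x y z a b e k : R).

Lemma bump_integrable k a b : 0 < k -> integrableR (@bump R k a b).
Proof.
move=> k0; apply: (@cc_integrable _ _ a b); first exact: bump_continuous.
move=> z zab; apply: bump_eq0; apply: contra zab => /andP[/ltW -> /ltW ->//].
Qed.

Lemma bump_integral_gt0 k a b : 0 < k -> a < b -> 0 < \int[mu]_z bump k a b z.
Proof.
move=> k0 ab; have ib := bump_integrable a b k0; have cb := @bump_continuous R k a b k0.
rewrite (@compact_support_integral _ _ a b (ltW ab))//; last first.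
  by move=> z zab; apply: bump_eq0; apply: contra zab => /andP[-> /ltW ->].
have dc x : is_derive x 1 (cumul (bump k a b)) (bump k a b x).
  exact: cumul_is_derive.
have cc : {within `[a, b], continuous (cumul (bump k a b))}.
  by apply: continuous_subspaceT; exact: is_derive1_continuous dc.
have [c] := MVT ab (fun x _ => dc x) cc.
rewrite in_itv/= => /bump_gt0 cb0 ->.
by rewrite mulr_gt0// subr_gt0.
Qed.

Definition nbump e x z : R :=
  (\int[mu]_t bump 1 x (x + e) t)^-1 * bump 1 x (x + e) z.

Lemma nbump_integrable e x : integrableR (nbump e x).
Proof. by apply: integrableRZ; exact: bump_integrable. Qed.

Lemma nbump_continuous e x : continuous (nbump e x).
Proof.
by move=> z; apply: cvgM; [exact: cvg_cst|exact: bump_continuous].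
Qed.

Lemma nbump_eq0 e x z : ~~ (x < z < x + e) -> nbump e x z = 0.
Proof. by move=> xz; rewrite /nbump bump_eq0 ?mulr0. Qed.

Lemma nbump_ge0 e x z : 0 < e -> 0 <= nbump e x z.
Proof.
move=> e0; rewrite mulr_ge0 ?bump_ge0// invr_ge0 ltW//.
by apply: bump_integral_gt0; rewrite ?ltrDl.
Qed.

Lemma nbump_integral e x : 0 < e -> \int[mu]_z nbump e x z = 1.
Proof.
move=> e0; rewrite RintegralZl//; last exact: bump_integrable.
by rewrite mulVf// gt_eqF// bump_integral_gt0// ltrDl.
Qed.

(** The two bumps have equal mass, so the primitive of their difference returns to 0 and has compact
    support. It is, up to sign, a smoothed indicator of the interval between [x] and [y]. *)
Lemma nbump_step_test_function e x y : 0 < e ->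
  let eta := cumul (fun z => nbump e x z - nbump e y z) in
  test_function eta /\ derive1 eta = (fun z => nbump e x z - nbump e y z).
Proof.
move=> e0 eta; pose b z := nbump e x z - nbump e y z; rewrite -/b in eta *.
have ib : integrableR b by apply: integrableRB; exact: nbump_integrable.
have cb : continuous b by move=> z; apply: cvgB; exact: nbump_continuous.
have de z : is_derive z 1 eta (b z) by exact: cumul_is_derive.
split; last exact: derive1_eq.
split.
  apply: smooth_derivative de _; apply: flat_algebra_smooth.
  rewrite (_ : b = fun z => nbump e x z + -1 * nbump e y z); last first.
    by apply/funext => z; rewrite mulN1r.
  apply: flat_algebra_add; [|apply: flat_algebra_scale];
    apply: flat_algebra_scale; exact: bump_smooth.
pose m := Num.min x y; pose M := Num.max x y + e.
have mx : m <= x by rewrite ge_min lexx.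
have my : m <= y by rewrite ge_min lexx orbT.
have xM : x + e <= M by rewrite lerD2r le_max lexx.
have yM : y + e <= M by rewrite lerD2r le_max lexx orbT.
have b0 z : ~~ (m < z < M) -> b z = 0.
  move=> zmM; rewrite /b !nbump_eq0 ?subrr//; apply: contra zmM => /andP[h1 h2];
    by apply/andP; lra.
have etaE z : eta z = \int[mu]_(t in `]-oo, z]) b t by [].
have eta0 z : z <= m -> eta z = 0.
  move=> zm; rewrite etaE (_ : 0 = \int[mu]_(t in `]-oo, z]) cst 0 t).
    apply: eq_Rintegral => t; rewrite inE/= in_itv/= => tz.
    by rewrite b0// negb_and -leNgt (le_trans tz zm).
  by rewrite Rintegral_cst//= mul0r.
have etaM z : M <= z -> eta z = 0.
  move=> Mz; have mM : m <= M by lra.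
  have <- : eta M = eta z.
    apply/eqP; rewrite eq_sym -subr_eq0 cumulB//.
    rewrite (_ : 0 = \int[mu]_(t in `]M, z]) cst 0 t).
      apply/eqP; apply: eq_Rintegral => t; rewrite inE/= in_itv/= => /andP[Mt _].
      by rewrite b0// negb_and -!leNgt (ltW Mt) orbT.
    by rewrite Rintegral_cst//= mul0r.
  have ib0 : \int[mu]_t b t = 0.
    by rewrite RintegralB ?nbump_integral ?subrr//; exact: nbump_integrable.
  have := @compact_support_integral _ b m M mM ib.
  have cm0 : cumul b m = 0 by exact: eta0.
  move=> h; transitivity (cumul b M - cumul b m); first by rewrite cm0 subr0.
  rewrite -h// => t tmM.
  by rewrite b0//; apply: contra tmM => /andP[-> /ltW ->].
apply: (@subclosed_compact _ _ `[m, M]%classic).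
- exact: closed_closure.
- exact: segment_compact.
- rewrite closureEbigcap => t; apply; split; first exact: interval_closed.
  move=> z /=; apply: contra_neqP; rewrite in_itv/= => /negP.
  rewrite negb_and -!ltNge => /orP[/ltW zm|/ltW Mz]; [exact: eta0|exact: etaM].
Qed.

Lemma near_integral_nbump w x e d : continuous w -> 0 < e ->
  (forall z, x <= z <= x + e -> `|w z - w x| <= d) ->
  `|\int[mu]_z (w z * nbump e x z) - w x| <= d.
Proof.
move=> cw e0 wd; have cn := @nbump_continuous e x.
have n0 z : ~~ (x <= z <= x + e) -> nbump e x z = 0.
  by move=> h; apply: nbump_eq0; apply: contra h => /andP[/ltW -> /ltW ->].
have iw : integrableR (fun z => w z * nbump e x z).
  exact: locally_integrable_mul (continuous_locally_integrable cw) cn n0.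
have -> : w x = \int[mu]_z (w x * nbump e x z).
  by rewrite RintegralZl ?nbump_integral ?mulr1//; exact: nbump_integrable.
have inx k : integrableR (fun z => k * nbump e x z).
  by apply: integrableRZ; exact: nbump_integrable.
rewrite -RintegralB//.
have -> : d = \int[mu]_z (d * nbump e x z).
  by rewrite RintegralZl ?nbump_integral ?mulr1//; exact: nbump_integrable.
have ib : integrableR (fun z => w z * nbump e x z - w x * nbump e x z).
  exact: integrableRB.
rewrite (le_trans (le_normr_Rintegral _ _))// le_Rintegral//.
  exact: integrableR_norm.
move=> z _; rewrite -mulrBl normrM (ger0_norm (nbump_ge0 _ _ e0)).
have [/wd|/n0 ->] := boolP (x <= z <= x + e); last by rewrite !mulr0.
by move=> h; rewrite ler_wpM2r// nbump_ge0.
Qed.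

(** Du Bois-Reymond: testing with the smoothed indicator equates the weighted averages of [w] just
    right of [x] and just right of [y]; continuity puts each within [d] of the value of [w]. *)
Lemma weak_derivative_eq0_cst w x y : continuous w ->
  (forall eta, test_function eta -> \int[mu]_z (w z * derive1 eta z) = 0) ->
  w x = w y.
Proof.
move=> cw H; apply/eqP; rewrite -subr_eq0 -normr_le0.
apply: (@le0_mul_small _ _ 2) => d d0.
have [e1 e10 h1] : exists2 e, 0 < e & forall z, x <= z <= x + e -> `|w z - w x| <= d.
  have /cvgrPdist_le/(_ _ d0)[e /= e0 h] := cw x.
  exists (e / 2) => [|z /andP[xz zx]]; first by rewrite divr_gt0.
  by rewrite distrC; apply: h; rewrite /= distrC ger0_norm ?subr_ge0//; lra.
have [e2 e20 h2] : exists2 e, 0 < e & forall z, y <= z <= y + e -> `|w z - w y| <= d.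
  have /cvgrPdist_le/(_ _ d0)[e /= e0 h] := cw y.
  exists (e / 2) => [|z /andP[xz zx]]; first by rewrite divr_gt0.
  by rewrite distrC; apply: h; rewrite /= distrC ger0_norm ?subr_ge0//; lra.
pose e := Num.min e1 e2; have e0 : 0 < e by rewrite lt_min e10.
have ee1 : e <= e1 by rewrite ge_min lexx.
have ee2 : e <= e2 by rewrite ge_min lexx orbT.
have [te de] := @nbump_step_test_function e x y e0.
have := H _ te; rewrite de => H0.
have kx := @near_integral_nbump w x e d cw e0 (fun z hz => h1 z ltac:(lra)).
have ky := @near_integral_nbump w y e d cw e0 (fun z hz => h2 z ltac:(lra)).
have iw t : integrableR (fun z => w z * nbump e t z).
  apply: (locally_integrable_mul (a := t) (b := t + e) (continuous_locally_integrable cw)).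
    exact: nbump_continuous.
  by move=> z h; apply: nbump_eq0; apply: contra h => /andP[/ltW -> /ltW ->].
have HE : \int[mu]_z (w z * nbump e x z) = \int[mu]_z (w z * nbump e y z).
  apply/eqP; rewrite -subr_eq0 -RintegralB//; apply/eqP; rewrite -[RHS]H0.
  by apply: eq_Rintegral => z _; rewrite mulrBr.
rewrite HE in kx; move: kx ky; move: (\int[mu]_z _) => I kx ky.
have := ler_distD I (w x) (w y); rewrite (distrC (w x) I).
by clear -kx ky; lra.
Qed.

(** The continuous function [u - cumul g] has weak derivative zero, hence is constant. *)
Lemma is_weak_derivative_primitive u g : continuous u ->
  is_weak_derivative u g -> integrableR g -> primitive u g.
Proof.
move=> cu [_ _ ug] ig; split=> // x y.
have pG := primitive_cumul ig; have cG := primitive_continuous pG.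
have [_ _ Gg] := primitive_is_weak_derivative pG.
have := @weak_derivative_eq0_cst (fun z => u z - cumul g z) y x.
have H : forall eta, test_function eta ->
    \int[mu]_z ((u z - cumul g z) * derive1 eta z) = 0.
  move=> eta te; have [M _ e0] := test_function_support te.
  have [_ _ c1] := test_function_derive te.
  have e0' := test_function_derive_support te e0.
  under eq_Rintegral do rewrite mulrBl.
  rewrite RintegralB//; first by rewrite ug// Gg// subrr.
    exact: locally_integrable_mul (continuous_locally_integrable cu) c1 e0'.
  exact: locally_integrable_mul (continuous_locally_integrable cG) c1 e0'.
have cw : continuous (fun z => u z - cumul g z).
  by move=> z; apply: cvgB; [exact: cu|exact: cG].
by move=> /(_ cw H); lra.
Qed.

Lemma bump_test_function k a b : 0 < k -> test_function (bump k a b).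
Proof.
move=> k0; split; first exact: flat_algebra_smooth (bump_smooth _ _ k0).
apply: (@subclosed_compact _ _ `[a, b]%classic).
- exact: closed_closure.
- exact: segment_compact.
- rewrite closureEbigcap => t; apply; split; first exact: interval_closed.
  move=> z /=; apply: contra_neqP; rewrite in_itv/= => /negP h.
  by apply: bump_eq0; apply: contra h => /andP[/ltW -> /ltW ->].
Qed.

(** Bumps that sharpen to indicators show that the difference [w] has integral 0 over every bounded
    interval. Its truncated primitive is then locally constant, and Lebesgue differentiation gives w
    = 0 almost everywhere. *)
Lemma weak_derivative_unique f g1 g2 : is_weak_derivative f g1 ->
  is_weak_derivative f g2 -> {ae mu, forall x, g1 x = g2 x}.
Proof.
move=> [_ l1 h1] [_ l2 h2].
have lw := locally_integrableB l1 l2; pose w := (g1 \- g2)%R.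
have [mw _ _] := lw.
have bw k a b : 0 < k -> integrableR (fun z => w z * bump k a b z).
  move=> k0; apply: (locally_integrable_mul (a := a) (b := b) lw).
    exact: bump_continuous.
  by move=> z h; apply: bump_eq0; apply: contra h => /andP[/ltW -> /ltW ->].
have w0 k a b : 0 < k -> \int[mu]_z (w z * bump k a b z) = 0.
  move=> k0; have te := bump_test_function a b k0.
  have E : \int[mu]_z (g1 z * bump k a b z) = \int[mu]_z (g2 z * bump k a b z).
    by apply/oppr_inj; rewrite -h1// -h2.
  under eq_Rintegral do rewrite mulrBl.
  have bg g : locally_integrable setT g -> integrableR (fun z => g z * bump k a b z).
    move=> lg; apply: (locally_integrable_mul (a := a) (b := b) lg).
      exact: bump_continuous.
    by move=> z h; apply: bump_eq0; apply: contra h => /andP[/ltW -> /ltW ->].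
  by rewrite RintegralB ?E ?subrr//; exact: bg.
have J0 a b : \int[mu]_z (w z * \1_(`]a, b[%classic) z) = 0.
  have iwab := @locally_integrable_itv _ w a b lw.
  have mI : measurable_fun setT (fun z => w z * \1_(`]a, b[%classic) z).
    by apply: measurable_funM.
  have [] := @dominated_cvgR _ (fun n z => w z * bump n.+1%:R^-1 a b z)
      (fun z => w z * \1_(`]a, b[%classic) z)
      (fun z => `|w z * \1_(`[a, b]%classic) z|).
  - by move=> n; apply: integrableR_meas; exact: bw.
  - by [].
  - apply: aeW => z; apply: cvgM; first exact: cvg_cst.
    rewrite indicE; have [zab|zab] := boolP (a < z < b).
      by rewrite mem_set/= ?in_itv//=; apply: bump_cvg; rewrite subr_gt0; case/andP: zab.
    rewrite memNset/=; last by rewrite in_itv/=; exact/negP.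
    by under eq_fun do rewrite bump_eq0//; exact: cvg_cst.
  - exact: integrableR_norm.
  - apply: aeW => z n; rewrite normrM [leRHS]normrM ler_wpM2l//.
    rewrite (ger0_norm (bump_ge0 _ _ _ _)) indicE.
    have [zab|zab] := boolP (a < z < b).
      by rewrite mem_set/= ?normr1 ?bump_le1// in_itv/=; lra.
    by rewrite bump_eq0.
  move=> _ /cvg_lim <-//; under eq_fun do rewrite w0//.
  exact: lim_cst.
(* As [w] is only locally integrable, differentiation is applied to its truncation to [-n, n], and
   countably many null sets are united. *)
have ae_n n : {ae mu, forall x, - n%:R < x < n%:R -> g1 x = g2 x}.
  have iwn := @locally_integrable_itv _ w (- n%:R) n%:R lw.
  have := primitive_derive (primitive_cumul iwn).
  apply: aeS => x [_ dx] xn; apply/eqP; rewrite -subr_eq0 -[_ - _]/(w x).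
  move: dx; rewrite indicE mem_set/=; last by rewrite in_itv/=; lra.
  rewrite mulr1 => <-; apply/eqP; rewrite derive1E.
  have -> : 0 = 'D_1 (cst (cumul (fun z => w z * \1_(`[- n%:R, n%:R]%classic) z) x)) x :> R.
    by rewrite derive_cst.
  apply: near_eq_derive; near=> y.
  have yn : - n%:R < y < n%:R.
    by apply/andP; split; near: y; [apply: lt_nbhsr|apply: lt_nbhsl]; lra.
  have H s t : s <= t -> - n%:R < s < n%:R -> - n%:R < t < n%:R ->
      cumul (fun z => w z * \1_(`[- n%:R, n%:R]%classic) z) t =
      cumul (fun z => w z * \1_(`[- n%:R, n%:R]%classic) z) s.
    move=> st sn tn; apply/eqP; rewrite -subr_eq0 cumulB//; apply/eqP.
    rewrite -Rintegral_itv_bndo_bndc; last exact: integrableRS.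
    rewrite Rintegral_mkcond -[RHS](J0 s t); apply: eq_Rintegral => z _.
    rewrite patchE !indicE; case: ifPn => zst; last by rewrite mulr0.
    rewrite mulr1 mem_set ?mulr1//=; move: zst; rewrite inE/= !in_itv/=; lra.
  by have [/H|/ltW/H] := leP x y => -> //=.
have := ae_foralln ae_n; apply: aeS => x /(_ (Num.truncn `|x|).+1); apply; rewrite -ltr_norml.
exact: truncnS_gt.
Unshelve. all: by end_near. Qed.

(** Existence makes the function picked by [xget] a weak derivative; uniqueness then identifies it
    almost everywhere. *)
Lemma weak_derivativeP F v : primitive F v ->
  {ae mu, forall x, weak_derivative F x = v x}.
Proof.
move=> pF; have wF := primitive_is_weak_derivative pF.
apply: (@weak_derivative_unique F) => //.
exact: (@xgetI _ (cst 0) [set g | is_weak_derivative F g] v wF).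
Qed.

End uniqueness_of_weak_derivatives.

(** * Gluing across zero sets; the derivative of |u| *)

Section gluing.
Context {R : realType}.
Local Notation mu := (@lebesgue_measure R).
Implicit Types (f g u v F tau : R -> R) (x y z w a b e : R).

(** A fixed sequence of steps turns derivatives into limits of sequences, the form that Fatou's
    lemma and dominated convergence require. *)
Lemma derivable_cvg_quotient F x : derivable F x 1 ->
  n.+1%:R * (F (x + n.+1%:R^-1) - F x) @[n --> \oo] --> derive1 F x.
Proof.
move=> dF; have : h^-1 *: (F (h + x) - F x) @[h --> 0^'] --> derive1 F x.
  move: dF => /cvg_ex[/= l Fl]; suff -> : derive1 F x = l.
    by move: Fl; under eq_fun do rewrite scaler1.
  by apply: cvg_lim => //; move: Fl; under eq_fun do rewrite scaler1.
move=> /cvgr_dnbhsP/(_ (fun n => n.+1%:R^-1)) H.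
have : (forall n : nat, n.+1%:R^-1 != 0 :> R) /\ n.+1%:R^-1 @[n --> \oo] --> (0 : R).
  split; first by move=> n; rewrite invr_eq0 pnatr_eq0.
  exact: cvg_harmonic.
move=> /H; apply: cvg_trans; apply: near_eq_cvg; apply: nearW => n.
by rewrite /= invrK [_ + x]addrC.
Qed.

Lemma first_zero g x z : continuous g -> x <= z -> g z = 0 ->
  exists c : R, [/\ x <= c <= z, g c = 0 & forall w, x <= w < c -> g w <> 0].
Proof.
move=> cg xz gz; pose A := `[x, z]%classic `&` g @^-1` [set 0].
have cA : compact A.
  apply: (@subclosed_compact _ _ `[x, z]%classic); last by move=> t [].
    apply: closedI; first exact: interval_closed.
    by apply: preimage_closed => [t _|]; [exact: cg|exact: closed_eq].
  exact: segment_compact.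
have A0 : A !=set0 by exists z; split=> //=; rewrite in_itv/= xz lexx.
have cid : {within A, continuous (fun t : R => t)}.
  by apply: continuous_subspaceT => t; exact: cvg_id.
have [c] := compact_EVT_min A0 cA cid.
rewrite inE => -[/=]; rewrite in_itv/= => xcz gc0 cmin; exists c; split=> //.
move=> w /andP[xw wc] gw.
have : c <= w.
  apply: cmin; rewrite inE; split => //=; rewrite in_itv/= xw.
  by case/andP: xcz => _ /(lt_le_trans wc)/ltW.
by rewrite leNgt wc.
Qed.

Lemma last_zero g x z : continuous g -> x <= z -> g x = 0 ->
  exists c : R, [/\ x <= c <= z, g c = 0 & forall w, c < w <= z -> g w <> 0].
Proof.
move=> cg xz gx; have cg' : continuous (fun t => g (- t)).
  by move=> t; apply: continuous_comp; [exact: opp_continuous|exact: cg].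
have [] := @first_zero _ (- z) (- x) cg'; rewrite ?lerN2// ?opprK//.
move=> c [/andP[zc cx] gc h]; exists (- c); split=> //; first by apply/andP; lra.
move=> w wc gw; apply: (h (- w)); first by apply/andP; lra.
by rewrite opprK.
Qed.

(* On a short interval either [g] stays positive or it stays below [e]; so the
   variation of [g - \int tau] is carried by [0 < g < e], for every [e]. *)
Lemma primitive_of_positive_part g tau : unifc g -> (forall x, 0 <= g x) ->
  integrableR tau ->
  (forall x y, x <= y -> (forall z, x <= z <= y -> 0 < g z) ->
     g y - g x = cumul tau y - cumul tau x) ->
  primitive g (fun x => tau x * \1_[set z | 0 < g z] x).
Proof.
move=> ug g0 it H; have cg := unifc_continuous ug.
have mg : measurable_fun setT g by exact: continuous_measurable_fun.
have mA e : measurable [set z | g z < e].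
  by rewrite -[X in measurable X]setTI; exact: (measurable_fun_ltr mg (measurable_cst e)).
have mA0 : measurable [set z | 0 < g z].
  by rewrite -[X in measurable X]setTI; exact: (measurable_fun_ltr (measurable_cst (0 : R)) mg).
have [t tE] : {t : R -> R | t = fun x => tau x * \1_[set z | 0 < g z] x} by eexists.
rewrite -tE; have ti : integrableR t by rewrite tE; exact: integrableR_indic.
split=> //; pose G x := g x - cumul t x.
have cG : continuous G.
  move=> x; apply: cvgB; first exact: cg.
  exact: (primitive_continuous (primitive_cumul ti)).
have G0 x y : x <= y -> (forall z, x <= z <= y -> 0 < g z) -> G x = G y.
  move=> xy gxy; have := H _ _ xy gxy.
  have : cumul t y - cumul t x = cumul tau y - cumul tau x.
    apply: eq_cumul => // z /gxy gz; rewrite tE indicE mem_set ?mulr1//.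
  by rewrite /G; lra.
have iat := integrableR_norm ti.
(* Up to the first zero [c] of [g] in [x, y] and from the last zero [d] on, [G] is constant, by [G0]
   and continuity. Since g c = g d = 0, [G] changes from [c] to [d] only by an integral of [t]. *)
have G1 x y : x <= y -> `|G y - G x| <= cumul (fun z => `|t z|) y - cumul (fun z => `|t z|) x.
  move=> xy; have [hz|nz] := pselect (exists2 z, x <= z <= y & g z = 0); last first.
    rewrite -(G0 x y) ?subrr ?normr0 ?subr_ge0 ?cumul_nd// => z zxy.
    by rewrite lt_neqAle g0 andbT; apply/eqP => gz; apply: nz; exists z.
  have [z /andP[xz zy] gz] := hz.
  have [c [/andP[xc cz] gc c0]] := first_zero cg xz gz.
  have [d [/andP[zd dy] gd d0]] := last_zero cg zy gz.
  have Gc : G c = G x.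
    have [xc'|cx] := ltP x c; last by congr G; lra.
    suff : G w @[w --> c^'-] --> G x.
      move=> /cvg_lim <-//; apply/esym/cvg_lim => //.
      exact: cvg_at_left_filter (cG c).
    apply: (@cvg_trans _ (G x @[w --> c^'-])); last exact: cvg_cst.
    apply: near_eq_cvg; near=> w.
    have xw : x < w by near: w; exact: nbhs_left_gt.
    have wc : w < c by near: w; exact: nbhs_left_lt.
    apply: G0; first exact: ltW.
    move=> s /andP[xs sw]; rewrite lt_neqAle g0 andbT eq_sym.
    by apply/eqP/c0; rewrite xs (le_lt_trans sw).
  have Gd : G d = G y.
    have [dy'|yd] := ltP d y; last by congr G; lra.
    suff : G w @[w --> d^'+] --> G y.
      move=> /cvg_lim <-//; apply/esym/cvg_lim => //.
      exact: cvg_at_right_filter (cG d).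
    apply: (@cvg_trans _ (G y @[w --> d^'+])); last exact: cvg_cst.
    apply: near_eq_cvg; near=> w.
    have wy : w < y by near: w; exact: nbhs_right_lt.
    have dw : d < w by near: w; exact: nbhs_right_gt.
    apply/esym/G0; first exact: ltW.
    move=> s /andP[ws sy]; rewrite lt_neqAle g0 andbT eq_sym.
    by apply/eqP/d0; rewrite sy (lt_le_trans dw).
  have cd : c <= d by lra.
  rewrite -Gc -Gd {1}/G {1}/G gc gd.
  have -> : 0 - cumul t d - (0 - cumul t c) = - (cumul t d - cumul t c) by ring.
  rewrite normrN (le_trans (norm_cumul ti cd))// lerB//; apply: cumul_nd => //.
pose te e z := `|t z| * \1_[set z | g z < e] z.
have ite e : integrableR (te e) by exact: integrableR_indic.
have te0 e z : 0 <= te e z by rewrite mulr_ge0 ?indicE ?ler0n.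
have G2 e : 0 < e -> forall x y, x <= y -> `|G y - G x| <= cumul (te e) y - cumul (te e) x.
  move=> e0; have [d d0 dP] := ug _ (divr_gt0 e0 (@ltr0n R 2)).
  apply: (chain_increment d0) => x y xy yx.
  have [[z zxy gz]|nz] := pselect (exists2 z, x <= z <= y & e <= g z).
    rewrite -(G0 x y) ?subrr ?normr0 ?subr_ge0 ?cumul_nd// => w wxy.
    have : `|z - w| < d by rewrite ltr_norml; lra.
    by move=> /dP; rewrite ler_norml; lra.
  rewrite (le_trans (G1 _ _ xy))//; apply: le_cumul => // z zxy.
  rewrite /te indicE mem_set ?mulr1//=; rewrite ltNge; apply/negP => ez.
  by apply: nz; exists z.
(* The sets {g < e} shrink to {g = 0} as e -> 0, and [t] vanishes there. *)
have teT : \int[mu]_z (te n.+1%:R^-1 z) @[n --> \oo] --> (0 : R).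
  have [] := @dominated_cvgR _ (fun n => te n.+1%:R^-1) (cst 0) (fun z => `|t z|).
  - by move=> n; exact: integrableR_meas.
  - exact: measurable_cst.
  - apply: aeW => x; have [g00|g00] := ltP 0 (g x).
      apply: (@cvg_trans _ ((0 : R) @[n --> \oo])); last exact: cvg_cst.
      apply: near_eq_cvg; near=> n; rewrite /te indicE memNset ?mulr0//=.
      apply/negP; rewrite -leNgt ltW//; near: n.
      exact: (near_infty_natSinv_lt (PosNum g00)).
    apply: (@cvg_trans _ ((0 : R) @[n --> \oo])); last exact: cvg_cst.
    apply: near_eq_cvg; apply: nearW => n.
    rewrite /te (_ : t x = 0) ?normr0 ?mul0r// tE indicE memNset ?mulr0//=.
    by apply/negP; rewrite -leNgt.
  - by [].
  - apply: aeW => z n; rewrite ger0_norm// /te indicE.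
    by case: (_ \in _); rewrite ?mulr1 ?mulr0.
  by move=> _; rewrite Rintegral_cst//= mul0r.
suff W x y : x <= y -> G x = G y.
  by move=> x y; have [/W|/ltW/W] := leP x y; rewrite /G; lra.
move=> xy; apply/eqP; rewrite eq_sym -subr_eq0 -normr_le0.
move/cvg_lim : (teT) => <-//; apply: limr_ge.
  apply/cvg_ex; exists 0; exact: teT.
apply: nearW => n; rewrite (le_trans (G2 n.+1%:R^-1 _ _ _ xy))//.
exact: cumul_le_total.
Unshelve. all: by end_near. Qed.

Lemma unifc_max0 F : unifc F -> unifc (fun x => Num.max (F x) 0).
Proof.
move=> uF e e0; have [d d0 dP] := uF _ e0; exists d => // x y /dP.
by rewrite !maxEle; case: ifPn; case: ifPn; rewrite -?ltNge !ler_norml; lra.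
Qed.

Lemma primitive_max0 u v : primitive u v ->
  primitive (fun x => Num.max (u x) 0) (fun x => v x * \1_[set z | 0 < u z] x).
Proof.
move=> pu; have [iv uv] := pu.
have -> : [set z | 0 < u z] = [set z | 0 < Num.max (u z) 0].
  by apply/seteqP; split=> z /=; rewrite lt_max ltxx orbF.
apply: primitive_of_positive_part => //.
- exact/unifc_max0/primitive_unifc/pu.
- by move=> x; rewrite le_max lexx orbT.
- move=> x y xy uxy; have p z : x <= z <= y -> Num.max (u z) 0 = u z.
    by move=> /uxy; rewrite lt_max ltxx orbF => /ltW/max_idPl.
  by rewrite !p ?uv ?lexx ?xy.
Qed.

(** The factor is the sign of [u], equal to 0 at the zeros of [u]. *)
Definition absder u v x : R :=
  v x * (\1_[set z | 0 < u z] x - \1_[set z | u z < 0] x).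

Lemma primitive_norm u v : primitive u v -> primitive (fun x => `|u x|) (absder u v).
Proof.
move=> pu; have [iv uv] := pu.
have pN : primitive (fun x => - u x) (fun x => - 1 * v x).
  split; first exact: integrableRZ.
  by move=> x y; rewrite !cumulZ//; have := uv x y; lra.
have := primitiveD (primitive_max0 pu) (primitive_max0 pN).
congr (primitive _ _); apply/funext => x; rewrite ?maxEle.
  rewrite oppr_le0; case: (ltgtP (u x) 0) => [h|h|->].
  - by rewrite ltr0_norm// add0r.
  - by rewrite gtr0_norm// addr0.
  - by rewrite normr0 addr0.
rewrite /absder (_ : [set z | 0 < - u z] = [set z | u z < 0]); last first.
  by apply/seteqP; split=> z /=; rewrite oppr_gt0.
by ring.
Qed.

(** At a zero of [u] the quotients of |u| with positive steps are the absolute values of those of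
    [u]. The former tend to [absder u v x], which is 0 there, and the latter to |v x|. *)
Lemma derivative_eq0_ae u v : primitive u v ->
  {ae mu, forall x, u x = 0 -> v x = 0}.
Proof.
move=> pu; have := aeI (primitive_derive pu) (primitive_derive (primitive_norm pu)).
apply: aeS => x [[du vx] [dn nx]] ux0; apply/eqP; rewrite -normr_eq0; apply/eqP.
have := derivable_cvg_quotient dn; rewrite nx /absder !indicE !memNset/= ?ux0 ?ltxx//.
rewrite subrr mulr0 normr0 => c0.
have c1 := cvg_norm (derivable_cvg_quotient du); rewrite vx ux0 in c1.
have E : (fun n : nat => `|n.+1%:R * (u (x + n.+1%:R^-1) - 0)|) =
    (fun n : nat => n.+1%:R * (`|u (x + n.+1%:R^-1)| - 0)).
  by apply/funext => n; rewrite normrM !subr0 ger0_norm.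
rewrite E in c1.
by have := cvg_unique _ (c1 _) c0; apply.
Qed.

Lemma mem_setb (P : R -> bool) x : (x \in [set z | P z]) = P x.
Proof. by apply/idP/idP; rewrite inE. Qed.

Lemma sign_stable a b : `|b - a| < `|b| -> (0 < a) = (0 < b) /\ (a < 0) = (b < 0).
Proof.
by have [b0|b0|->] := ltgtP b 0;
  rewrite ?(ltr0_norm b0) ?(gtr0_norm b0) ?normr0 ltr_norml => /andP[h1 h2];
  split; apply/idP/idP; lra.
Qed.

(** Write v_j s_j - v s = (v_j - v) s_j + v (s_j - s) with the signs s_j and s. The first term is
    bounded by |v_j - v|. In the second the signs agree eventually where u x != 0, and v = 0 almost
    everywhere on {u = 0}; 2 |v| dominates. *)
Lemma absder_cvg (u_ v_ : nat -> R -> R) u v :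
  (forall j, primitive (u_ j) (v_ j)) -> primitive u v ->
  (forall x, u_ ^~ x @ \oo --> u x) ->
  \int[mu]_x `|v_ j x - v x| @[j --> \oo] --> (0 : R) ->
  \int[mu]_x `|absder (u_ j) (v_ j) x - absder u v x| @[j --> \oo] --> (0 : R).
Proof.
move=> pj pu uu vv; have iv := pu.1.
pose s (w : R -> R) x : R := \1_[set z | 0 < w z] x - \1_[set z | w z < 0] x.
have s1 (w : R -> R) x : `|s w x| <= 1.
  by rewrite /s !indicE; case: (_ \in _); case: (_ \in _);
    rewrite ?subrr ?subr0 ?sub0r ?normrN ?normr0 ?normr1.
have ms (w : R -> R) F : primitive w F -> measurable_fun setT (s w).
  move=> pw; have mw : measurable_fun setT w.
    by apply: continuous_measurable_fun; exact: primitive_continuous pw.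
  apply: measurable_funB; apply: measurable_indic; rewrite -[X in measurable X]setTI.
    exact: (measurable_fun_ltr (measurable_cst (0 : R)) mw).
  exact: (measurable_fun_ltr mw (measurable_cst (0 : R))).
have ivs (w : R -> R) F : primitive w F -> integrableR (fun x => v x * s w x).
  by move=> pw; apply: integrableRMb (s1 w) => //; exact: ms pw.
have c2 : \int[mu]_x `|v x * s (u_ j) x - v x * s u x| @[j --> \oo] --> (0 : R).
  have [] := @dominated_cvgR _ (fun j x => `|v x * s (u_ j) x - v x * s u x|) (cst 0)
     (fun x => 2 * `|v x|).
  - move=> j; apply: measurableT_comp => //; apply: integrableR_meas.
    by apply: integrableRB; [exact: ivs (pj j)|exact: ivs pu].
  - exact: measurable_cst.
  - apply: aeS (derivative_eq0_ae pu) => x vx0.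
    have [/eqP/vx0 vx|ux0] := boolP (u x == 0).
      by under eq_fun do rewrite vx !mul0r subrr normr0; exact: cvg_cst.
    apply: (@cvg_trans _ ((0 : R) @[n --> \oo])); last exact: cvg_cst.
    apply: near_eq_cvg; near=> j.
    have h : `|u x - u_ j x| < `|u x|.
      by near: j; move/cvgrPdist_lt : (uu x); apply; rewrite normr_gt0.
    rewrite (_ : s (u_ j) x = s u x) ?subrr ?normr0// /s !indicE.
    rewrite ![_ \in _]mem_setb; have [-> ->] := sign_stable h.
    by [].
  - exact/integrableRZ/integrableR_norm.
  - apply: aeW => x j; rewrite normr_id -mulrBr normrM mulrC ler_wpM2r//.
    by rewrite (le_trans (ler_normB _ _))// (_ : 2 = 1 + 1)// lerD.
  by move=> _; rewrite Rintegral_cst//= mul0r.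
have c3 : \int[mu]_x `|v_ j x - v x| + \int[mu]_x `|v x * s (u_ j) x - v x * s u x|
    @[j --> \oo] --> (0 : R) by rewrite -[0]addr0; exact: cvgD.
apply: (@squeeze_cvgr _ _ _ _ (cst 0) _ _ _ _ _ c3); last exact: cvg_cst.
apply: nearW => j; rewrite Rintegral_ge0//=.
have ia (w : R -> R) F : primitive w F -> integrableR (absder w F).
  by move=> pw; have [] := primitive_norm pw.
have i1 : integrableR (fun x => `|v_ j x - v x|).
  by apply/integrableR_norm/integrableRB => //; case: (pj j).
have i2 : integrableR (fun x => `|v x * s (u_ j) x - v x * s u x|).
  by apply/integrableR_norm/integrableRB; [exact: ivs (pj j)|exact: ivs pu].
rewrite -RintegralD// le_Rintegral//.
- by apply/integrableR_norm/integrableRB; [exact: ia (pj j)|exact: ia pu].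
- exact: integrableRD.
- move=> x _; rewrite /absder -/(s _ _) -/(s _ _).
  have -> : v_ j x * s (u_ j) x - v x * s u x =
    (v_ j x - v x) * s (u_ j) x + (v x * s (u_ j) x - v x * s u x) by ring.
  rewrite (le_trans (ler_normD _ _))// lerD2r normrM.
  by rewrite -[leRHS]mulr1 ler_wpM2l.
Unshelve. all: by end_near. Qed.

End gluing.

(** * Integrals of derivatives bounded by increments *)

Section variation_bound.
Context {R : realType}.
Local Notation mu := (@lebesgue_measure R).
Implicit Types (f g u v F T H tau : R -> R) (x y z w a b e s : R).

Lemma lebesgue_measure_shift s (A : set R) : measurable A ->
  pushforward mu (fun z => z + s : measurableTypeR R) A = mu A.
Proof.
move=> mA; apply/esym/lebesgue_measure_unique => //=.
  by apply: measurable_funD.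
move=> ms _ [[a b]] _ <-.
rewrite /pushforward (_ : _ @^-1` _ = `]a - s, b - s]%classic); last first.
  by apply/seteqP; split=> z /=; rewrite !in_itv/=; lra.
rewrite /= !lebesgue_measure_itv/= !lte_fin ltrD2r; case: ifP => // _.
by rewrite -!EFinD; congr EFin; ring.
Qed.

Lemma ge0_integral_shift s (f : R -> \bar R) : measurable_fun setT f ->
  (forall z, 0 <= f z)%E -> (\int[mu]_z f (z + s)%R = \int[mu]_z f z)%E.
Proof.
move=> mf f0; have mphi : measurable_fun setT (fun z => z + s : measurableTypeR R).
  by apply: measurable_funD.
pose phi (z : R) : measurableTypeR R := z + s.
transitivity (\int[pushforward mu phi]_z f z)%E.
  by rewrite ge0_integral_pushforward.
by apply: eq_measure_integral => A mA _; exact: lebesgue_measure_shift.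
Qed.

Lemma integrable_shift s v : integrableR v -> integrableR (fun z => v (z + s)).
Proof.
move=> iv; have mv := integrableR_meas iv; apply/integrableP; split.
  apply/measurable_EFinP; apply: measurableT_comp mv _.
  by apply: measurable_funD.
rewrite (@ge0_integral_shift s (fun z => `|v z|%:E)) //.
  by case/integrableP : iv.
by apply/measurable_EFinP; exact: measurableT_comp.
Qed.

Lemma eq_RintegralT f g : (forall z, f z = g z) ->
  \int[mu]_z f z = \int[mu]_z g z.
Proof. by move=> fg; apply: eq_Rintegral. Qed.

Lemma Rintegral_shift s v : integrableR v ->
  \int[mu]_z v (z + s) = \int[mu]_z v z.
Proof.
move=> iv; have mv := integrableR_meas iv.
have ian := integrableR_norm iv.
have ip : integrableR (fun z => `|v z| + v z) by exact: integrableRD.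
have vE z : v z = (`|v z| + v z) - `|v z| by ring.
have ge0 k : integrableR k -> (forall z, 0 <= k z) -> \int[mu]_z k (z + s) = \int[mu]_z k z.
  move=> ik k0; congr fine; apply: (@ge0_integral_shift s (EFin \o k)).
    exact: measurable_int ik.
  by move=> z; rewrite lee_fin.
transitivity (\int[mu]_z ((`|v (z + s)| + v (z + s)) - `|v (z + s)|)).
  by apply: eq_RintegralT => z; exact: vE.
transitivity (\int[mu]_z ((`|v z| + v z) - `|v z|)); last first.
  by apply: eq_RintegralT => z; rewrite -vE.
rewrite !RintegralB//; try exact: (integrable_shift s ip); try exact: (integrable_shift s ian).
rewrite (ge0 _ ip) ?(ge0 _ ian)// => z.
by have := ler_norm (- v z); rewrite normrN; lra.
Qed.

Lemma integrableR_indic_of (A : set R) v : measurable A ->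
  mu.-integrable A (EFin \o v) -> integrableR (fun z => v z * \1_A z).
Proof.
move=> mA /(@integrable_mkcond _ _ _ mu A (EFin \o v) mA).1.
congr (mu.-integrable _ _).
apply/funext => z; rewrite patchE /= indicE.
by case: ifPn => zA; rewrite ?mulr1 ?mulr0.
Qed.

Lemma Rintegral_indic (A : set R) v :
  \int[mu]_(z in A) v z = \int[mu]_z (v z * \1_A z).
Proof.
rewrite Rintegral_mkcond; apply: eq_Rintegral => z _; rewrite patchE indicE.
by case: ifPn => zA; rewrite ?mulr1 ?mulr0.
Qed.

Lemma bounded_integrable_indic (A : set R) v (C : R) : measurable A ->
  (mu A < +oo)%E -> measurable_fun setT v -> (forall x, A x -> `|v x| <= C) ->
  integrableR (fun z => v z * \1_A z).
Proof.
move=> mA Ay mv vC; apply: integrableR_indic_of => //.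
by apply: (@bounded_integrable _ _ _ C) => //; exact: measurable_funTS.
Qed.

Lemma mu_itv_lty (b1 b2 : bool) a b : (mu [set` Interval (BSide b1 a) (BSide b2 b)] < +oo)%E.
Proof.
by rewrite lebesgue_measure_itv/=; case: ifP => _; rewrite -?EFinB ltry.
Qed.

Lemma limn_einf_le (u : nat -> \bar R) B : (forall n, u n <= B)%E ->
  (limn_einf u <= B)%E.
Proof.
move=> uB; rewrite limn_einf_lim; apply: lime_le; first exact: is_cvg_einfs.
apply: nearW => n; apply: le_trans (uB n).
by apply: ereal_inf_lbound; exists n => /=.
Qed.

Lemma limn_einf_ge0 (u : nat -> \bar R) : (forall n, 0 <= u n)%E ->
  (0 <= limn_einf u)%E.
Proof.
move=> u0; rewrite limn_einf_lim; apply: lime_ge; first exact: is_cvg_einfs.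
by apply: nearW => n; apply: le_ereal_inf_tmp => _ [m _ <-].
Qed.

(** Translation invariance makes the integral of the increments telescope. With [H] clamped to
    [a, b] and lowered by [H a], the function is nonnegative and vanishes left of [a], so at most a
    strip of length [s] beyond [b] counts, where it equals H b - H a. *)
Lemma quotient_monotone_le H a b s : a <= b -> 0 < s ->
  (forall x y, a <= x -> x <= y -> y <= b -> H x <= H y) ->
  let K x := H (Num.max a (Num.min x b)) in
  integrableR (fun z => (K (z + s) - K z) * \1_(`]a, b[%classic) z) /\
  \int[mu]_z ((K (z + s) - K z) * \1_(`]a, b[%classic) z) <= s * (H b - H a).
Proof.
move=> ab s0 Hnd K; pose k z := K z - H a.
have cla z : a <= Num.max a (Num.min z b) <= b.
  by rewrite le_max lexx/= ge_max ab/= ge_min lexx orbT.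
have Knd x y : x <= y -> K x <= K y.
  move=> xy; apply: Hnd; [by case/andP: (cla x)| |by case/andP: (cla y)].
  by rewrite !maxEle !minEle; repeat case: ifP; lra.
have k0 z : 0 <= k z by rewrite subr_ge0; apply: Hnd; case/andP: (cla z).
have kB z : k z <= H b - H a by rewrite lerB//; apply: Hnd; case/andP: (cla z).
have mK : measurable_fun setT K.
  by apply: nondecreasing_measurable => // x y; exact: Knd.
have mk : measurable_fun setT k by exact: measurable_funB.
have ikb (A : set R) : measurable A -> (mu A < +oo)%E -> integrableR (fun z => k z * \1_A z).
  move=> mA Ay; apply: (@bounded_integrable_indic _ _ (H b - H a)) => //.
  by move=> x _; rewrite ger0_norm.
have i1 : integrableR (fun z => k z * \1_(`]a, b[%classic) z).
  by apply: ikb => //; exact: mu_itv_lty.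
have i2 : integrableR (fun z => k z * \1_(`]a + s, b + s[%classic) z).
  by apply: ikb => //; exact: mu_itv_lty.
have E z : (K (z + s) - K z) * \1_(`]a, b[%classic) z =
    k (z + s) * \1_(`]a + s, b + s[%classic) (z + s) - k z * \1_(`]a, b[%classic) z.
  rewrite !indicE !mem_setb !in_itv/= !ltrD2r /k; ring.
have i2s := integrable_shift s i2.
rewrite (eq_RintegralT E).
have -> : (fun z => (K (z + s) - K z) * \1_(`]a, b[%classic) z) =
  (fun z => k (z + s) * \1_(`]a + s, b + s[%classic) (z + s) - k z * \1_(`]a, b[%classic) z).
  by apply/funext.
split; first exact: integrableRB.
rewrite RintegralB// (Rintegral_shift s i2) -RintegralB//.
have -> : s * (H b - H a) = \int[mu]_z ((H b - H a) * \1_(`[b, b + s]%classic) z).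
  have mb : mu [set` `[b, b + s]] = s%:E.
    by rewrite lebesgue_measure_itv/= lte_fin ltrDl s0 -EFinB; congr EFin; ring.
  by rewrite -Rintegral_indic Rintegral_cst//= mb mulrC.
apply: le_Rintegral => //; first exact: integrableRB.
  apply: (@bounded_integrable_indic _ (cst (H b - H a)) `|H b - H a|) => //.
  exact: mu_itv_lty.
have ka z : z <= a -> k z = 0.
  move=> za; rewrite /k /K; have /max_idPl -> : Num.min z b <= a by rewrite ge_min za.
  exact: subrr.
move=> z _; rewrite !indicE !mem_setb !in_itv/=.
have [za|az] := leP z a; first by rewrite (ka z za) !mul0r subrr mulr_ge0// (le_trans (k0 z)).
have [zb|bz] := ltP z b.
  rewrite /= mulr1 mulr0.
  by rewrite subr_le0; case: (_ && _); rewrite ?mulr1 ?mulr0.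
rewrite /= mulr0 subr0.
case: (ltP z (b + s)) => zbs; rewrite ?andbF ?andbT /=.
  rewrite (ltW zbs) mulr1; case: (_ < _); rewrite ?mulr1// ?mulr0 (le_trans (k0 z))//.
by rewrite mulr0 mulr_ge0// (le_trans (k0 z)).
Qed.

(** Fatou's lemma for the difference quotients of [T], which are dominated by those of the monotone
    [H]. Jumps of [H] do no harm; this matters because [signed_gap] can jump where the decreasing
    phase ends or a new one begins. *)
Lemma variation_bound T H tau (E : set R) a b : a <= b ->
  (forall x y, a <= x -> x <= y -> y <= b -> `|T y - T x| <= H y - H x) ->
  measurable_fun setT T -> measurable_fun setT tau -> measurable E ->
  E `<=` `]a, b[%classic ->
  {ae mu, forall x, E x ->
     n.+1%:R * (T (x + n.+1%:R^-1) - T x) @[n --> \oo] --> tau x} ->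
  (\int[mu]_x (`|tau x| * \1_E x)%:E <= (H b - H a)%:E)%E.
Proof.
move=> ab TH mT mtau mE Eab cT.
have Hnd x y : a <= x -> x <= y -> y <= b -> H x <= H y.
  by move=> ax xy yb; rewrite -subr_ge0 (le_trans _ (TH _ _ ax xy yb)).
(* Clamping lets the quotients be formed near [b]; at each point of [E] it is inactive once the step
   is small. *)
pose c z := Num.max a (Num.min z b).
have cab z : a <= c z <= b.
  by rewrite le_max lexx/= ge_max ab/= ge_min lexx orbT.
have cnd x y : x <= y -> c x <= c y.
  by move=> xy; rewrite /c !maxEle !minEle; repeat case: ifP; lra.
have mc : measurable_fun setT c by apply: nondecreasing_measurable => // x y; exact: cnd.
have mTc : measurable_fun setT (fun z => T (c z)) by exact: measurableT_comp.
have mTs s : measurable_fun setT (fun z => T (c (z + s))).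
  by apply: (measurableT_comp mTc); exact: measurable_funD.
pose f n x := n.+1%:R * `|T (c (x + n.+1%:R^-1)) - T (c x)| * \1_E x.
have mf n : measurable_fun setT (f n).
  apply: measurable_funM => //; apply: measurable_funM => //.
  by apply: measurableT_comp => //; exact: measurable_funB.
have mf' n : measurable_fun setT (fun x => (f n x)%:E) by exact/measurable_EFinP.
have f0 n x : 0 <= f n x by rewrite !mulr_ge0// indicE ler0n.
have fH n : (\int[mu]_x (f n x)%:E <= (H b - H a)%:E)%E.
  have s0 : 0 < n.+1%:R^-1 :> R by [].
  have [iK KH] := quotient_monotone_le ab s0 Hnd; rewrite -/(c _) in iK KH.
  set k := (fun z => _) in iK.
  have ink := integrableRZ n.+1%:R iK.
  apply: (@le_trans _ _ (\int[mu]_x (n.+1%:R * k x)%:E)%E).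
    apply: ge0_le_integral => //=.
    - by move=> x _; rewrite lee_fin.
    - exact: mf'.
    - exact: measurable_int ink.
    - move=> x _; rewrite lee_fin /f /k -mulrA ler_wpM2l// !indicE.
      have [xE|xE] := boolP (x \in E); last first.
        rewrite mulr0 mulr_ge0// subr_ge0; apply: Hnd; [by case/andP: (cab x)| |].
          by apply: cnd; rewrite lerDl ltW.
        by case/andP: (cab (x + n.+1%:R^-1)).
      rewrite mem_set; last by apply: Eab; rewrite inE in xE.
      rewrite !mulr1; apply: TH; [by case/andP: (cab x)| |].
        by apply: cnd; rewrite lerDl ltW.
      by case/andP: (cab (x + n.+1%:R^-1)).
  have := integrable_fin_num measurableT ink.
  move=> /fineK <-; rewrite lee_fin -/(Rintegral _ _ _) RintegralZl//.
  by rewrite -ler_pdivlMl// KH.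
have f0' n x : [set: R] x -> (0 <= (f n x)%:E)%E by rewrite lee_fin.
have fat := @fatou _ _ _ mu setT measurableT (fun n x => (f n x)%:E) mf' f0'.
apply: le_trans (le_trans fat (limn_einf_le fH)).
apply: ae_ge0_le_integral => //.
- apply/measurable_EFinP; apply: measurable_funM => //.
  exact: measurableT_comp.
- by move=> x _; apply: limn_einf_ge0 => n; rewrite lee_fin.
- rewrite (_ : (fun x => _) = (fun x => - limn_esup (fun n => - (f n x)%:E))%E); last first.
    by apply/funext => x; rewrite (limn_esupN (fun n => (f n x)%:E)) oppeK.
  apply: measurableT_comp => //; apply: measurable_fun_limn_esup => n.
  apply/(measurable_EFinP _ (fun x => - f n x)).
  exact: measurableT_comp (mf n).
- apply: aeS cT => x cTx _; have [xE|xE] := boolP (x \in E); last first.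
    by rewrite indicE (negbTE xE) mulr0; apply: limn_einf_ge0 => n; rewrite lee_fin.
  have Ex : E x by rewrite inE in xE.
  suff cf : (f n x)%:E @[n --> \oo] --> (`|tau x| * \1_E x)%:E.
    by rewrite (cvg_limn_einf_sup cf).
  apply: cvg_EFin; first exact: nearW.
  rewrite indicE xE mulr1.
  have cn : `|n.+1%:R * (T (x + n.+1%:R^-1) - T x)| @[n --> \oo] --> `|tau x|.
    by apply: cvg_norm; exact: cTx.
  apply: cvg_trans cn; apply: near_eq_cvg.
  have /= := Eab _ Ex; rewrite in_itv/= => /andP[ax xb].
  near=> n; rewrite /f indicE xE mulr1 normrM ger0_norm//.
  have cc z : a <= z -> z <= b -> c z = z.
    by move=> az zb; rewrite /c; have /min_idPl -> := zb; have /max_idPr -> := az.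
  have xnb : x + n.+1%:R^-1 < b.
    rewrite -ltrBrDl; near: n.
    have bx : 0 < b - x by rewrite subr_gt0.
    exact: (near_infty_natSinv_lt (PosNum bx)).
  have n0 : 0 < n.+1%:R^-1 :> R by [].
  rewrite (cc x (ltW ax) (ltW xb)) cc//; last exact: ltW.
  by rewrite (le_trans (ltW ax))// lerDl ltW.
Unshelve. all: by end_near. Qed.

End variation_bound.

(** * Variation of the truncated gap over an obstacle *)

Section obstacle.
Context {R : realType}.
Local Notation mu := (@lebesgue_measure R).
Implicit Types (f g u v F T H tau : R -> R) (x y z w a b c e s : R).

(** The last clause is convexity on detached intervals, cleared of denominators. *)
Definition obstacle f F : Prop :=
  [/\ unifc f, unifc F, forall x, f x <= F x &
      forall p y q, p < y < q -> (forall z, p <= z <= q -> f z < F z) ->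
        (q - p) * F y <= (q - y) * F p + (y - p) * F q].

Section truncated_gap.
Variables (f F : R -> R) (c eps : R).
Hypotheses (obs : obstacle f F) (eps0 : 0 < eps).

Let D x := f x - c * x.
Let P x := F x - c * x.
Definition truncated_gap x := Num.min (F x - f x) eps.
Local Notation T := truncated_gap.
Let pos x y := forall z, x <= z <= y -> f z < F z.

(* On a component of [F > f] the convex function [P] first decreases, then
   increases; [desc] marks the decreasing phase. There [D + T = min P (D + eps)]
   varies at most like [D] minus the decrease of [T], afterwards like [D] plus the
   increase of [T]. With the sign of [signed_gap] the correction is the decrease of
   [signed_gap] in both phases, so it telescopes, and it is at most [2 * eps] in all. *)
Let desc x := `[< exists2 y, x < y & pos x y /\ P y < P x >].

Definition signed_gap x : R := if desc x then T x else - T x.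
Local Notation Th := signed_gap.

Let fF x : f x <= F x. Proof. by case: obs. Qed.

Let T0 x : 0 <= T x. Proof. by rewrite le_min subr_ge0 fF ltW. Qed.

Let Te x : T x <= eps. Proof. by rewrite ge_min lexx orbT. Qed.

Lemma norm_signed_gap x : `|Th x| <= eps.
Proof. by rewrite /Th; case: ifP => _; rewrite ?normrN ger0_norm. Qed.

Let T_eq0 x : F x = f x -> T x = 0.
Proof. by move=> h; rewrite /T h subrr; apply/min_idPl/ltW. Qed.

Let basic x y m : `|D y - D x| <= m ->
  (P y <= P x -> `|D y + T y - (D x + T x)| <= m - (T y - T x)) /\
  (P x <= P y -> `|D y + T y - (D x + T x)| <= m + (T y - T x)).
Proof.
rewrite !ler_norml /truncated_gap /P /D => h.
by rewrite !minEle; split; case: ifP => h1; case: ifP => h2; lra.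
Qed.

(** If [P y] exceeded both end values, it would lie above the chord; [P] is as convex as [F], since
    they differ by a linear function. *)
Let convP p y q : p < y < q -> pos p q -> P q < P y -> P y <= P p.
Proof.
move=> /andP[py yq] pq Pqy; rewrite leNgt; apply/negP => Ppy.
case: obs => _ _ _ cvx.
have := cvx p y q; rewrite py yq => /(_ isT pq); rewrite leNgt => /negP; apply.
have h1 : 0 < (y - p) * (P y - P q) by rewrite mulr_gt0// subr_gt0.
have h2 : 0 < (q - y) * (P y - P p) by rewrite mulr_gt0// subr_gt0.
by move: h1 h2; rewrite /P; lra.
Qed.

Let descP x : desc x -> exists2 y, x < y & pos x y /\ P y < P x.
Proof. by move/asboolP. Qed.

Let ndescP x y : ~~ desc x -> x <= y -> pos x y -> P x <= P y.
Proof.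
move=> /asboolPn nx; rewrite le_eqVlt => /predU1P[->//|xy] pxy.
by rewrite leNgt; apply/negP => Pyx; apply: nx; exists y.
Qed.

Let desc_le x y : x <= y -> pos x y -> desc y -> P y <= P x /\ desc x.
Proof.
rewrite le_eqVlt => /predU1P[->//|xy] pxy /descP[z yz [pyz Pzy]].
have pxz : pos x z.
  move=> w /andP[xw wz]; have [wy|/ltW yw] := leP w y.
    by apply: pxy; rewrite xw.
  by apply: pyz; rewrite yw.
have Pyx : P y <= P x by apply: (convP (q := z)) => //; rewrite xy.
split=> //; apply/asboolP; exists z; first exact: lt_trans yz.
by split=> //; exact: lt_le_trans Pyx.
Qed.

Variables (a b : R) (W : R -> R).
Hypothesis DW : forall x y, a <= x -> x <= y -> y <= b -> `|D y - D x| <= W y - W x.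

Let seg x y : a <= x -> x <= y -> y <= b -> pos x y ->
  `|D y + T y - (D x + T x)| <= W y - W x + Th x - Th y.
Proof.
move=> ax xy yb pxy; have [b1 b2] := basic (DW ax xy yb).
have := T0 x; have := T0 y; rewrite /Th.
have [dy|dy] := boolP (desc y).
  by have [/b1 {}b1 ->] := desc_le xy pxy dy; lra.
have [dx|dx] := boolP (desc x); last by have := b2 (ndescP dx xy pxy); lra.
by have [/b1|/ltW/b2] := leP (P y) (P x); lra.
Qed.

Lemma truncated_gap_variation x y : a <= x -> x <= y -> y <= b ->
  `|T y - T x| <= (2 * W y - Th y) - (2 * W x - Th x).
Proof.
move=> ax xy yb.
(* Recovering [T] from [D + T] costs the variation of [D] once more, whence the factor 2. *)
suff : `|D y + T y - (D x + T x)| <= W y - W x + Th x - Th y.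
  by have := DW ax xy yb; rewrite !ler_norml; lra.
have [uf uF _ _] := obs.
have cP : continuous P.
  move=> z; apply: cvgB; first exact: unifc_continuous uF z.
  by apply: cvgM; [exact: cvg_cst|exact: cvg_id].
have cg : continuous (fun z => F z - f z).
  by move=> z; apply: cvgB; [exact: unifc_continuous uF z|exact: unifc_continuous uf z].
(* If [x, y] meets the contact set, cut at the first and last contact points [z1], [z2]. There [T]
   vanishes, so between them only the variation of [D] counts. *)
have [[z /andP[xz zy] gz]|nz] := pselect (exists2 z, x <= z <= y & F z - f z = 0); last first.
  apply: seg => // z zxy; rewrite lt_neqAle fF andbT eq_sym -subr_eq0.
  by apply/eqP => gz; apply: nz; exists z.
have [z1 [/andP[xz1 z1z] gz1 h1]] := first_zero cg xz gz.
have [z2 [/andP[zz2 z2y] gz2 h2]] := last_zero cg zy gz.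
have Tz1 : T z1 = 0 by apply: T_eq0; lra.
have Tz2 : T z2 = 0 by apply: T_eq0; lra.
have pos1 w : w < z1 -> pos x w.
  move=> wz1 t /andP[xt tw]; rewrite lt_neqAle fF andbT eq_sym -subr_eq0.
  by apply/eqP/h1; rewrite xt (le_lt_trans tw).
have pos2 w : z2 < w -> pos w y.
  move=> wz1 t /andP[xt tw]; rewrite lt_neqAle fF andbT eq_sym -subr_eq0.
  by apply/eqP/h2; rewrite tw (lt_le_trans wz1).
have k1 : `|D z1 + T z1 - (D x + T x)| <= W z1 - W x + Th x.
  have [b1 b2] := basic (DW ax xz1 (le_trans (le_trans z1z zy) yb)).
  have := T0 x; rewrite /Th; have [dx|dx] := boolP (desc x).
    by have [/b1|/ltW/b2] := leP (P z1) (P x); lra.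
  (* Detachment holds only before [z1], so monotonicity reaches [z1] by a left limit. *)
  have Pz1 : P x <= P z1.
    move: xz1; rewrite le_eqVlt => /predU1P[->//|xz1].
    have cl : P w @[w --> z1^'-] --> P z1 by exact: cvg_at_left_filter (cP z1).
    move/cvg_lim : (cl) => <-//; apply: limr_ge; first by apply/cvg_ex; exists (P z1).
    near=> w; apply: ndescP => //.
      by apply/ltW; near: w; exact: nbhs_left_gt.
    by apply: pos1; near: w; exact: nbhs_left_lt.
  by have := b2 Pz1; lra.
have k2 : `|D y + T y - (D z2 + T z2)| <= W y - W z2 - Th y.
  have [b1 b2] := basic (DW (le_trans ax (le_trans xz zz2)) z2y yb).
  have := T0 y; rewrite /Th; have [dy|dy] := boolP (desc y); last first.
    by have [/b1|/ltW/b2] := leP (P y) (P z2); lra.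
  have Pz2 : P y <= P z2.
    move: z2y; rewrite le_eqVlt => /predU1P[->//|z2y].
    have cl : P w @[w --> z2^'+] --> P z2 by exact: cvg_at_right_filter (cP z2).
    move/cvg_lim : (cl) => <-//; apply: limr_ge; first by apply/cvg_ex; exists (P z2).
    near=> w; have wy : w <= y.
      by apply/ltW; near: w; exact: nbhs_right_lt.
    have zw : z2 < w by near: w; exact: nbhs_right_gt.
    by have [] := desc_le wy (pos2 _ zw) dy.
  by have := b1 Pz2; lra.
have k3 := DW (le_trans ax xz1) (le_trans z1z zz2) (le_trans z2y yb).
by move: k1 k2 k3; rewrite Tz1 Tz2 !ler_norml; lra.
Unshelve. all: by end_near. Qed.

End truncated_gap.
End obstacle.

(** * Integrability of F' and the loss near contact *)

Section obstacle_primitive.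
Context {R : realType}.
Local Notation mu := (@lebesgue_measure R).
Implicit Types (f g u v F T H tau : R -> R) (x y z w a b c e s : R).

Lemma cvg_add_harmonic x : x + n.+1%:R^-1 @[n --> \oo] --> x.
Proof.
rewrite -[X in _ --> X]addr0.
by apply: cvgD; [exact: cvg_cst|exact: cvg_harmonic].
Qed.

Lemma chain_increment_in (G W : R -> R) r a b : 0 < r -> a <= b ->
  (forall x y, a <= x -> x <= y -> y <= b -> y - x < r -> `|G y - G x| <= W y - W x) ->
  `|G b - G a| <= W b - W a.
Proof.
move=> r0 ab H; pose c z := Num.max a (Num.min z b).
have ca : c a = a by rewrite /c (min_idPl ab) maxxx.
have cb : c b = b by rewrite /c minxx (max_idPr ab).
suff : `|G (c b) - G (c a)| <= W (c b) - W (c a) by rewrite ca cb.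
apply: (@chain_increment _ (G \o c) (W \o c) r r0 _ a b ab) => x y xy yx /=.
by apply: H; rewrite /c !maxEle !minEle; repeat case: ifP; lra.
Qed.

Lemma integrableR_of_bounded tau B : measurable_fun setT tau ->
  (forall n : nat, (\int[mu]_x (`|tau x| * \1_(`]- n%:R, n%:R[%classic) x)%:E <= B%:E)%E) ->
  integrableR tau /\ \int[mu]_x `|tau x| <= B.
Proof.
move=> mt tB; suff H : (\int[mu]_x `|tau x|%:E <= B%:E)%E.
  have it : integrableR tau.
    apply/integrableP; split; first exact/measurable_EFinP.
    exact: le_lt_trans H (ltry B).
  split=> //; rewrite -lee_fin /Rintegral fineK//.
  exact: (integrable_fin_num measurableT (integrableR_norm it)).
pose f n x := `|tau x| * \1_(`]- n%:R, n%:R[%classic) x.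
have mf n : measurable_fun setT (fun x => (f n x)%:E).
  by apply/measurable_EFinP; apply: measurable_funM => //; exact: measurableT_comp.
have f0 n x : [set: R] x -> (0 <= (f n x)%:E)%E.
  by move=> _; rewrite lee_fin mulr_ge0// indicE ler0n.
have := @fatou _ _ _ mu setT measurableT (fun n x => (f n x)%:E) mf f0.
move=> /le_trans/(_ (limn_einf_le tB)) fat.
apply: le_trans fat.
rewrite le_eqVlt; apply/orP; left; apply/eqP; apply: eq_integral => x _.
apply/esym; have [] // := @cvg_limn_einf_sup R (fun n => (f n x)%:E) `|tau x|%:E _.
apply: cvg_EFin; first exact: nearW.
apply: (@cvg_trans _ (`|tau x| @[_ --> \oo])); last exact: cvg_cst.
apply: near_eq_cvg; near=> n; rewrite /= /f indicE mem_setb in_itv/= -ltr_norml.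
suff -> : `|x| < n%:R by rewrite mulr1.
apply: lt_le_trans (truncnS_gt _) _; rewrite ler_nat; near: n.
exact: nbhs_infty_ge.
Unshelve. all: by end_near. Qed.

Section slopes.
Variables (f F : R -> R).
Hypothesis obs : obstacle f F.
Let pos x y := forall z, x <= z <= y -> f z < F z.

Let pos_sub x y x' y' : pos x y -> x <= x' -> y' <= y -> pos x' y'.
Proof.
move=> pxy xx yy z /andP[xz zy]; apply: pxy.
by rewrite (le_trans xx)// (le_trans zy).
Qed.

Lemma obstacle_slope p y q : p < y < q -> pos p q ->
  (F y - F p) * (q - y) <= (F q - F y) * (y - p).
Proof. by case: obs => _ _ _ cvx pyq pq; have := cvx p y q pyq pq; lra. Qed.

Lemma obstacle_slope_le p y q : p < y <= q -> pos p q ->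
  (F y - F p) / (y - p) <= (F q - F p) / (q - p).
Proof.
move=> /andP[py]; rewrite le_eqVlt => /predU1P[->//|yq] pq.
have := @obstacle_slope p y q; rewrite py yq => /(_ isT pq) h.
rewrite ler_pdivrMr ?subr_gt0// mulrAC ler_pdivlMr ?subr_gt0 ?(lt_trans py)//.
by lra.
Qed.

Lemma obstacle_slope_ge p y q : p < y < q -> pos p q ->
  (F y - F p) / (y - p) <= (F q - F y) / (q - y).
Proof.
move=> /andP[py yq] pq; have := @obstacle_slope p y q.
rewrite py yq => /(_ isT pq) h.
by rewrite ler_pdivrMr ?subr_gt0// mulrAC ler_pdivlMr ?subr_gt0.
Qed.

Lemma positive_gap_open x : f x < F x -> exists2 r : R, 0 < r & pos (x - r) (x + r).
Proof.
move=> fFx; have [uf uF _ _] := obs; have e0 : 0 < (F x - f x) / 4 by rewrite divr_gt0// subr_gt0.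
have [d1 d10 h1] := uf _ e0; have [d2 d20 h2] := uF _ e0.
exists (Num.min d1 d2 / 2); first by rewrite divr_gt0// lt_min d10.
move=> z; set r := Num.min d1 d2 => zr.
have r0 : 0 < r by rewrite lt_min d10.
have rd1 : r <= d1 by rewrite ge_min lexx.
have rd2 : r <= d2 by rewrite ge_min lexx orbT.
have : `|x - z| < r by rewrite ltr_norml; lra.
move=> xz; have := h1 x z (lt_le_trans xz rd1); have := h2 x z (lt_le_trans xz rd2).
by rewrite !ler_norml; lra.
Qed.

Definition rquotient n x := n.+1%:R * (F (x + n.+1%:R^-1) - F x).

(** Convexity guarantees the limit where [f < F]; [obstacle_primitive] multiplies it by the
    indicator of that set. *)
Definition rderivative x := limn (rquotient ^~ x).

Lemma rquotientE n x : rquotient n x = (F (x + n.+1%:R^-1) - F x) / (x + n.+1%:R^-1 - x).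
Proof. by rewrite /rquotient mulrC [x + _]addrC addrK invrK. Qed.

(** Convex slopes from [x] decrease with the step and stay above a slope taken on the left. The
    index is shifted by [N] to keep the steps inside a detached neighbourhood. *)
Lemma rquotient_cvg x : f x < F x -> rquotient ^~ x @ \oo --> rderivative x.
Proof.
move=> /positive_gap_open[r r0 pr]; suff [l ul] : exists l : R, rquotient ^~ x @ \oo --> l.
  by rewrite /rderivative (cvg_lim _ ul).
have [N Nr] : exists N : nat, N.+1%:R^-1 < r.
  have [N _ /(_ N (leqnn N))] := near_infty_natSinv_lt (PosNum r0); by exists N.
have Nn n : (n + N).+1%:R^-1 < r.
  apply: le_lt_trans Nr; rewrite lef_pV2 ?posrE// ler_nat ltnS.
  exact: leq_addl.
have n0 n : 0 < n.+1%:R^-1 :> R by [].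
have : cvgn (fun n => rquotient (n + N) x).
  apply: nonincreasing_is_cvgn.
    apply/nonincreasing_seqP => n; rewrite !rquotientE; apply: obstacle_slope_le.
      by rewrite ltrDl lerD2l n0/= addSn lef_pV2 ?posrE// ler_nat.
    by apply: (pos_sub pr); rewrite ?lerD2l ?gerBl ltW.
  exists ((F x - F (x - r)) / (x - (x - r))) => _ [n _ <-].
  rewrite rquotientE; apply: obstacle_slope_ge.
    by rewrite ltrBlDr ltrDl r0 ltrDl n0.
  by apply: (pos_sub pr); rewrite ?lerD2l// ltW.
move=> /cvg_ex[l ul]; exists l; rewrite -(cvg_shiftn N); exact: ul.
Qed.

Lemma rderivative_le x y : x < y -> pos x y -> f y < F y ->
  rderivative x <= (F y - F x) / (y - x).
Proof.
move=> xy pxy fFy; have fFx : f x < F x by apply: pxy; rewrite lexx ltW.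
have cx := rquotient_cvg fFx; rewrite /rderivative; apply: limr_le.
  by apply/cvg_ex; eexists; exact: cx.
have xy0 : 0 < y - x by rewrite subr_gt0.
near=> n; rewrite rquotientE; have n0 : 0 < n.+1%:R^-1 :> R by [].
have ny : n.+1%:R^-1 < y - x by near: n; exact: (near_infty_natSinv_lt (PosNum xy0)).
apply: obstacle_slope_le => //.
by rewrite ltrDl n0 -lerBrDl ltW.
Unshelve. all: by end_near. Qed.

Lemma rderivative_ge x y : x < y -> pos x y ->
  (F y - F x) / (y - x) <= rderivative y.
Proof.
move=> xy pxy; have fFy : f y < F y by apply: pxy; rewrite lexx ltW.
have cy := rquotient_cvg fFy; rewrite /rderivative; apply: limr_ge.
  by apply/cvg_ex; eexists; exact: cy.
have [r r0 pr] := positive_gap_open fFy.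
near=> n; rewrite rquotientE; have n0 : 0 < n.+1%:R^-1 :> R by [].
have nr : n.+1%:R^-1 < r by near: n; exact: (near_infty_natSinv_lt (PosNum r0)).
apply: obstacle_slope_ge => //; first by rewrite xy ltrDl.
move=> z /andP[xz zn]; have [zy|/ltW yz] := leP z y; first by apply: pxy; rewrite xz.
apply: pr; rewrite (le_trans zn) ?lerD2l ?(ltW nr)// andbT.
by rewrite (le_trans _ yz)// gerBl ltW.
Unshelve. all: by end_near. Qed.

Lemma rderivative_nd x y : x <= y -> pos x y -> rderivative x <= rderivative y.
Proof.
rewrite le_eqVlt => /predU1P[->//|xy] pxy.
have fFy : f y < F y by apply: pxy; rewrite lexx ltW.
exact: le_trans (rderivative_le xy pxy fFy) (rderivative_ge xy pxy).
Qed.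

(** On a subinterval [a, b] shorter than [r], both increments lie between [b - a] times the right
    derivatives at [a] and at [b]. They differ by at most [r] times the increment of the right
    derivative, which telescopes; then r -> 0. *)
Lemma rderivative_increment x y (w : R -> R) : integrableR w -> x <= y -> pos x y ->
  (forall z, x <= z <= y -> w z = rderivative z) ->
  F y - F x = cumul w y - cumul w x.
Proof.
move=> iw xy pxy wd; pose G z := F z - cumul w z.
suff : `|G y - G x| <= 0 by rewrite normr_le0 /G => /eqP; lra.
apply: (@le0_mul_small _ _ (rderivative y - rderivative x)) => r r0.
rewrite mulrBr; pose W z := r * rderivative z; rewrite -/(W y) -/(W x).
apply: (chain_increment_in r0 xy) => a b xa ab yb bar.
move: ab; rewrite le_eqVlt => /predU1P[->|ab]; first by rewrite !subrr normr0.
have pab : pos a b by move=> z zab; apply: pxy; lra.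
have fFb : f b < F b by apply: pab; rewrite lexx ltW.
have h1 := rderivative_le ab pab fFb; have h2 := rderivative_ge ab pab.
have ba0 : 0 < b - a by rewrite subr_gt0.
rewrite ler_pdivlMr// in h1; rewrite ler_pdivrMr// in h2.
have h3 : cumul w b - cumul w a <= rderivative b * (b - a).
  apply: cumul_cst_le => //; first exact: ltW.
  move=> z /andP[az zb]; rewrite wd; last by apply/andP; lra.
  by apply: rderivative_nd => // t tz; apply: pab; lra.
have h4 : rderivative a * (b - a) <= cumul w b - cumul w a.
  have := @cumul_cst_le _ (fun z => -1 * w z) (- rderivative a) a b (integrableRZ (-1) iw) (ltW ab).
  rewrite !cumulZ// => H; have : -1 * cumul w b - -1 * cumul w a <= - rderivative a * (b - a).
    apply: H => z /andP[az zb]; rewrite mulN1r lerN2 wd; last by apply/andP; lra.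
    by apply: rderivative_nd => // t tz; apply: pab; lra.
  by lra.
have rr : rderivative a <= rderivative b by apply: rderivative_nd => //; exact: ltW.
have h5 : (rderivative b - rderivative a) * (b - a) <= (rderivative b - rderivative a) * r.
  by rewrite ler_wpM2l ?subr_ge0// ltW.
rewrite /G /W ler_norml; move: h1 h2 h3 h4 h5; lra.
Qed.

End slopes.

Lemma unifcB f g : unifc f -> unifc g -> unifc (fun x => f x - g x).
Proof.
move=> uf ug e e0; have e20 : 0 < e / 2 by rewrite divr_gt0.
have [d1 d10 h1] := uf _ e20; have [d2 d20 h2] := ug _ e20.
exists (Num.min d1 d2); first by rewrite lt_min d10.
move=> x y; rewrite lt_min => /andP[/h1 + /h2]; rewrite !ler_norml; lra.
Qed.

Lemma unifc_truncated_gap f F e : unifc f -> unifc F -> unifc (truncated_gap f F e).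
Proof.
move=> uf uF e' e0; have [d d0 h] := unifcB uF uf e0.
exists d => // x y /h; rewrite /truncated_gap !ler_norml !minEle.
by do 2 case: ifP; lra.
Qed.

(** Here [W] in [truncated_gap_variation] is the cumulative integral of |f' - c| over [a, b]. The
    term [2 * e] is what [signed_gap], bounded by [e], contributes at the two ends. *)
Lemma signed_gap_total f f' F c e (a b : R) : obstacle f F -> 0 < e ->
  primitive f f' -> a <= b ->
  forall tau (E : set R), measurable_fun setT tau -> measurable E ->
  E `<=` `]a, b[%classic ->
  {ae mu, forall x, E x ->
    n.+1%:R * (truncated_gap f F e (x + n.+1%:R^-1) - truncated_gap f F e x) @[n --> \oo]
      --> tau x} ->
  (\int[mu]_x (`|tau x| * \1_E x)%:E <=
    (2 * \int[mu]_x (`|f' x - c| * \1_(`[a, b]%classic) x) + 2 * e)%:E)%E.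
Proof.
move=> obs e0 pf ab tau E mt mE Eab cT; have [if' ff'] := pf.
have [uf uF _ _] := obs.
have mf' := integrableR_meas if'.
have mT : measurable_fun setT (truncated_gap f F e).
  apply: continuous_measurable_fun; apply: unifc_continuous.
  exact: unifc_truncated_gap.
pose w x := (f' x - c) * \1_(`[a, b]%classic) x.
have iw : integrableR w.
  have -> : w = fun x => f' x * \1_(`[a, b]%classic) x - cst c x * \1_(`[a, b]%classic) x.
    by apply/funext => x; rewrite /w mulrBl.
  apply: integrableRB; first exact: integrableR_indic.
  apply: (@bounded_integrable_indic _ _ _ `|c|) => //; exact: mu_itv_lty.
have DW x y : a <= x -> x <= y -> y <= b ->
    `|(f y - c * y) - (f x - c * x)| <=
    cumul (fun z => `|w z|) y - cumul (fun z => `|w z|) x.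
  move=> ax xy yb; have -> : (f y - c * y) - (f x - c * x) = cumul w y - cumul w x.
    have icx : integrableR (fun z => cst c z * \1_(`[a, b]%classic) z).
      apply: (@bounded_integrable_indic _ _ _ `|c|) => //; exact: mu_itv_lty.
    have ifx := integrableR_indic (measurable_itv `[a, b]) if'.
    have wE : w = fun x => f' x * \1_(`[a, b]%classic) x - cst c x * \1_(`[a, b]%classic) x.
      by apply/funext => z; rewrite /w mulrBl.
    have E1 : cumul (fun z => f' z * \1_(`[a, b]%classic) z) y -
        cumul (fun z => f' z * \1_(`[a, b]%classic) z) x = cumul f' y - cumul f' x.
      apply: eq_cumul => // z zxy; rewrite indicE mem_setb in_itv/= (_ : _ <= _ <= _) ?mulr1//.
      by apply/andP; lra.
    have E2 : cumul (fun z => cst c z * \1_(`[a, b]%classic) z) y -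
        cumul (fun z => cst c z * \1_(`[a, b]%classic) z) x = c * (y - x).
      rewrite cumulB// (eq_Rintegral _ _ (g := cst c)); last first.
        move=> z; rewrite inE/= in_itv/= => zxy.
        by rewrite indicE mem_setb in_itv/= (_ : _ <= _ <= _) ?mulr1//; apply/andP; lra.
      by rewrite Rintegral_cst//= mu_itvoc.
    by rewrite wE !cumulN//; have := ff' x y; lra.
  exact: norm_cumul.
have := @variation_bound R (truncated_gap f F e)
  (fun z => 2 * cumul (fun z => `|w z|) z - signed_gap f F c e z) tau E a b ab.
move=> /(_ (truncated_gap_variation obs e0 DW) mT mt mE Eab cT).
move/le_trans; apply; rewrite lee_fin.
have := norm_signed_gap c obs e0 a; have := norm_signed_gap c obs e0 b.
have : cumul (fun z => `|w z|) b - cumul (fun z => `|w z|) a <= \int[mu]_z `|w z|.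
  by apply: cumul_le_total => //; exact: integrableR_norm.
have -> : \int[mu]_z `|w z| = \int[mu]_x (`|f' x - c| * \1_(`[a, b]%classic) x).
  by apply: eq_RintegralT => z; rewrite /w normrM indicE; case: (_ \in _); rewrite ?normr1 ?normr0.
by rewrite !ler_norml; lra.
Qed.

(** Truncating above the supremum of [F - f] changes nothing, so the variation estimate with c = 0
    bounds the L1 norm of the right derivative minus [f'] on {f < F}, uniformly over bounded
    windows. *)
Lemma obstacle_primitive f f' F : obstacle f F -> primitive f f' ->
  (exists B, forall x, F x - f x <= B) -> exists v, primitive F v.
Proof.
move=> obs pf [B gB]; have [uf uF fF _] := obs; have [if' ff'] := pf.
have ug := unifcB uF uf.
pose A := [set z | 0 < F z - f z].
have cF := unifc_continuous uF; have cg := unifc_continuous ug.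
have mF : measurable_fun setT F by exact: continuous_measurable_fun.
have mg : measurable_fun setT (fun z => F z - f z) by exact: continuous_measurable_fun.
have mA : measurable A.
  by rewrite -[X in measurable X]setTI; exact: (measurable_fun_ltr (measurable_cst (0 : R)) mg).
have posA x : A x -> f x < F x by rewrite /A /= subr_gt0.
pose d x := rderivative F x * \1_A x.
have md : measurable_fun setT d.
  apply: (@measurable_fun_cvg _ _ _ _ (fun n x => rquotient F n x * \1_A x)).
    move=> n; apply: measurable_funM => //; apply: measurable_funM => //.
    by apply: measurable_funB => //; apply: (measurableT_comp mF); exact: measurable_funD.
  move=> x _; rewrite /d indicE; case: (boolP (x \in A)) => [|_]; last first.
    by rewrite mulr0; under eq_fun do rewrite mulr0; exact: cvg_cst.
  rewrite inE => /posA fFx; apply: cvgM; last exact: cvg_cst.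
  exact: rquotient_cvg obs _ fFx.
pose tau x := d x - f' x * \1_A x.
have mt : measurable_fun setT tau.
  by apply: measurable_funB => //; apply: measurable_funM => //; exact: integrableR_meas.
have e0 : 0 < `|B| + 1 by rewrite ltr_wpDl.
have TE : truncated_gap f F (`|B| + 1) = fun x => F x - f x.
  apply/funext => x; apply/min_idPl; rewrite (le_trans (gB x))//.
  by rewrite (le_trans (ler_norm B))// lerDl.
have [it _] : integrableR tau /\
    \int[mu]_x `|tau x| <= 2 * \int[mu]_x `|f' x| + 2 * (`|B| + 1).
  apply: integrableR_of_bounded => // n.
  pose E := A `&` `]- n%:R, n%:R[%classic.
  have mE : measurable E by exact: measurableI.
  have nn : - n%:R <= n%:R :> R by rewrite ge0_cp//.
  have En : E `<=` `]- n%:R, n%:R[%classic by move=> x [].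
  have := @signed_gap_total f f' F 0 (`|B| + 1) _ _ obs e0 pf nn tau E mt mE En.
  rewrite TE => H.
  have -> : (\int[mu]_x (`|tau x| * \1_(`]- n%:R, n%:R[%classic) x)%:E =
      \int[mu]_x (`|tau x| * \1_E x)%:E)%E.
    apply: eq_integral => x _; congr EFin; rewrite /E indicI /=.
    rewrite !indicE; case: (boolP (x \in A)) => xA; first by rewrite mul1r.
    by rewrite /tau /d indicE (negbTE xA) !mulr0 subrr normr0 !mul0r.
  apply: le_trans (H _) _.
    apply: aeS (primitive_derive pf) => x [df dfx] [Ax _].
    have cB : (rquotient F k x - k.+1%:R * (f (x + k.+1%:R^-1) - f x)) @[k --> \oo] -->
        rderivative F x - f' x.
      apply: cvgB; first exact: rquotient_cvg obs _ (posA _ Ax).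
      by rewrite -dfx; exact: derivable_cvg_quotient.
    have -> : tau x = rderivative F x - f' x.
      by rewrite /tau /d indicE mem_set// !mulr1.
    apply: cvg_trans cB; apply: near_eq_cvg; apply: nearW => k /=.
    by rewrite /rquotient; ring.
  rewrite lee_fin lerD2r ler_wpM2l//.
  have -> : (fun x => `|f' x - 0| * \1_(`[- n%:R, n%:R]%classic) x) =
    (fun x => `|f' x| * \1_(`[- n%:R, n%:R]%classic) x).
    by apply/funext => x; rewrite subr0.
  apply: le_Rintegral => //; [|exact: integrableR_norm|].
    by apply: integrableR_indic => //; exact: integrableR_norm.
  by move=> x _; rewrite indicE; case: (_ \in _); rewrite ?mulr1 ?mulr0.
(* Inside a detached interval convexity gives the increments; [primitive_of_positive_part] joins the
   intervals across the contact set. *)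
have pg : primitive (fun x => F x - f x) (fun x => tau x * \1_A x).
  apply: primitive_of_positive_part => //; first by move=> x; rewrite subr_ge0.
  move=> x y xy pxy.
  have := @rderivative_increment f F obs x y (fun z => tau z + f' z).
  have pxy' z : x <= z <= y -> f z < F z by move=> /pxy; rewrite subr_gt0.
  move=> /(_ (integrableRD it if') xy pxy').
  rewrite (cumulD x it if') (cumulD y it if') => H.
  have : F y - F x = cumul tau y + cumul f' y - (cumul tau x + cumul f' x).
    by apply: H => z /pxy zA; rewrite /tau /d indicE mem_set// !mulr1 subrK.
  by have := ff' x y; lra.
exists (fun x => f' x + tau x * \1_A x); have := primitiveD pf pg.
by congr (primitive _ _); apply/funext => x; ring.
Qed.

(** Contact points are kept in the set, which makes it open; by [derivative_eq0_ae] they contribute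
    only a null set. *)
Definition small_gap f f' F v e x : R :=
  `|v x - f' x| * \1_[set z | F z - f z < e] x.

Lemma gap_variation f f' F v c e (a b : R) (w : R -> R) : obstacle f F -> 0 < e ->
  primitive f f' -> primitive F v -> a <= b -> integrableR w ->
  (forall x, a <= x <= b -> `|f' x - c| <= w x) ->
  cumul (small_gap f f' F v e) b - cumul (small_gap f f' F v e) a <= 2 * (cumul w b - cumul w a) + 2 * e.
Proof.
move=> obs e0 pf pF ab iw wc; have [uf uF fF _] := obs.
set Q := small_gap f f' F v e.
have [if' ff'] := pf; have [iv Fv] := pF.
have ug := unifcB uF uf; have cg := unifc_continuous ug.
have mg : measurable_fun setT (fun z => F z - f z) by exact: continuous_measurable_fun.
pose A := [set z | F z - f z < e].
have mA : measurable A.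
  by rewrite -[X in measurable X]setTI; exact: (measurable_fun_ltr mg (measurable_cst e)).
pose tau x := v x - f' x; have it : integrableR tau by exact: integrableRB.
have mt := integrableR_meas it.
have iQ : integrableR Q by apply: integrableR_indic => //; exact: integrableR_norm.
pose E := A `&` `]a, b[%classic; have mE : measurable E by exact: measurableI.
have Eab : E `<=` `]a, b[%classic by move=> x [].
have := @signed_gap_total f f' F c e a b obs e0 pf ab tau E mt mE Eab => H.
have iE : integrableR (fun x => `|tau x| * \1_E x).
  by apply: integrableR_indic => //; exact: integrableR_norm.
have {}H : \int[mu]_x (`|tau x| * \1_E x) <=
    2 * \int[mu]_x (`|f' x - c| * \1_(`[a, b]%classic) x) + 2 * e.
  rewrite -lee_fin {1}/Rintegral fineK; last exact: integrable_fin_num iE.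
  apply: H; apply: aeS (primitive_derive (primitiveB pF pf)) => x [dg dgx] [Ax _].
  have := derivable_cvg_quotient dg; rewrite dgx.
  apply: cvg_trans; apply: near_eq_cvg; near=> n.
  (* The set {F - f < e} is open, so for small steps both ends lie in it and the truncation at [e]
     is inactive. *)
  have Axn : F (x + n.+1%:R^-1) - f (x + n.+1%:R^-1) < e.
    near: n; have cn : (F (x + n.+1%:R^-1) - f (x + n.+1%:R^-1)) @[n --> \oo] --> F x - f x.
      apply: (@cvg_comp _ _ _ (fun n : nat => x + n.+1%:R^-1) (fun z => F z - f z) _ (nbhs x)); last exact: cg.
      exact: cvg_add_harmonic.
    by apply: (cvgr_lt _ cn).
  have tg z : F z - f z < e -> truncated_gap f F e z = F z - f z.
    by move=> h; apply/min_idPl/ltW.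
  by rewrite !tg.
have -> : cumul Q b - cumul Q a = \int[mu]_x (`|tau x| * \1_E x).
  rewrite cumulB// -Rintegral_itv_bndo_bndc; last exact: integrableRS.
  rewrite Rintegral_indic; apply: eq_RintegralT => x.
  by rewrite /Q /small_gap /E indicI/= mulrA.
apply: le_trans H _; rewrite lerD2r ler_wpM2l//.
rewrite cumulB// Rintegral_itv_obnd_cbnd; last exact: integrableRS.
rewrite [leRHS]Rintegral_indic; apply: le_Rintegral => //.
- apply: (integrableR_le _ (integrableR_norm iw)).
    apply: measurable_funM => //; apply: measurableT_comp => //.
    by apply: measurable_funB => //; exact: integrableR_meas.
  move=> x; rewrite normrM normr_id indicE mem_setb in_itv/=.
  case: (boolP (a <= x <= b)) => [/wc h|]; rewrite ?normr1 ?normr0 ?mulr1 ?mulr0//.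
  exact: le_trans h (ler_norm _).
- exact: integrableR_indic.
- move=> x _; rewrite indicE mem_setb in_itv/=.
  by case: (boolP (a <= x <= b)) => [/wc|]; rewrite ?mulr1 ?mulr0.
Unshelve. all: by end_near. Qed.

End obstacle_primitive.

(** * L1 stability of F' under perturbation of the obstacle *)

Section stability.
Context {R : realType}.
Local Notation mu := (@lebesgue_measure R).
Implicit Types (f g u v h F T H tau : R -> R) (x y z a b c e s : R).

Lemma continuous_segment_unif h a b e : continuous h -> 0 < e ->
  exists2 r : R, 0 < r & forall x y, a <= x <= b -> `|x - y| < r -> `|h x - h y| <= e.
Proof.
move=> ch e0; have := @segment_compact R a b => /compact_near_coveringP.
move=> /(_ R (0 : R)^'+ (fun r x => forall y, `|x - y| < r -> `|h x - h y| <= e) _) H.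
have {}H : \forall r \near (0 : R)^'+, `[a, b] `<=`
    (fun x => forall y, `|x - y| < r -> `|h x - h y| <= e).
  apply: H => x _; have e20 : 0 < e / 2 by rewrite divr_gt0.
  have /cvgrPdist_le/(_ _ e20)[d /= d0 hd] := ch x.
  exists (ball x (d / 2), [set r | r < d / 2]).
    split=> /=; first by apply: nbhsx_ballx; rewrite divr_gt0.
    by apply: nbhs_right_lt; rewrite divr_gt0.
  move=> [x' r] [/= xx' rd] y xy.
  have h1 := hd x' ltac:(by apply: lt_trans xx' _; lra).
  have h2 := hd y; rewrite /= in h2.
  have : `|x - y| < d.
    by have := ler_distD x' x y; rewrite /ball/= in xx'; lra.
  by move=> /h2; move: h1; rewrite !ler_norml; lra.
near (0 : R)^'+ => r; exists r; first by near: r; exact: nbhs_right_gt.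
have Hr : `[a, b] `<=` (fun x => forall y, `|x - y| < r -> `|h x - h y| <= e).
  by near: r.
by move=> x y xab xy; apply: Hr => //=; rewrite in_itv.
Unshelve. all: by end_near. Qed.

(* [w] dominates the distance in L1 of [f] to a step function with [n] steps of
   length [L] on [[-M, M]], vanishing outside. *)
Lemma step_approximation f eta : integrableR f -> 0 < eta ->
  exists (M L : R) (n : nat) (w : R -> R),
  [/\ 0 <= M /\ 0 <= L, n%:R * L = M + M,
      [/\ integrableR w, forall x, 0 <= w x & \int[mu]_x w x <= eta],
      (forall k, (k < n)%N -> exists c : R, forall x,
        - M + k%:R * L <= x <= - M + k.+1%:R * L -> `|f x - c| <= w x) &
      forall x, M <= `|x| -> `|f x| <= w x].
Proof.
(* One third of [eta] each: the tails of [f] beyond [M], a continuous L1 approximation [h] on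
   [-M, M], and the oscillation of [h] over one step. *)
move=> if_ eta0; have e30 : 0 < eta / 3 by rewrite divr_gt0.
have [m mP] : exists m : nat, \int[mu]_x (`|f x| * \1_(~` `]- m.+1%:R, m.+1%:R[%classic) x) <= eta / 3.
  have [] := @dominated_cvgR R (fun m x => `|f x| * \1_(~` `]- m.+1%:R, m.+1%:R[%classic) x)
    (cst 0) (fun x => `|f x|).
  - move=> m; apply: measurable_funM.
      by apply: measurableT_comp => //; exact: integrableR_meas.
    by apply: measurable_indic; exact: measurableC.
  - exact: measurable_cst.
  - apply: aeW => x; apply: (@cvg_trans _ ((0 : R) @[_ --> \oo])); last exact: cvg_cst.
    apply: near_eq_cvg; near=> m; rewrite indicE memNset ?mulr0//= => /(_ _); apply.
    rewrite in_itv/= -ltr_norml; apply: lt_le_trans (truncnS_gt _) _.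
    by rewrite ler_nat ltnS; near: m; exact: nbhs_infty_ge.
  - exact: integrableR_norm.
  - apply: aeW => x m; rewrite normrM normr_id -[leRHS]mulr1 ler_wpM2l// indicE.
    by case: (_ \in _); rewrite ?normr1 ?normr0.
  rewrite Rintegral_cst//= mul0r => _ /cvgrPdist_le/(_ _ e30)[m _ /(_ m (leqnn m))].
  by rewrite sub0r normrN => h; exists m; exact: le_trans (ler_norm _) h.
pose M : R := m.+1%:R; have M0 : 0 < M by rewrite ltr0n.
have iab : mu.-integrable `[- M, M] (EFin \o f) by exact: integrableRS.
have [g_ [cg ig gf]] := @approximation_continuous_integrable R `[- M, M]%classic f
  (measurable_itv _) (mu_itv_lty _ _ _ _) iab.
have [h ch hP] : exists2 h : R -> R, continuous h &
    integrableR (fun x => `|f x - h x| * \1_(`[- M, M]%classic) x) /\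
    \int[mu]_x (`|f x - h x| * \1_(`[- M, M]%classic) x) <= eta / 3.
  have : \forall n \near \oo, (\int[mu]_(z in `[(- M)%R, M]) `|(f z - g_ n z)%:E| < (eta / 3)%:E)%E.
    have /fine_cvgP[fn cf] := gf; near=> n.
    have h1 : (\int[mu]_(z in `[(- M)%R, M]) `|(f z - g_ n z)%:E|)%E \is a fin_num by near: n.
    by rewrite -(fineK h1) lte_fin; near: n; exact: (cvgr_lt _ cf).
  move=> [n _ /(_ n (leqnn n)) hn]; exists (g_ n) => //.
  have i1 : mu.-integrable `[- M, M] (EFin \o (fun x => `|f x - g_ n x|)).
    apply: integrable_norm; rewrite (_ : _ \o _ = (EFin \o f) \- (EFin \o g_ n))%E//.
    exact: integrableB.
  split; first exact: integrableR_indic_of.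
  rewrite -Rintegral_indic -lee_fin /Rintegral fineK; first exact: ltW hn.
  exact: integrable_fin_num i1.
have d0 : 0 < eta / 3 / (M + M) by rewrite divr_gt0// addr_gt0.
have [r r0 hr] := continuous_segment_unif (- M) M ch d0.
pose n := (Num.truncn ((M + M) / r)).+1; pose L := (M + M) / n%:R.
have n0 : 0 < n%:R :> R by rewrite ltr0n.
have nL : n%:R * L = M + M by rewrite /L mulrC divfK// gt_eqF.
have L0 : 0 < L by rewrite divr_gt0// addr_gt0.
have Lr : L < r.
  by rewrite ltr_pdivrMr// mulrC -ltr_pdivrMr//; exact: truncnS_gt.
exists M, L, n, (fun x => `|f x - h x| * \1_(`[- M, M]%classic) x
  + eta / 3 / (M + M) * \1_(`[- M, M]%classic) x
  + `|f x| * \1_(~` `]- M, M[%classic) x).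
have i2 : integrableR (fun x => eta / 3 / (M + M) * \1_(`[- M, M]%classic) x).
  apply: (@bounded_integrable_indic _ _ (cst (eta / 3 / (M + M))) (eta / 3 / (M + M))) => //.
    exact: mu_itv_lty.
  by move=> x _; rewrite gtr0_norm.
have i3 : integrableR (fun x => `|f x| * \1_(~` `]- M, M[%classic) x).
  apply: integrableR_indic; last exact: integrableR_norm.
  exact: measurableC.
split=> //; [by split; exact: ltW|split| |].
- by apply: integrableRD => //; apply: integrableRD => //; case: hP.
- have c0 := ltW d0.
  by move=> x; do !apply: addr_ge0; apply: mulr_ge0 => //; rewrite indicE ler0n.
- have i12 := integrableRD hP.1 i2; rewrite RintegralD// RintegralD//; last by case: hP.
  rewrite -[X in _ + X + _]Rintegral_indic Rintegral_cst//=.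
  have -> : mu [set` `[- M, M]] = (M + M)%:E.
    by rewrite lebesgue_measure_itv/= lte_fin gt0_cp// -EFinB opprK.
  rewrite /= divfK ?gt_eqF ?addr_gt0//.
  by have := hP.2; have := mP; rewrite -/M; lra.
- move=> k kn; exists (h (- M + k%:R * L)) => x /andP[kx xk].
  have kL : 0 <= k%:R * L by rewrite mulr_ge0// ltW.
  have kL' : k.+1%:R * L <= M + M by rewrite -nL ler_wpM2r ?(ltW L0)// ler_nat.
  rewrite -natr1 mulrDl mul1r in xk kL'.
  have xM : - M <= x <= M by apply/andP; lra.
  rewrite !indicE !mem_setb in_itv/= xM !mulr1.
  have : `|x - (- M + k%:R * L)| < r by rewrite ger0_norm; lra.
  move=> /(hr _ _ xM) hx; have := ler_distD (h x) (f x) (h (- M + k%:R * L)).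
  have : 0 <= `|f x| * (x \in ~` `]- M, M[%classic)%:R by rewrite mulr_ge0.
  by lra.
- move=> x Mx; rewrite !indicE (_ : x \in ~` `]- M, M[%classic); last first.
    by rewrite inE/= in_itv/= -ltr_norml; apply/negP; rewrite -leNgt.
  by rewrite mulr1 lerDr addr_ge0// mulr_ge0// ltW.
Unshelve. all: by end_near. Qed.

Lemma small_gap_integrable f f' F v e : obstacle f F -> primitive f f' ->
  primitive F v -> integrableR (small_gap f f' F v e).
Proof.
move=> [uf uF _ _] pf pF; apply: integrableR_indic.
  have mg : measurable_fun setT (fun z => F z - f z).
    by apply: continuous_measurable_fun; apply: unifc_continuous; exact: unifcB.
  by rewrite -[X in measurable X]setTI; exact: (measurable_fun_ltr mg (measurable_cst e)).
by apply/integrableR_norm/integrableRB; [case: pF|case: pf].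
Qed.

Lemma small_gap_ge0 f f' F v e x : 0 <= small_gap f f' F v e x.
Proof. by rewrite mulr_ge0// indicE ler0n. Qed.

(** Sum [gap_variation] over the steps of a step function close to [f], taking for [c] the value of
    the step and 0 on the tails. [K] is chosen before the obstacle, so the estimate is uniform along
    a sequence of obstacles. *)
Lemma small_gap_uniformly_small f eta : integrableR f -> 0 < eta ->
  exists2 K : R, 0 <= K & forall f1 f1' F v e, 0 < e -> obstacle f1 F ->
    primitive f1 f1' -> primitive F v ->
    \int[mu]_x small_gap f1 f1' F v e x <=
      2 * \int[mu]_x `|f1' x - f x| + eta + K * e.
Proof.
move=> if_ eta0; have e20 : 0 < eta / 2 by rewrite divr_gt0.
have [M [L [n [w [[M0 L0] nL [iw w0 weta] wc wM]]]]] := step_approximation if_ e20.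
(* Each of the [n] steps and the two tails costs [2 * e]. The approximation error enters doubled, so
   it was taken to be [eta / 2]. *)
exists (2 * (n%:R + 2)) => [|f1 f1' F v e e0 obs pf pF].
  by rewrite mulr_ge0// addr_ge0.
have i1 : integrableR (fun x => `|f1' x - f x|).
  by apply/integrableR_norm/integrableRB => //; case: pf.
pose W x := `|f1' x - f x| + w x.
have iW : integrableR W by exact: integrableRD.
have W0 x : 0 <= W x by rewrite addr_ge0.
set Q := small_gap f1 f1' F v e.
have iQ : integrableR Q by exact: small_gap_integrable.
have Q0 x : 0 <= Q x by exact: small_gap_ge0.
have gv c a b : a <= b -> (forall x, a <= x <= b -> `|f1' x - c| <= W x) ->
    cumul Q b - cumul Q a <= 2 * (cumul W b - cumul W a) + 2 * e.
  by move=> ab h; apply: (gap_variation obs e0 pf pF ab iW h).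
have cells k : (k <= n)%N -> cumul Q (- M + k%:R * L) - cumul Q (- M) <=
    2 * (cumul W (- M + k%:R * L) - cumul W (- M)) + 2 * e * k%:R.
  elim: k => [_|k IH kn]; first by rewrite mul0r addr0 !subrr !mulr0 addr0.
  have [c cP] := wc _ kn.
  have := gv c (- M + k%:R * L) (- M + k.+1%:R * L).
  have -> : - M + k%:R * L <= - M + k.+1%:R * L by rewrite lerD2l ler_wpM2r// ler_nat.
  move=> /(_ isT) gvk; have := IH (ltnW kn).
  have : cumul Q (- M + k.+1%:R * L) - cumul Q (- M + k%:R * L) <=
      2 * (cumul W (- M + k.+1%:R * L) - cumul W (- M + k%:R * L)) + 2 * e.
    apply: gvk => x xk; rewrite /W.
    by have := cP _ xk; have := ler_distD (f x) (f1' x) c; lra.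
  have : 2 * e * k.+1%:R = 2 * e * k%:R + 2 * e by rewrite -natr1; ring.
  move: (cumul Q _) (cumul Q _) (cumul Q _) (cumul W _) (cumul W _) (cumul W _).
  move: (2 * e * k.+1%:R) (2 * e * k%:R) => ? ? ? ? ? ? ? ?; lra.
have all b : M <= b -> cumul Q b - cumul Q (- b) <= 2 * \int[mu]_x W x + 2 * (n%:R + 2) * e.
  move=> Mb; have fW x : M <= `|x| -> `|f1' x - 0| <= W x.
    move=> /wM; rewrite subr0 /W; have := ler_distD (f x) (f1' x) 0.
    by rewrite !subr0; lra.
  have t1 := gv 0 M b Mb.
  have {}t1 : cumul Q b - cumul Q M <= 2 * (cumul W b - cumul W M) + 2 * e.
    by apply: t1 => x /andP[Mx _]; apply: fW; rewrite ger0_norm// (le_trans M0).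
  have bM : - b <= - M by rewrite lerN2.
  have t2 := gv 0 (- b) (- M) bM.
  have {}t2 : cumul Q (- M) - cumul Q (- b) <= 2 * (cumul W (- M) - cumul W (- b)) + 2 * e.
    apply: t2 => x /andP[_ xM]; apply: fW; rewrite ler0_norm; first by lra.
    by rewrite (le_trans xM)// oppr_le0.
  have := cells n (leqnn n); rewrite nL addKr => t3.
  have bb : - b <= b by lra.
  have := cumul_le_total iW bb W0.
  by lra.
have EW : \int[mu]_x W x = \int[mu]_x `|f1' x - f x| + \int[mu]_x w x by rewrite RintegralD.
have [_] : integrableR Q /\ \int[mu]_x `|Q x| <= 2 * \int[mu]_x W x + 2 * (n%:R + 2) * e.
  apply: integrableR_of_bounded => [|k]; first exact: integrableR_meas.
  have [b Mb kb] : exists2 b : R, M <= b & k%:R <= b.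
    by exists (Num.max k%:R M); rewrite le_max lexx ?orbT.
  have bb : - b <= b by rewrite ge0_cp// (le_trans M0).
  have ik : integrableR (fun x => `|Q x| * \1_(`]- k%:R, k%:R[%classic) x).
    by apply: integrableR_indic => //; exact: integrableR_norm.
  rewrite -(fineK (integrable_fin_num measurableT ik)) lee_fin.
  apply: le_trans (all b Mb); rewrite cumulB// -Rintegral_itv_bndo_bndc; last exact: integrableRS.
  rewrite [leRHS]Rintegral_indic; apply: le_Rintegral => //; first exact: integrableR_indic.
  move=> x _; rewrite ger0_norm// ler_wpM2l// !indicE !mem_setb !in_itv/=.
  case: (boolP (- k%:R < x < k%:R)) => // xk.
  rewrite (_ : - b < x < b)//; move: xk; rewrite -!ltr_norml => xk.
  exact: lt_le_trans xk kb.
have -> : \int[mu]_x `|Q x| = \int[mu]_x Q x.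
  by apply: eq_RintegralT => x; rewrite ger0_norm.
by rewrite EW; lra.
Qed.

Lemma derivable_cvg_left_quotient F x : derivable F x 1 ->
  n.+1%:R * (F x - F (x - n.+1%:R^-1)) @[n --> \oo] --> derive1 F x.
Proof.
move=> dF; have : h^-1 *: (F (h + x) - F x) @[h --> 0^'] --> derive1 F x.
  move: dF => /cvg_ex[/= l Fl]; suff -> : derive1 F x = l.
    by move: Fl; under eq_fun do rewrite scaler1.
  by apply: cvg_lim => //; move: Fl; under eq_fun do rewrite scaler1.
move=> /cvgr_dnbhsP/(_ (fun n => - n.+1%:R^-1)) H.
have : (forall n : nat, - n.+1%:R^-1 != 0 :> R) /\ - n.+1%:R^-1 @[n --> \oo] --> (0 : R).
  split; first by move=> n; rewrite oppr_eq0 invr_eq0 pnatr_eq0.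
  by rewrite -oppr0; apply: cvgN; exact: cvg_harmonic.
move=> /H; apply: cvg_trans; apply: near_eq_cvg; apply: nearW => n.
by rewrite /= invrN invrK [_ + x]addrC scaleNr -scalerN opprB.
Qed.

(** By convexity each right derivative lies between its left and right slopes of step [s]. The two
    slopes of [F] differ by its second difference over [s], and passing from [F] to [F1] moves a
    slope by at most [2 * d / s]. *)
Lemma rderivative_dist f1 F1 f F x (s d : R) : obstacle f1 F1 -> obstacle f F -> 0 < s ->
  (forall z, x - s <= z <= x + s -> f1 z < F1 z /\ f z < F z) ->
  (forall z, `|F1 z - F z| <= d) ->
  `|rderivative F1 x - rderivative F x| <=
    s^-1 * (F (x + s) + F (x - s) - 2 * F x) + 2 * d / s.
Proof.
move=> o1 o s0 pos FF; have xs : x < x + s by rewrite ltrDl.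
have sx : x - s < x by rewrite gtrDl oppr_lt0.
have h1 k K : obstacle k K -> (forall z, x - s <= z <= x + s -> k z < K z) ->
    s^-1 * (K x - K (x - s)) <= rderivative K x <= s^-1 * (K (x + s) - K x).
  move=> ok pk; have p1 z : x <= z <= x + s -> k z < K z.
    by move=> /andP[xz zx]; apply: pk; rewrite zx (le_trans (ltW sx)).
  have p2 z : x - s <= z <= x -> k z < K z.
    by move=> /andP[xz zx]; apply: pk; rewrite xz (le_trans zx)// ltW.
  have kx : k (x + s) < K (x + s) by apply: p1; rewrite lexx ltW.
  have := rderivative_le ok xs p1 kx.
  have := rderivative_ge ok sx p2.
  rewrite [_ / (x + s - x)]mulrC [_ / (x - (x - s))]mulrC.
  have -> : x + s - x = s by rewrite addrC addKr.
  have -> : x - (x - s) = s by rewrite opprB addrC subrK.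
  by move=> -> ->.
have /andP[a1 a2] := h1 _ _ o1 (fun z hz => (pos z hz).1).
have /andP[b1 b2] := h1 _ _ o (fun z hz => (pos z hz).2).
have i0 : 0 < s^-1 by rewrite invr_gt0.
have e1 := FF x; have e2 := FF (x + s); have e3 := FF (x - s).
rewrite !ler_norml in e1 e2 e3.
have c2 : s^-1 * (F1 (x + s) - F1 x) <= s^-1 * (F (x + s) - F x + 2 * d).
  by rewrite ler_wpM2l ?(ltW i0)//; lra.
have c1 : s^-1 * (F x - F (x - s) - 2 * d) <= s^-1 * (F1 x - F1 (x - s)).
  by rewrite ler_wpM2l ?(ltW i0)//; lra.
rewrite mulrDr in c2; rewrite mulrBr in c1.
have -> : s^-1 * (F (x + s) + F (x - s) - 2 * F x) + 2 * d / s =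
  s^-1 * (F (x + s) - F x) - s^-1 * (F x - F (x - s)) + s^-1 * (2 * d) by ring.
by rewrite ler_norml; lra.
Qed.

(** At a point where [F] is differentiable the second difference over the step is small for a
    suitable step; with that step fixed, uniform convergence removes the other term of
    [rderivative_dist]. The same estimate with one fixed step dominates, and the set is bounded
    because [F] vanishes at infinity. *)
Lemma detached_stability (f_ F_ v_ : nat -> R -> R) f F v e :
  (forall j, obstacle (f_ j) (F_ j)) -> obstacle f F ->
  (forall j, primitive (F_ j) (v_ j)) -> primitive F v ->
  (forall x, 0 <= f x) ->
  (forall e : R, 0 < e -> exists M : R, forall x, M <= `|x| -> F x <= e) ->
  (forall e, 0 < e -> \forall j \near \oo,
    forall x, `|f_ j x - f x| <= e /\ `|F_ j x - F x| <= e) ->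
  0 < e ->
  \int[mu]_x (`|v_ j x - v x| * \1_[set x | e <= F x - f x] x) @[j --> \oo] --> (0 : R).
Proof.
move=> oj o pj pF f0 F0 fF e0.
have [uf uF fleF _] := o; have [B FB] := primitive_bounded pF.
have e20 : 0 < e / 2 by rewrite divr_gt0.
have e80 : 0 < e / 8 by rewrite divr_gt0.
(* Within [r = d / 2] of a point with gap at least [e], the gap of [F] stays at least [e / 2]. The
   errors [e / 8] in [f_ j] and [F_ j] leave a gap of at least [e / 4]. *)
have [d d0 hd] := unifcB uF uf e20.
pose r := d / 2; have r0 : 0 < r by rewrite divr_gt0.
have [M MP] := F0 _ e20.
have [N _ NP] := fF _ e80.
pose S := [set x | e <= F x - f x].
have mS : measurable S.
  have -> : S = ~` [set x | F x - f x < e].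
    by apply/seteqP; split=> x; rewrite /S /= leNgt => /negP.
  apply: measurableC; have mg : measurable_fun setT (fun z => F z - f z).
    by apply: continuous_measurable_fun; apply: unifc_continuous; exact: unifcB.
  by rewrite -[X in measurable X]setTI; exact: (measurable_fun_ltr mg (measurable_cst e)).
have SM x : S x -> `|x| < M.
  rewrite /S /= => Sx; rewrite ltNge; apply/negP => /MP; have := f0 x; lra.
have posS x z j : S x -> x - r <= z <= x + r -> (N <= j)%N ->
    f_ j z < F_ j z /\ f z < F z.
  rewrite /S /= => Sx zx Nj; have xz : `|x - z| < d by rewrite ltr_norml; apply/andP; rewrite /r in zx; lra.
  have := hd _ _ xz; have [] := NP j Nj z; rewrite !ler_norml; lra.
have aeD : {ae mu, forall x, (forall j, rderivative (F_ j) x = v_ j x) /\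
    rderivative F x = v x /\ n.+1%:R * (F (x + n.+1%:R^-1) + F (x - n.+1%:R^-1) - 2 * F x)
      @[n --> \oo] --> (0 : R)}.
  have a1 : {ae mu, forall x, forall j, derivable (F_ j) x 1 /\ derive1 (F_ j) x = v_ j x}.
    by apply: ae_foralln => j; exact: primitive_derive.
  apply: aeS (aeI a1 (primitive_derive pF)) => x [xj [dF dFx]]; split; [|split].
  - move=> j; have [dFj <-] := xj j.
    exact: (cvg_lim (@norm_hausdorff _ _) (derivable_cvg_quotient dFj)).
  - by rewrite -dFx; exact: (cvg_lim (@norm_hausdorff _ _) (derivable_cvg_quotient dF)).
  - rewrite -(subrr (v x)) -dFx.
    have c : n.+1%:R * (F (x + n.+1%:R^-1) - F x) - n.+1%:R * (F x - F (x - n.+1%:R^-1))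
        @[n --> \oo] --> derive1 F x - derive1 F x.
      by apply: cvgB; [exact: derivable_cvg_quotient|exact: derivable_cvg_left_quotient].
    apply: cvg_trans c; apply: near_eq_cvg; apply: nearW => n /=; ring.
(* The bound of [rderivative_dist] at step [r]: a second difference of [F] is at most [4 * B], and
   the uniform distance is at most [e / 8]. *)
pose C := r^-1 * (4 * B) + 2 * (e / 8) / r.
have B0 : 0 <= B by apply: le_trans (FB 0).
have C0 : 0 <= C.
  by rewrite addr_ge0// ?mulr_ge0// ?divr_ge0 ?invr_ge0 ?(ltW r0)// ltW.
have iv j := (pj j).1; have ivF := pF.1.
have iS j : integrableR (fun x => `|v_ j x - v x| * \1_S x).
  by apply: integrableR_indic => //; apply/integrableR_norm/integrableRB.
rewrite -(cvg_shiftn N).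
have [] := @dominated_cvgR R (fun j x => `|v_ (j + N)%N x - v x| * \1_S x) (cst 0)
  (fun x => C * \1_(`[- M, M]%classic) x).
- by move=> j; exact: integrableR_meas.
- exact: measurable_cst.
- apply: aeS aeD => x [xj [xF xB]].
  have [Sx|nSx] := pselect (S x); last first.
    apply: (@cvg_trans _ ((0 : R) @[_ --> \oo])); last exact: cvg_cst.
    by apply: near_eq_cvg; apply: nearW => j; rewrite indicE memNset ?mulr0.
  apply/cvgrPdist_le => /= k k0; have k20 : 0 < k / 2 by rewrite divr_gt0.
  have [n nr nB] : exists2 n : nat, n.+1%:R^-1 < r &
      n.+1%:R * (F (x + n.+1%:R^-1) + F (x - n.+1%:R^-1) - 2 * F x) <= k / 2.
    have h1 := near_infty_natSinv_lt (PosNum r0).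
    have h2 : \forall n \near \oo,
        n.+1%:R * (F (x + n.+1%:R^-1) + F (x - n.+1%:R^-1) - 2 * F x) < k / 2.
      exact: (cvgr_lt _ xB).
    have [n _ /(_ n (leqnn n))[? ?]] := filterI h1 h2.
    by exists n => //; exact: ltW.
  (* The step 1/(n+1) is already fixed; this accuracy makes the term [2 * dl / s] equal to
     [k / 2]. *)
  pose dl := k / 4 / n.+1%:R; have dl0 : 0 < dl by rewrite !divr_gt0.
  have [J _ JP] := fF _ dl0.
  exists J => // j /= Jj; rewrite sub0r normrN indicE mem_set// mulr1 normr_id.
  rewrite -xj -xF.
  have n0 : 0 < n.+1%:R^-1 :> R by [].
  have pos' z : x - n.+1%:R^-1 <= z <= x + n.+1%:R^-1 -> f_ (j + N)%N z < F_ (j + N)%N z /\ f z < F z.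
    move=> /andP[z1 z2]; apply: (posS x) => //; last exact: leq_addl.
    by rewrite (le_trans _ z1) ?(le_trans z2)// ?lerD2l ?lerN2 ltW.
  have JN : (J <= j + N)%N by rewrite (leq_trans Jj)// leq_addr.
  have := rderivative_dist (oj _) o n0 pos' (fun z => (JP _ JN z).2).
  move=> /le_trans; apply; rewrite !invrK.
  have -> : 2 * dl * n.+1%:R = k / 2 by rewrite /dl mulrA divfK ?pnatr_eq0//; lra.
  by lra.
- apply: (@bounded_integrable_indic _ _ (cst C) `|C|) => //; exact: mu_itv_lty.
- apply: aeS aeD => x [xj [xF _]] j.
  rewrite normrM normr_id; have [Sx|nSx] := pselect (S x); last first.
    by rewrite [\1_S x]indicE memNset// normr0 mulr0 mulr_ge0// indicE ler0n.
  rewrite !indicE mem_set// normr1 mulr1 mem_setb in_itv/= -ler_norml (ltW (SM _ Sx)) mulr1.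
  rewrite -xj -xF.
  have NjN : (N <= j + N)%N by exact: leq_addl.
  have := rderivative_dist (oj (j + N)%N) o r0 (fun z hz => posS x z _ Sx hz NjN) (fun z => (NP _ NjN z).2).
  move=> /le_trans; apply; rewrite /C lerD2r ler_wpM2l ?invr_ge0 ?(ltW r0)//.
  have := FB x; have := FB (x + r); have := FB (x - r); rewrite !ler_norml; lra.
by move=> _; rewrite Rintegral_cst//= mul0r.
Qed.

(** Where the gap of [F_ j] is below [e], that of [F] is below [2 * e], and v_j is compared with v
    through f'_j and f'. Elsewhere the gap of [F] is at least [e / 2] and [detached_stability]
    applies. *)
Lemma obstacle_stability (f_ f'_ F_ v_ : nat -> R -> R) f f' F v :
  (forall j, obstacle (f_ j) (F_ j)) -> obstacle f F ->
  (forall j, primitive (f_ j) (f'_ j)) -> primitive f f' ->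
  (forall j, primitive (F_ j) (v_ j)) -> primitive F v ->
  (forall x, 0 <= f x) ->
  (forall e : R, 0 < e -> exists M : R, forall x, M <= `|x| -> F x <= e) ->
  (forall e, 0 < e -> \forall j \near \oo,
    forall x, `|f_ j x - f x| <= e /\ `|F_ j x - F x| <= e) ->
  \int[mu]_x `|f'_ j x - f' x| @[j --> \oo] --> (0 : R) ->
  \int[mu]_x `|v_ j x - v x| @[j --> \oo] --> (0 : R).
Proof.
move=> oj o pfj pf pFj pF f0 F0 fF cf'.
(* The budget in tenths of [eta]: two for [2 * |f'_j - f'|], four for the small gap of [F_ j], three
   for that of [F], where [K] multiplies [2 * e], and one for the detached part. *)
apply/cvgrPdist_le => /= eta eta0; have e0 : 0 < eta / 10 by rewrite divr_gt0.
have [if' _] := pf; have [iv _] := pF.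
have [K K0 KP] := small_gap_uniformly_small if' e0.
pose e := eta / 10 / (K + 1); have K10 : 0 < K + 1 by lra.
have ee0 : 0 < e by rewrite divr_gt0.
have Ke : K * e <= eta / 10.
  have : (K + 1) * e = eta / 10 by rewrite /e mulrC divfK ?gt_eqF.
  by lra.
have e20 : 0 < e / 4 by rewrite divr_gt0.
have e2e : 0 < e / 2 by rewrite divr_gt0.
have c3 := detached_stability oj o pFj pF f0 F0 fF e2e.
near=> j; rewrite sub0r normrN ger0_norm ?Rintegral_ge0//.
have [if'j _] := pfj j; have [ivj _] := pFj j.
have jF x : `|f_ j x - f x| <= e / 4 /\ `|F_ j x - F x| <= e / 4.
  by move: x; near: j; exact: fF.
have j1 : \int[mu]_x `|f'_ j x - f' x| < eta / 10 by near: j; exact: (cvgr_lt _ cf').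
have j3 : \int[mu]_x (`|v_ j x - v x| * \1_[set x | e / 2 <= F x - f x] x) < eta / 10.
  by near: j; exact: (cvgr_lt _ c3).
have k1 := KP _ _ _ _ _ ee0 (oj j) (pfj j) (pFj j).
have k2 := KP _ _ _ _ _ (mulr_gt0 (@ltr0n R 2) ee0) o pf pF.
have z0 : \int[mu]_x `|f' x - f' x| = 0.
  rewrite (_ : (fun x => _) = cst 0) ?Rintegral_cst ?mul0r//.
  by apply/funext => x; rewrite subrr normr0.
rewrite z0 in k2.
pose S := [set x | e / 2 <= F x - f x].
have [uf uF _ _] := o.
have mS : measurable S.
  have -> : S = ~` [set x | F x - f x < e / 2].
    by apply/seteqP; split=> x; rewrite /S /= leNgt => /negP.
  apply: measurableC; have mg : measurable_fun setT (fun z => F z - f z).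
    by apply: continuous_measurable_fun; apply: unifc_continuous; exact: unifcB.
  by rewrite -[X in measurable X]setTI; exact: (measurable_fun_ltr mg (measurable_cst (e / 2))).
have i1 : integrableR (fun x => `|f'_ j x - f' x|) by exact/integrableR_norm/integrableRB.
have i2 := small_gap_integrable e (oj j) (pfj j) (pFj j).
have i3 := small_gap_integrable (2 * e) o pf pF.
have i4 : integrableR (fun x => `|v_ j x - v x| * \1_S x).
  by apply: integrableR_indic => //; exact/integrableR_norm/integrableRB.
have i11 := integrableRZ 2 i1.
have i12 := integrableRD i11 i2; have i13 := integrableRD i12 i3.
have i14 := integrableRD i13 i4.
apply: (@le_trans _ _ (\int[mu]_x (2 * `|f'_ j x - f' x| + small_gap (f_ j) (f'_ j) (F_ j) (v_ j) e x
   + small_gap f f' F v (2 * e) x + `|v_ j x - v x| * \1_S x))).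
  apply: le_Rintegral => //; first exact/integrableR_norm/integrableRB.
  move=> x _; rewrite /small_gap /S !indicE !mem_setb.
  have [h1 h2] := jF x.
  have n1 := normr_ge0 (f'_ j x - f' x); have n2 := normr_ge0 (v_ j x - v x).
  have n3 := normr_ge0 (v_ j x - f'_ j x); have n4 := normr_ge0 (v x - f' x).
  have [gj|gj] := ltP (F_ j x - f_ j x) e; rewrite ?mulr1 ?mulr0.
    have -> : F x - f x < 2 * e by move: h1 h2; rewrite !ler_norml; lra.
    have := ler_distD (f'_ j x) (v_ j x) (v x); have := ler_distD (f' x) (f'_ j x) (v x).
    rewrite (distrC (f' x) (v x)) mulr1; have : 0 <= `|v_ j x - v x| * (e / 2 <= F x - f x)%R%:R.
      by rewrite mulr_ge0.
    by lra.
  have -> : e / 2 <= F x - f x by move: h1 h2; rewrite !ler_norml; lra.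
  have : 0 <= `|v x - f' x| * (F x - f x < 2 * e)%R%:R by rewrite mulr_ge0.
  by rewrite mulr1; lra.
rewrite RintegralD// RintegralD// RintegralD// RintegralZl//.
by move: j1 j3 k1 k2; rewrite -/S; lra.
Unshelve. all: by end_near. Qed.

End stability.

(** * Averages at all scales and their supremum *)

Section averages.
Context {R : realType}.
Local Notation mu := (@lebesgue_measure R).
Implicit Types (f g u v phi : R -> R) (x y z t d : R).

Definition averaging_kernel phi (C : R) : Prop :=
  [/\ continuous phi, forall z, 0 <= phi z, forall z, phi (- z) = phi z,
      integrableR phi /\ \int[mu]_z phi z = 1 &
      forall z, phi z <= C /\ `|z| * phi z <= C].

Definition profile f (B : R) : Prop :=
  [/\ unifc f, forall x, 0 <= f x <= B & integrableR f].

Definition average phi f t x : R := convolution f (dilation phi t) x.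

Definition max_average phi f x : R := sup [set average phi f t x | t in [set t | 0 < t]].

Variables (phi : R -> R) (C : R).
Hypothesis kphi : averaging_kernel phi C.

Let cphi : continuous phi. Proof. by case: kphi. Qed.
Let phi0 z : 0 <= phi z. Proof. by case: kphi. Qed.
Let phiN z : phi (- z) = phi z. Proof. by case: kphi. Qed.
Let iphi : integrableR phi. Proof. by case: kphi => _ _ _ []. Qed.
Let phi1 : \int[mu]_z phi z = 1. Proof. by case: kphi => _ _ _ []. Qed.
Let phiC z : phi z <= C. Proof. by case: kphi => _ _ _ _ /(_ z)[]. Qed.
Let zphiC z : `|z| * phi z <= C. Proof. by case: kphi => _ _ _ _ /(_ z)[]. Qed.

Lemma kernel_bound_ge0 : 0 <= C. Proof. exact: le_trans (phi0 0) (phiC 0). Qed.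

Lemma dilation_ge0 t z : 0 < t -> 0 <= dilation phi t z.
Proof. by move=> t0; rewrite mulr_ge0// invr_ge0 ltW. Qed.

Lemma dilation_le t z : 0 < t -> dilation phi t z <= C / t.
Proof. by move=> t0; rewrite /dilation mulrC ler_wpM2r// invr_ge0 ltW. Qed.

Lemma norm_dilation_le t z : 0 < t -> `|z| * dilation phi t z <= C.
Proof.
move=> t0; have := zphiC (z / t); rewrite normrM (gtr0_norm (_ : 0 < t^-1)) ?invr_gt0//.
by rewrite /dilation mulrA.
Qed.

Lemma continuous_dilation t : continuous (dilation phi t).
Proof.
move=> z; apply: cvgM; first exact: cvg_cst.
apply: (@continuous_comp _ _ _ (fun z => z / t) phi); last exact: cphi.
by apply: cvgM; [exact: cvg_id|exact: cvg_cst].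
Qed.

Lemma continuous_dilationB t x : continuous (fun y => dilation phi t (x - y)).
Proof.
move=> y; apply: (@continuous_comp _ _ _ (fun y => x - y)); last exact: continuous_dilation.
by apply: cvgB; [exact: cvg_cst|exact: cvg_id].
Qed.

Lemma integrable_average f t x : integrableR f -> 0 < t ->
  integrableR (fun y => f y * dilation phi t (x - y)).
Proof.
move=> fi t0; apply: (@integrableRMb _ _ _ (C / t)) => //.
  by apply: continuous_measurable_fun; exact: continuous_dilationB.
by move=> y; rewrite ger0_norm ?dilation_ge0// dilation_le.
Qed.

Lemma integrable_scaled f (B t x : R) : profile f B ->
  integrableR (fun z => f (x + t * z) * phi z).
Proof.
move=> [uf fB _]; rewrite (_ : (fun z => _) = fun z => phi z * f (x + t * z)); last first.
  by apply/funext => z; rewrite mulrC.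
apply: (@integrableRMb _ _ _ B) => //; last first.
  by move=> z; have /andP[f0 fb] := fB (x + t * z); rewrite ger0_norm.
apply: continuous_measurable_fun => z.
apply: (@continuous_comp _ _ _ (fun z => x + t * z) f); last exact: unifc_continuous.
by apply: cvgD; [exact: cvg_cst|apply: cvgM; [exact: cvg_cst|exact: cvg_id]].
Qed.

(** Substitute y = x + t z; evenness of [phi] absorbs the sign. The right-hand side also makes sense
    at t = 0, where [scaled0] gives it the value [f x]. *)
Lemma average_scaled f (B t x : R) : profile f B -> 0 < t ->
  average phi f t x = \int[mu]_z (f (x + t * z) * phi z).
Proof.
move=> [uf fB _] t0; have cf := unifc_continuous uf.
pose F z := x + t * z.
have dF z : is_derive z (1 : R) F t.
  have := is_derive1_affine t (- (x / t)) z; congr is_derive; apply/funext => w.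
  by rewrite opprK mulrDr [t * (x / t)]mulrC divfK ?gt_eqF// addrC.
have F' : derive1 F = cst t by exact: derive1_eq.
rewrite /average /convolution /Rintegral.
rewrite (@increasing_ge0_integration_by_substitutionT _ F (fun y => f y * dilation phi t (x - y))).
- congr fine; apply: eq_integral => z _; congr EFin; rewrite F' mulrfctE /F /dilation/=.
  have -> : (x - (x + t * z)) / t = - z.
    by rewrite opprD addNKr mulNr mulrAC mulfV ?mul1r// gt_eqF.
  by rewrite phiN -mulrA [t^-1 * _]mulrC -mulrA mulVf ?mulr1// gt_eqF.
- by move=> a b ab; rewrite /F ltrD2l ltr_pM2l.
- by rewrite F'; exact: cst_continuous.
- by rewrite F'; apply: is_cvg_cst.
- by rewrite F'; apply: is_cvg_cst.
- by move=> z; have := dF z; move=> /@ex_derive.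
- by apply: cvg_comp (cvg_addrl_Ny x); apply: gt0_cvgMrNy => //; exact: cvg_id.
- by apply: cvg_comp (cvg_addrl x); apply: gt0_cvgMry => //; exact: cvg_id.
- move=> y; apply: cvgM; first exact: cf.
  exact: continuous_dilationB.
- by move=> y; rewrite mulr_ge0 ?dilation_ge0//; case/andP: (fB y).
Qed.

Lemma average_le f (B t x : R) : profile f B -> 0 < t -> average phi f t x <= B.
Proof.
move=> fB t0; rewrite (average_scaled x fB t0).
rewrite -[leRHS]mulr1 -phi1 -RintegralZl//.
apply: le_Rintegral => //; [exact: integrable_scaled fB|exact: integrableRZ|].
by move=> z _; rewrite ler_wpM2r//; case: fB => _ /(_ (x + t * z))/andP[].
Qed.

Lemma average_dist f1 f2 (B1 B2 d t x1 x2 : R) : profile f1 B1 -> profile f2 B2 ->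
  (forall y, `|f1 (x1 + y) - f2 (x2 + y)| <= d) -> 0 < t ->
  `|average phi f1 t x1 - average phi f2 t x2| <= d.
Proof.
move=> p1 p2 fd t0; rewrite (average_scaled x1 p1 t0) (average_scaled x2 p2 t0).
have i1 := integrable_scaled t x1 p1; have i2 := integrable_scaled t x2 p2.
rewrite -RintegralB//; apply: le_trans (le_normr_Rintegral _ _) _ => //.
  exact: integrableRB.
rewrite -[leRHS]mulr1 -phi1 -RintegralZl//.
apply: le_Rintegral => //; [exact/integrableR_norm/integrableRB|exact: integrableRZ|].
by move=> z _; rewrite -mulrBl normrM (ger0_norm (phi0 z)) ler_wpM2r.
Qed.

Lemma average_le_mass f t x (B : R) : profile f B -> 0 < t ->
  average phi f t x <= C / t * \int[mu]_y f y.
Proof.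
move=> [_ fB fi] t0; rewrite -RintegralZl//.
apply: le_Rintegral => //; [exact: integrable_average|exact: integrableRZ|].
by move=> y _; rewrite mulrC ler_wpM2r ?dilation_le//; case/andP: (fB y).
Qed.

Lemma continuous_scaled f (B x : R) : profile f B ->
  continuous (fun t => \int[mu]_z (f (x + t * z) * phi z)).
Proof.
move=> fB t; have [uf fb fi] := fB; apply/(@cvg_nbhsP _ R^o) => t_ tcvg.
have cf := unifc_continuous uf.
have [] := @dominated_cvgR R (fun n z => f (x + t_ n * z) * phi z)
  (fun z => f (x + t * z) * phi z) (fun z => B * phi z) => //.
- by move=> n; apply: integrableR_meas; exact: integrable_scaled fB.
- by apply: integrableR_meas; exact: integrable_scaled fB.
- apply: aeW => z; apply: cvgM; last exact: cvg_cst.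
  have c : x + t_ n * z @[n --> \oo] --> x + t * z.
    by apply: cvgD; [exact: cvg_cst|apply: cvgM => //; exact: cvg_cst].
  by apply: (continuous_cvg _ _ c); exact: cf.
- exact: integrableRZ.
- apply: aeW => z n; have /andP[f0 f1] := fb (x + t_ n * z).
  by rewrite ger0_norm ?mulr_ge0// ler_wpM2r.
Qed.

Lemma scaled0 f x : \int[mu]_z (f (x + 0 * z) * phi z) = f x.
Proof.
under eq_Rintegral do rewrite mul0r addr0.
by rewrite RintegralZl// phi1 mulr1.
Qed.

Lemma has_sup_average f (B x : R) : profile f B ->
  has_sup [set average phi f t x | t in [set t | 0 < t]].
Proof.
move=> fB; split; first by exists (average phi f 1 x); exists 1 => //=.
by exists B => _ [t /= t0 <-]; exact: average_le.
Qed.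

Lemma max_average_ub f (B t x : R) : profile f B -> 0 < t ->
  average phi f t x <= max_average phi f x.
Proof.
move=> fB t0; apply: ub_le_sup; first by case: (has_sup_average x fB).
by exists t.
Qed.

Lemma max_average_le f (b x : R) : (forall t, 0 < t -> average phi f t x <= b) ->
  max_average phi f x <= b.
Proof.
move=> fb; apply: ge_sup; first by exists (average phi f 1 x); exists 1 => //=.
by move=> _ [t /= t0 <-]; exact: fb.
Qed.

(** With two base points a single estimate serves both purposes: f1 = f2 gives the modulus of
    continuity, and x1 = x2 the stability in the uniform norm. *)
Lemma max_average_dist f1 f2 (B1 B2 d x1 x2 : R) : profile f1 B1 -> profile f2 B2 ->
  (forall y, `|f1 (x1 + y) - f2 (x2 + y)| <= d) ->
  `|max_average phi f1 x1 - max_average phi f2 x2| <= d.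
Proof.
move=> p1 p2 fd; rewrite ler_norml lerBrDr lerBlDr; apply/andP; split.
- rewrite addrC lerBlDr; apply: max_average_le => t t0.
  have := average_dist p1 p2 fd t0; have := max_average_ub x1 p1 t0.
  by rewrite ler_norml; lra.
- apply: max_average_le => t t0.
  have := average_dist p1 p2 fd t0; have := max_average_ub x2 p2 t0.
  by rewrite ler_norml; lra.
Qed.

Lemma unifc_max_average f (B : R) : profile f B -> unifc (max_average phi f).
Proof.
move=> fB e e0; have [uf _ _] := fB; have [d d0 dP] := uf _ e0.
exists d => // x1 x2 xd; apply: (max_average_dist fB fB) => y.
by apply: dP; rewrite (_ : x1 + y - _ = x1 - x2)//; ring.
Qed.

(** The averages at [x] tend to [f x] as t -> 0+. *)
Lemma le_max_average f (B x : R) : profile f B -> f x <= max_average phi f x.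
Proof.
move=> fB; have c := @cvg_at_right_filter _ _ _ _ _ (continuous_scaled fB (x := x) (x0 := 0)).
rewrite -[leLHS]scaled0 -(cvg_lim (@norm_hausdorff _ _) c).
apply: limr_le; first by apply/cvg_ex; eexists; exact: c.
near=> t; have t0 : 0 < t by near: t; exact: nbhs_right_gt.
by rewrite -(average_scaled x fB t0); exact: max_average_ub fB _.
Unshelve. all: by end_near. Qed.

(** The averages extend continuously to t = 0 with value [f x], and beyond [T] they are at most a
    level [c] strictly between [f x] and the supremum. So the maximum over [0, T] is global and is
    not taken at 0. *)
Lemma max_average_attained f (B x : R) : profile f B -> f x < max_average phi f x ->
  exists2 t : R, 0 < t & max_average phi f x = average phi f t x.
Proof.
move=> fB fF; have [_ fb fi] := fB; have /andP[fx0 _] := fb x.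
pose A t := \int[mu]_z (f (x + t * z) * phi z).
pose m := \int[mu]_y f y; have m0 : 0 <= m by apply: Rintegral_ge0 => y _; case/andP: (fb y).
pose c := (f x + max_average phi f x) / 2.
have c0 : 0 < c by rewrite /c; lra.
have cF : c < max_average phi f x by rewrite /c; lra.
have fc : f x < c by rewrite /c; lra.
have [s s0 cs] : exists2 s : R, 0 < s & c < average phi f s x.
  apply: contrapT => no; move: cF; rewrite ltNge => /negP; apply.
  apply: max_average_le => t t0; rewrite leNgt; apply/negP => ct.
  by apply: no; exists t.
pose T := Num.max s (C * m / c).
have sT : s <= T by rewrite le_max lexx.
have T0 : 0 < T by exact: lt_le_trans sT.
have big t : T <= t -> average phi f t x <= c.
  move=> Tt; have t0 : 0 < t by exact: lt_le_trans Tt.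
  apply: le_trans (average_le_mass x fB t0) _.
  rewrite mulrAC ler_pdivrMr// [c * t]mulrC -ler_pdivrMr//.
  by apply: le_trans Tt; rewrite le_max lexx orbT.
have cA : {within `[0, T], continuous A}.
  by apply: continuous_subspaceT; exact: continuous_scaled fB.
have [t] := EVT_max (ltW T0) cA; rewrite in_itv/= => /andP[t0 tT] tmax.
have At : c < A t.
  have As : A s = average phi f s x by rewrite (average_scaled x fB s0).
  by apply: lt_le_trans cs _; rewrite -As; apply: tmax; rewrite in_itv/= (ltW s0).
have {}t0 : 0 < t.
  rewrite lt_neqAle t0 andbT; apply/eqP => t00; move: At; rewrite -t00 /A scaled0; lra.
exists t => //; apply/eqP; rewrite eq_le (max_average_ub x fB t0) andbT.
apply: max_average_le => r r0; rewrite (average_scaled x fB t0) -/(A t).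
have [rT|Tr] := leP r T.
  by rewrite (average_scaled x fB r0) -/(A r); apply: tmax; rewrite in_itv/= rT ltW.
by apply: le_trans (big _ (ltW Tr)) _; exact: ltW.
Unshelve. all: by []. Qed.

(** Cut [f] at height [e / 2]. The lower part has averages at most [e / 2]. The upper part lives in
    |y| < M, where the kernel centred at a far [x] is at most C / (|x| - M) at every scale. *)
Lemma max_average_vanishing f (B : R) : profile f B ->
  (forall e : R, 0 < e -> exists M : R, forall x, M <= `|x| -> f x <= e) ->
  forall e : R, 0 < e -> exists M : R, forall x, M <= `|x| -> max_average phi f x <= e.
Proof.
move=> fB f0 e e0; have e20 : 0 < e / 2 by rewrite divr_gt0.
have [M MP] := f0 _ e20; have [uf fb fi] := fB.
pose m := \int[mu]_y f y; have m0 : 0 <= m by apply: Rintegral_ge0 => y _; case/andP: (fb y).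
have C0 := kernel_bound_ge0.
pose f1 y := Num.min (f y) (e / 2); pose f2 y := f y - f1 y.
have f1P y : 0 <= f1 y <= e / 2 /\ f1 y <= f y.
  by have /andP[? ?] := fb y; rewrite /f1 minEle; case: ifP; lra.
have f2P y : 0 <= f2 y <= f y by have := f1P y; rewrite /f2; lra.
have f2M y : M <= `|y| -> f2 y = 0.
  by move=> /MP fe; rewrite /f2 /f1 minEle fe subrr.
have uf1 : unifc f1.
  move=> k /uf[r r0 rP]; exists r => // a b /rP.
  by rewrite /f1 !minEle !ler_norml; do 2 case: ifP; lra.
have i1 : integrableR f1.
  apply: (integrableR_le _ fi); first by apply: continuous_measurable_fun; exact: unifc_continuous.
  by move=> y; have [/andP[f10 _] f1f] := f1P y; rewrite ger0_norm.
have i2 : integrableR f2 by exact: integrableRB.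
have p1 : profile f1 (e / 2) by split=> // y; have [] := f1P y.
exists (M + C * m / (e / 2) + 1) => x Mx; apply: max_average_le => t t0.
have q0 : 0 <= C * m / (e / 2) by rewrite divr_ge0 ?mulr_ge0// ltW.
have Dx : 0 < `|x| - M by lra.
pose K := C / (`|x| - M); have K0 : 0 <= K by rewrite divr_ge0// ltW.
have -> : average phi f t x = average phi f1 t x + average phi f2 t x.
  rewrite /average /convolution -RintegralD//; [|exact: integrable_average..].
  by apply: eq_Rintegral => y _; rewrite /f2; ring.
have : average phi f2 t x <= K * m.
  rewrite -RintegralZl//; apply: le_Rintegral => //.
  - exact: integrable_average.
  - exact: integrableRZ.
  move=> y _; have /andP[f20 f2f] := f2P y.
  apply: (@le_trans _ _ (f2 y * K)); last by rewrite mulrC ler_wpM2l.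
  have [/f2M ->|yM] := leP M `|y|; first by rewrite !mul0r.
  rewrite ler_wpM2l// /K ler_pdivlMr// mulrC; apply: le_trans (norm_dilation_le (x - y) t0).
  by rewrite ler_wpM2r ?dilation_ge0//; have := lerB_dist x y; lra.
have : K * m <= e / 2.
  rewrite /K mulrAC ler_pdivrMr// [leRHS]mulrC -ler_pdivrMr//; lra.
have := average_le x p1 t0; lra.
Qed.

End averages.

(** * Mean value forms of first and second differences *)

Section difference_quotients.
Context {R : realType}.
Implicit Types (f g : R -> R) (x s t c h e : R).

Lemma is_derive1_translate g a x c : is_derive (c + x) 1 g a ->
  is_derive x 1 (fun s => g (c + s)) a.
Proof.
move=> ga; have := is_derive1_affine 1 (- c) x; rewrite -[X in is_derive _ _ _ X]mulr1.
have -> : (fun z => 1 * (z - - c)) = (fun z => c + z).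
  by apply/funext => z; rewrite mul1r opprK addrC.
by move=> d; have := is_derive1_compose d ga; rewrite !mulr1.
Qed.

Lemma is_derive1_reflect g a x c : is_derive (c - x) 1 g a ->
  is_derive x 1 (fun s => g (c - s)) (- a).
Proof.
move=> ga; have := is_derive1_affine (-1) c x.
have -> : (fun z => -1 * (z - c)) = (fun z => c - z).
  by apply/funext => z; rewrite mulN1r opprB.
by move=> d; have := is_derive1_compose d ga; rewrite mulrN1.
Qed.

(** Both signs of [h] occur: it will be a multiple of [b / t], whose sign depends on the kernel. *)
Lemma first_difference g g' c h :
  (forall s, `|s - c| <= `|h| -> is_derive s 1 g (g' s)) ->
  exists2 s, `|s - c| <= `|h| & g (c + h) - g c = h * g' s.
Proof.
have [h0|/ltW h0] := leP 0 h => gd.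
- have cc : c <= c + h by rewrite lerDl.
  have dg s : s \in `[c, c + h] -> is_derive s 1 g (g' s).
    by rewrite in_itv/= => /andP[? ?]; apply: gd; rewrite (ger0_norm h0) ler_norml; lra.
  have dgo s : s \in `]c, c + h[ -> is_derive s 1 g (g' s).
    by move=> sc; apply: dg; exact: subset_itv_oo_cc.
  have cg : {within `[c, c + h], continuous g}.
    by apply: derivable_within_continuous => s /dg[].
  have [s] := MVT_segment cc dgo cg.
  rewrite in_itv/= addrAC subrr add0r mulrC => /andP[? ?] ?; exists s => //.
  by rewrite (ger0_norm h0) ler_norml; lra.
- have cc : c + h <= c by rewrite gerDl.
  have dg s : s \in `[c + h, c] -> is_derive s 1 g (g' s).
    by rewrite in_itv/= => /andP[? ?]; apply: gd; rewrite (ler0_norm h0) ler_norml; lra.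
  have dgo s : s \in `]c + h, c[ -> is_derive s 1 g (g' s).
    by move=> sc; apply: dg; exact: subset_itv_oo_cc.
  have cg : {within `[c + h, c], continuous g}.
    by apply: derivable_within_continuous => s /dg[].
  have [s] := MVT_segment cc dgo cg.
  rewrite in_itv/= opprD addNKr => /andP[? ?] gE; exists s.
    by rewrite (ler0_norm h0) ler_norml; lra.
  by rewrite -opprB gE mulrN opprK mulrC.
Qed.

(** Rolle for G(s) = g(c+s) + g(c-s) - l s^2, with [l] chosen so that G(0) = G(h), then the mean
    value theorem for [g'] on [c-s, c+s]. *)
Lemma second_difference g g' g'' c h : 0 < h ->
  (forall s, `|s - c| <= h -> is_derive s 1 g (g' s)) ->
  (forall s, `|s - c| <= h -> is_derive s 1 g' (g'' s)) ->
  exists2 s, `|s - c| <= h & g (c + h) + g (c - h) - 2 * g c = h ^+ 2 * g'' s.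
Proof.
move=> h0 dg dg'; pose l := (g (c + h) + g (c - h) - 2 * g c) / h ^+ 2.
have h20 : h ^+ 2 != 0 by rewrite expf_neq0// gt_eqF.
have lE : g (c + h) + g (c - h) - 2 * g c = h ^+ 2 * l by rewrite [RHS]mulrC divfK.
pose G s := g (c + s) + g (c - s) - l * s ^+ 2.
have dG s : 0 <= s <= h -> is_derive s 1 G (g' (c + s) - g' (c - s) - l * (2 * s)).
  move=> /andP[s0 sh]; apply: is_derive1_sub.
    apply: is_derive1_add; [apply: is_derive1_translate|apply: is_derive1_reflect].
    - by apply: dg; rewrite addrAC subrr add0r ger0_norm.
    - by apply: dg; rewrite addrAC subrr add0r normrN ger0_norm.
  apply: is_derive1_scale; have := is_derive1_pow 2 (@is_derive_id _ _ s 1).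
  by rewrite /= expr1 mulr1.
have dGo s : s \in `]0, h[ -> derivable G s 1.
  by rewrite in_itv/= => /andP[/ltW s0 /ltW sh]; have [] := dG s; rewrite ?s0.
have cG : {within `[0, h], continuous G}.
  by apply: derivable_within_continuous => s; rewrite in_itv/= => /dG[].
have G0h : G 0 = G h by rewrite /G addr0 subr0 expr0n/= mulr0; move: lE; lra.
have [s] := Rolle h0 dGo cG G0h.
rewrite in_itv/= => /andP[s0 sh] G0.
have E0 : g' (c + s) - g' (c - s) = l * (2 * s).
  have ds : is_derive s 1 G (g' (c + s) - g' (c - s) - l * (2 * s)).
    by apply: dG; rewrite !ltW.
  apply/eqP; rewrite -subr_eq0; apply/eqP.
  by rewrite -(derive_val (is_derive := ds)) (derive_val (is_derive := G0)).
have cs : c - s <= c + s by rewrite lerD2l ge0_cp// ltW.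
have dg's z : z \in `[c - s, c + s] -> is_derive z 1 g' (g'' z).
  by rewrite in_itv/= => /andP[? ?]; apply: dg'; rewrite ler_norml; lra.
have dgo z : z \in `]c - s, c + s[ -> is_derive z 1 g' (g'' z).
  by move=> zc; apply: dg's; exact: subset_itv_oo_cc.
have cg : {within `[c - s, c + s], continuous g'}.
  by apply: derivable_within_continuous => z /dg's[].
have [z] := MVT_segment cs dgo cg.
rewrite in_itv/= => /andP[z1 z2]; rewrite E0 => E1.
exists z; first by rewrite ler_norml; lra.
rewrite lE; congr (_ * _); have s20 : 2 * s != 0 by rewrite mulf_neq0// gt_eqF.
by apply: (mulIf s20); rewrite E1; congr (_ * _); ring.
Qed.

End difference_quotients.

(** * The maximum principle and convexity off contact *)

Section maximum_principle.
Context {R : realType}.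
Local Notation mu := (@lebesgue_measure R).
Implicit Types (f g u v : R -> R) (x y z s t d : R).

(* In terms of [K (x, t) = phi (x / t) / t] the last equation reads
   [K_xx + a K_tt + (b / t) K_t = 0]. *)
Definition elliptic_kernel (phi phi' phi'' : R -> R) (a b D : R) : Prop :=
  [/\ 0 <= a, forall z, is_derive z 1 phi (phi' z), forall z, is_derive z 1 phi' (phi'' z),
      continuous phi'' /\ (forall z, [/\ `|phi z| <= D, `|z * phi' z| <= D, `|phi'' z| <= D &
        `|z ^+ 2 * phi'' z| <= D]) &
      forall z, phi'' z + a * (2 * phi z + 4 * (z * phi' z) + z ^+ 2 * phi'' z)
        - b * (phi z + z * phi' z) = 0].

Variables (phi phi' phi'' : R -> R) (C a b D : R).
Hypothesis kphi : averaging_kernel phi C.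
Hypothesis ephi : elliptic_kernel phi phi' phi'' a b D.

Let a0 : 0 <= a. Proof. by case: ephi. Qed.
Let dphi z : is_derive z 1 phi (phi' z). Proof. by case: ephi. Qed.
Let dphi' z : is_derive z 1 phi' (phi'' z). Proof. by case: ephi. Qed.
Let cphi'' : continuous phi''. Proof. by case: ephi => _ _ _ []. Qed.
Let phiD z : `|phi z| <= D. Proof. by case: ephi => _ _ _ [_ /(_ z)[]]. Qed.
Let phi'D z : `|z * phi' z| <= D. Proof. by case: ephi => _ _ _ [_ /(_ z)[]]. Qed.
Let phi''D z : `|phi'' z| <= D. Proof. by case: ephi => _ _ _ [_ /(_ z)[]]. Qed.
Let z2phi''D z : `|z ^+ 2 * phi'' z| <= D. Proof. by case: ephi => _ _ _ [_ /(_ z)[]]. Qed.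
Let ode z : phi'' z + a * (2 * phi z + 4 * (z * phi' z) + z ^+ 2 * phi'' z)
        - b * (phi z + z * phi' z) = 0.
Proof. by case: ephi. Qed.
Let D0 : 0 <= D. Proof. exact: le_trans (phiD 0). Qed.

Definition dil_xx t z : R := phi'' (z / t) / t ^+ 3.
Definition dil_t t z : R := - (phi (z / t) + z / t * phi' (z / t)) / t ^+ 2.
Definition dil_tt t z : R :=
  (2 * phi (z / t) + 4 * (z / t * phi' (z / t)) + (z / t) ^+ 2 * phi'' (z / t)) / t ^+ 3.

Lemma dilation_elliptic t z : 0 < t ->
  dil_xx t z + a * dil_tt t z + b / t * dil_t t z = 0.
Proof.
move=> t0; have tn : t != 0 by rewrite gt_eqF.
rewrite /dil_xx /dil_tt /dil_t -[RHS](mul0r (t ^- 3)) -(ode (z / t)).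
move: (phi _) (phi' _) (phi'' _) => p q r; field.
by [].
Qed.

Lemma is_derive_ratio z t : 0 < t -> is_derive t 1 (fun s => z / s) (- (z / t) / t).
Proof.
move=> t0; have tn : t != 0 by rewrite gt_eqF.
have := is_derive1_scale z (is_derive1_inv tn (@is_derive_id _ _ t 1)).
move=> d; apply: is_derive_eq d _; field. exact: tn.
Qed.

Lemma is_derive_dilation t z : 0 < t -> is_derive t 1 (dilation phi ^~ z) (dil_t t z).
Proof.
move=> t0; have tn : t != 0 by rewrite gt_eqF.
have d1 := is_derive1_compose (is_derive_ratio z t0) (dphi _).
have := is_derive1_mul (is_derive1_inv tn (@is_derive_id _ _ t 1)) d1.
move=> d; apply: is_derive_eq d _; rewrite /dil_t; field. exact: tn.
Qed.

Lemma is_derive_dil_t t z : 0 < t -> is_derive t 1 (dil_t ^~ z) (dil_tt t z).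
Proof.
move=> t0; have tn : t != 0 by rewrite gt_eqF.
have r := is_derive_ratio z t0.
have d1 := is_derive1_compose r (dphi _).
have d2 := is_derive1_mul r (is_derive1_compose r (dphi' _)).
have t2 : t ^+ 2 != 0 by rewrite expf_neq0.
have d3 := @is_derive1_inv R (fun s => s ^+ 2) t _ t2 (is_derive1_pow 2 (@is_derive_id _ _ t 1)).
have := is_derive1_scale (-1) (is_derive1_mul (is_derive1_add d1 d2) d3).
have -> : (fun x => -1 * ((phi (z / x) + z / x * phi' (z / x)) * (x ^+ 2)^-1)) = dil_t ^~ z.
  by apply/funext => x; rewrite /dil_t mulN1r mulNr.
move=> d; apply: is_derive_eq d _; rewrite /dil_tt /=; field. exact: tn.
Qed.

Lemma is_derive_dilation_x t z : 0 < t ->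
  is_derive z 1 (dilation phi t) (phi' (z / t) / t ^+ 2) /\
  is_derive z 1 (fun z => phi' (z / t) / t ^+ 2) (dil_xx t z).
Proof.
move=> t0; have tn : t != 0 by rewrite gt_eqF.
have r : is_derive z 1 (fun x => x / t) t^-1.
  have := is_derive1_affine t^-1 0 z; congr is_derive.
  by apply/funext => x; rewrite subr0 mulrC.
split.
- have := is_derive1_scale t^-1 (is_derive1_compose r (dphi _)).
  move=> d; apply: is_derive_eq d _; field. exact: tn.
- have := is_derive1_scale (t ^- 2) (is_derive1_compose r (dphi' _)).
  have -> : (fun x => t ^- 2 * phi' (x / t)) = (fun x => phi' (x / t) / t ^+ 2).
    by apply/funext => x; rewrite mulrC.
  move=> d; apply: is_derive_eq d _; rewrite /dil_xx; field. exact: tn.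
Qed.

Lemma dil_bounds t s z : 0 < t -> t / 2 <= s ->
  [/\ `|dil_xx s z| <= D / (t / 2) ^+ 3, `|dil_t s z| <= 2 * D / (t / 2) ^+ 2 &
      `|dil_tt s z| <= 7 * D / (t / 2) ^+ 3].
Proof.
move=> t0 ts; have t20 : 0 < t / 2 by rewrite divr_gt0.
have s0 : 0 < s by exact: lt_le_trans ts.
have dv n (p q : R) : `|p| <= q -> `|p / s ^+ n| <= q / (t / 2) ^+ n.
  move=> pq; have q0 : 0 <= q by exact: le_trans pq.
  rewrite normrM normfV (ger0_norm (exprn_ge0 _ (ltW s0))).
  have h : (t / 2) ^+ n <= s ^+ n by rewrite lerXn2r// nnegrE ltW.
  by rewrite ler_pM// ?invr_ge0 ?exprn_ge0 ?(ltW s0)// lef_pV2 ?posrE ?exprn_gt0.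
split; apply: dv => //.
- rewrite normrN; have := phiD (z / s); have := phi'D (z / s).
  by rewrite !ler_norml; lra.
- have := phiD (z / s); have := phi'D (z / s); have := z2phi''D (z / s).
  by rewrite !ler_norml; lra.
Qed.

Let cphi : continuous phi. Proof. exact: is_derive1_continuous dphi. Qed.
Let cphi' : continuous phi'. Proof. exact: is_derive1_continuous dphi'. Qed.

Lemma continuous_dil_xx t : continuous (dil_xx t).
Proof.
move=> z; apply: cvgM; last exact: cvg_cst.
apply: (@continuous_comp _ _ _ (fun z => z / t) phi''); last exact: cphi''.
by apply: cvgM; [exact: cvg_id|exact: cvg_cst].
Qed.

Lemma continuous_dil_t t z : 0 < t ->
  {for t, continuous (dil_t ^~ z)} /\ {for t, continuous (dil_tt ^~ z)}.
Proof.
move=> t0; have tn : t != 0 by rewrite gt_eqF.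
have cr : z / s @[s --> t] --> z / t.
  by apply: cvgM; [exact: cvg_cst|apply: cvgV => //; exact: cvg_id].
have c0 : phi (z / s) @[s --> t] --> phi (z / t) by apply: (continuous_cvg _ _ cr); exact: cphi.
have c1 : phi' (z / s) @[s --> t] --> phi' (z / t) by apply: (continuous_cvg _ _ cr); exact: cphi'.
have c2 : phi'' (z / s) @[s --> t] --> phi'' (z / t) by apply: (continuous_cvg _ _ cr); exact: cphi''.
have cV n : s ^- n @[s --> t] --> t ^- n.
  by apply: cvgV; [rewrite expf_neq0|exact: exprn_continuous].
have c3 : z / s * phi' (z / s) @[s --> t] --> z / t * phi' (z / t) by exact: cvgM.
have k (l : R) : cst l s @[s --> t] --> l by exact: cvg_cst.
split; apply: cvgM; last exact: cV.
- by apply: cvgN; exact: cvgD.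
- exact: cV.
- have c4 : (z / s) ^+ 2 @[s --> t] --> (z / t) ^+ 2.
    by rewrite expr2; under eq_fun do rewrite expr2; exact: cvgM.
  apply: cvgD; last exact: cvgM.
  by apply: cvgD; apply: cvgM => //; exact: cvg_cst.
Qed.

Let K x f t y := f y * dilation phi t (x - y).

Let iK x f (t : R) : integrableR f -> 0 < t -> integrableR (K x f t).
Proof. exact: (integrable_average kphi). Qed.

(** The term with [k] makes the maximum strict in [x], so that even the degenerate case a = 0 is
    contradictory. The tilt [l] cancels in symmetric second differences. *)
Lemma no_interior_maximum f (B x0 t k r l : R) : profile f B -> 0 < t -> 0 < k -> 0 < r ->
  (forall x s, `|x - x0| <= r -> 0 < s ->
    average phi f s x + k * (x - x0) ^+ 2 + l * (x - x0) <= average phi f t x0) -> False.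
Proof.
move=> fB t0 k0 r0 maxP; have [uf fb fi] := fB.
pose c := b / t.
(* The first bound keeps the points in the window, the second gives [e n ^+ 2 <= q], and the third
   keeps all scales at least [t / 2]. *)
pose q := Num.min r (Num.min 1 (t / 2 / (`|c| + 1))).
have c10 : 0 < `|c| + 1 by have := normr_ge0 c; lra.
have q0 : 0 < q by rewrite !lt_min r0 ltr01 !divr_gt0.
have [qr [q1 qc]] : q <= r /\ q <= 1 /\ q * (`|c| + 1) <= t / 2.
  by rewrite -ler_pdivlMr// /q !ge_min !lexx !orbT.
have qt : q <= t / 2.
  by have := mulr_ge0 (ltW q0) (normr_ge0 c); lra.
have cq : `|c| * q <= t / 2.
  by have := mulr_ge0 (ltW q0) (normr_ge0 c); lra.
(* The difference quotients [T n / e n ^+ 2] of the averages are at most [- 2 * k]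
   because [(x0, t)] is a maximum, while by dominated convergence they tend to the
   average of [K_xx + a K_tt + c K_t], which vanishes. *)
pose e n : R := q / n.+1%:R.
have e0 n : 0 < e n by rewrite divr_gt0.
have eq n : e n <= q by rewrite ler_pdivrMr// ler_peMr ?ler1n// ltW.
have e2q n : e n ^+ 2 <= q.
  apply: le_trans (eq n); rewrite expr2 ler_piMr ?(ltW (e0 n))//.
  exact: le_trans (eq n) q1.
have ecvg : e n @[n --> \oo] --> (0 : R).
  by rewrite -(mulr0 q); apply: cvgM; [exact: cvg_cst|exact: cvg_harmonic].
(* A quadratic step in [t]: divided by [e n ^+ 2], the first difference tends to the first-order
   term c K_t. *)
pose h n : R := c * e n ^+ 2.
have hq n : `|h n| <= t / 2.
  rewrite /h normrM (ger0_norm (sqr_ge0 _)); apply: le_trans cq.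
  by rewrite ler_wpM2l.
have hcvg : h n @[n --> \oo] --> (0 : R).
  rewrite -(mulr0 c) -(mulr0 0); apply: cvgM; first exact: cvg_cst.
  by under eq_fun do rewrite expr2; exact: cvgM.
pose T1 n y := K (x0 + e n) f t y + K (x0 - e n) f t y - 2 * K x0 f t y.
pose T2 n y := K x0 f (t + e n) y + K x0 f (t - e n) y - 2 * K x0 f t y.
pose T3 n y := K x0 f (t + h n) y - K x0 f t y.
pose T n y := T1 n y + a * T2 n y + T3 n y.
have tm n : 0 < t - e n by have := eq n; lra.
have tp n : 0 < t + e n by have := e0 n; lra.
have th n : 0 < t + h n by have := hq n; rewrite ler_norml; lra.
have second (u v w : R -> R) : integrableR u -> integrableR v -> integrableR w ->
    integrableR (fun y => u y + v y - 2 * w y) /\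
    \int[mu]_y (u y + v y - 2 * w y) = \int[mu]_y u y + \int[mu]_y v y - 2 * \int[mu]_y w y.
  move=> iu iv iw; have i1 := integrableRD iu iv; have i2 := integrableRZ 2 iw.
  by split; [exact: integrableRB|rewrite RintegralB// RintegralD// RintegralZl].
have [i1 E1] : (forall n, integrableR (T1 n)) /\ forall n, \int[mu]_y T1 n y =
    average phi f t (x0 + e n) + average phi f t (x0 - e n) - 2 * average phi f t x0.
  by split=> n; have [] := second _ _ _ (iK (x0 + e n) fi t0) (iK (x0 - e n) fi t0) (iK x0 fi t0).
have [i2 E2] : (forall n, integrableR (T2 n)) /\ forall n, \int[mu]_y T2 n y =
    average phi f (t + e n) x0 + average phi f (t - e n) x0 - 2 * average phi f t x0.
  by split=> n; have [] := second _ _ _ (iK x0 fi (tp n)) (iK x0 fi (tm n)) (iK x0 fi t0).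
have i3 n : integrableR (T3 n) by apply: integrableRB; exact: iK.
have E3 n : \int[mu]_y T3 n y = average phi f (t + h n) x0 - average phi f t x0.
  by rewrite RintegralB//; exact: iK.
have ia n : integrableR (fun y => a * T2 n y) by exact: integrableRZ.
have i12 n : integrableR (fun y => T1 n y + a * T2 n y) by exact: integrableRD.
have iT n : integrableR (T n) by exact: integrableRD.
have ET n : \int[mu]_y T n y <= - (2 * k) * e n ^+ 2.
  rewrite RintegralD// RintegralD// RintegralZl// E1 E2 E3.
  have er : `|e n| <= r by rewrite ger0_norm ?(ltW (e0 n))//; exact: le_trans (eq n) qr.
  have m1 := maxP (x0 + e n) t; have m2 := maxP (x0 - e n) t.
  have m3 s : 0 < s -> average phi f s x0 <= average phi f t x0.
    move=> s0; have := maxP x0 s; rewrite subrr normr0 (ltW r0) => /(_ isT s0).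
    by rewrite expr0n/= !mulr0 !addr0.
  have := m3 _ (tp n); have := m3 _ (tm n); have := m3 _ (th n).
  move: m1 m2; rewrite (_ : x0 + e n - x0 = e n); last by ring.
  rewrite (_ : x0 - e n - x0 = - e n); last by ring.
  rewrite normrN => /(_ er t0) + /(_ er t0); rewrite sqrrN mulrN => u1 u2 u3 u4 u5.
  have : a * (average phi f (t + e n) x0 + average phi f (t - e n) x0
    - 2 * average phi f t x0) <= 0 by rewrite mulr_ge0_le0//; lra.
  by lra.
have TE n y : exists p : R * R * R, [/\ `|p.1.1 - (x0 - y)| <= e n, `|p.1.2 - t| <= e n,
    `|p.2 - t| <= `|h n| & T n y = f y * (e n ^+ 2 * (dil_xx t p.1.1
       + a * dil_tt p.1.2 (x0 - y) + c * dil_t p.2 (x0 - y)))].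
  pose z := x0 - y.
  have [p1 P1 Q1] := second_difference (e0 n) (c := z)
    (fun s _ => (is_derive_dilation_x s t0).1) (fun s _ => (is_derive_dilation_x s t0).2).
  have pos s : `|s - t| <= e n -> 0 < s.
    by rewrite ler_norml; have := tm n; lra.
  have [p2 P2 Q2] := second_difference (e0 n) (c := t)
    (fun s hs => is_derive_dilation z (pos s hs)) (fun s hs => is_derive_dil_t z (pos s hs)).
  have posh s : `|s - t| <= `|h n| -> 0 < s.
    by have := hq n; rewrite (ler_norml (s - t)); lra.
  have [p3 P3 Q3] := first_difference (c := t) (h := h n)
    (fun s hs => is_derive_dilation z (posh s hs)).
  exists (p1, p2, p3); split => //=.
  rewrite /T /T1 /T2 /T3 /K (_ : x0 + e n - y = z + e n); last by rewrite /z; ring.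
  rewrite (_ : x0 - e n - y = z - e n); last by rewrite /z; ring.
  rewrite -/z.
  transitivity (f y * ((dilation phi t (z + e n) + dilation phi t (z - e n) - 2 * dilation phi t z)
   + a * (dilation phi (t + e n) z + dilation phi (t - e n) z - 2 * dilation phi t z)
   + (dilation phi (t + h n) z - dilation phi t z))); first by ring.
  by rewrite Q1 Q2 Q3 /h; ring.
pose M := D / (t / 2) ^+ 3 + a * (7 * D / (t / 2) ^+ 3) + `|c| * (2 * D / (t / 2) ^+ 2).
have [] := @dominated_cvgR R (fun n y => (e n ^+ 2)^-1 * T n y) (cst 0) (fun y => M * f y).
- by move=> n; apply: integrableR_meas; exact: integrableRZ.
- exact: measurable_cst.
- apply: aeW => y; have [p pP] := choice (TE ^~ y).
  have squeeze (u w : nat -> R) (v : R) : (forall n, `|u n - v| <= `|w n|) ->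
      w n @[n --> \oo] --> (0 : R) -> u n @[n --> \oo] --> v.
    move=> uw /cvgrPdist_le w0; apply/cvgrPdist_le => d d0; have := w0 d d0.
    apply: filterS => n; rewrite sub0r normrN distrC; exact: le_trans.
  have en n : `|e n| = e n by rewrite ger0_norm// ltW.
  have c1 : (p n).1.1 @[n --> \oo] --> x0 - y.
    by apply: squeeze ecvg => n; rewrite en; case: (pP n).
  have c2 : (p n).1.2 @[n --> \oo] --> t.
    by apply: squeeze ecvg => n; rewrite en; case: (pP n).
  have c3 : (p n).2 @[n --> \oo] --> t by apply: squeeze hcvg => n; case: (pP n).
  have [ct ctt] := continuous_dil_t (x0 - y) t0.
  have d1 : dil_xx t (p n).1.1 @[n --> \oo] --> dil_xx t (x0 - y).
    by apply: (continuous_cvg _ _ c1); exact: continuous_dil_xx.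
  have d2 : dil_tt (p n).1.2 (x0 - y) @[n --> \oo] --> dil_tt t (x0 - y).
    by exact: (cvg_comp _ _ c2 ctt).
  have d3 : dil_t (p n).2 (x0 - y) @[n --> \oo] --> dil_t t (x0 - y).
    by exact: (cvg_comp _ _ c3 ct).
  have d : f y * (dil_xx t (p n).1.1 + a * dil_tt (p n).1.2 (x0 - y) + c * dil_t (p n).2 (x0 - y))
      @[n --> \oo] --> f y * (dil_xx t (x0 - y) + a * dil_tt t (x0 - y) + c * dil_t t (x0 - y)).
    apply: cvgM; first exact: cvg_cst.
    apply: cvgD; first (apply: cvgD => //).
      by apply: cvgM => //; exact: cvg_cst.
    by apply: cvgM => //; exact: cvg_cst.
  rewrite dilation_elliptic// mulr0 in d.
  apply: cvg_trans d; apply: near_eq_cvg; apply: nearW => n.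
  have [_ _ _ ->] := pP n; rewrite [RHS]mulrCA mulKf//.
  by rewrite expf_neq0// gt_eqF.
- exact: integrableRZ.
- apply: aeW => y n; have [[[p1 p2] p3] /= [_ P2 P3 ->]] := TE n y.
  have e20 : 0 < e n ^+ 2 by rewrite exprn_gt0.
  rewrite mulrCA mulKf ?gt_eqF// normrM [leRHS]mulrC.
  have /andP[fy0 _] := fb y; rewrite (ger0_norm fy0) ler_wpM2l//.
  have h2 : t / 2 <= p2 by move: P2; rewrite ler_norml; have := eq n; lra.
  have h3 : t / 2 <= p3 by move: P3; rewrite ler_norml; have := hq n; lra.
  have tt : t / 2 <= t by lra.
  have [b1 _ _] := dil_bounds p1 t0 tt.
  have [_ _ b2] := dil_bounds (x0 - y) t0 h2.
  have [_ b3 _] := dil_bounds (x0 - y) t0 h3.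
  apply: le_trans (ler_normD _ _) _; rewrite /M lerD//; last by rewrite normrM ler_wpM2l.
  apply: le_trans (ler_normD _ _) _; rewrite lerD//.
  by rewrite normrM (ger0_norm a0) ler_wpM2l.
move=> _; rewrite Rintegral_cst// mul0r => c0.
have k20 : - (2 * k) < 0 by lra.
have [n _ /(_ n (leqnn n))] := cvgr_gt _ c0 _ k20.
rewrite RintegralZl//; have e20 : 0 < e n ^+ 2 by rewrite exprn_gt0.
by move=> /lt_le_trans/(_ (ler_wpM2l _ (ET n))); rewrite invr_ge0 (ltW e20) mulrCA mulVf ?gt_eqF// mulr1 ltxx => /(_ isT).
Qed.

(** A violation of convexity leaves an interior maximum of [F] minus the chord plus a small
    parabola. Off contact [F] is there an average at some scale [t], while it bounds all averages
    nearby, so the averages have a forbidden maximum in (x, t). *)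
Lemma obstacle_max_average f (B : R) : profile f B -> obstacle f (max_average phi f).
Proof.
move=> fB; have [uf fb fi] := fB; have uF := unifc_max_average kphi fB.
split => //; first by move=> x; exact: (le_max_average kphi x fB).
set F := max_average phi f => p y q /andP[py yq] gap.
have pq : p < q by exact: lt_trans yq.
have pq0 : 0 < q - p by rewrite subr_gt0.
pose l := (F q - F p) / (q - p).
have lE : l * (q - p) = F q - F p by rewrite /l divfK ?gt_eqF.
rewrite leNgt; apply/negP => bad.
pose d := F y - F p - l * (y - p).
have d0 : 0 < d.
  rewrite -(pmulr_rgt0 _ pq0) /d.
  have -> : (q - p) * (F y - F p - l * (y - p)) =
      (q - p) * F y - (q - p) * F p - (y - p) * (l * (q - p)) by ring.
  by rewrite lE; move: bad; lra.
(* Over [p, q] the parabola adds at most half of the excess [d] above the chord, so the maximum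
   stays off the ends. *)
pose k := d / 2 / (q - p) ^+ 2.
have k0 : 0 < k by rewrite !divr_gt0// exprn_gt0.
have kE : k * (q - p) ^+ 2 = d / 2 by rewrite /k divfK// expf_neq0// gt_eqF.
pose W x := F x - l * (x - p) + k * (x - p) ^+ 2.
have cW : {within `[p, q], continuous W}.
  apply: continuous_subspaceT => x; apply: cvgD.
    apply: cvgB; first exact: unifc_continuous.
    by apply: cvgM; [exact: cvg_cst|apply: cvgB; [exact: cvg_id|exact: cvg_cst]].
  apply: cvgM; first exact: cvg_cst.
  under eq_fun do rewrite expr2.
  by rewrite expr2; apply: cvgM; (apply: cvgB; [exact: cvg_id|exact: cvg_cst]).
have [x0] := EVT_max (ltW pq) cW; rewrite in_itv/= => /andP[px0 x0q] Wmax.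
have Wy : F p + d <= W x0.
  apply: le_trans (Wmax y _); last by rewrite in_itv/= !ltW.
  rewrite /W /d; have := mulr_ge0 (ltW k0) (sqr_ge0 (y - p)); lra.
have px : p < x0.
  rewrite lt_neqAle px0 andbT; apply/eqP => px; move: Wy.
  by rewrite -px /W subrr expr0n/= !mulr0; lra.
have xq : x0 < q.
  rewrite lt_neqAle x0q andbT; apply/eqP => xq; move: Wy.
  by rewrite xq /W kE lE; lra.
have [|t t0 Ft] := max_average_attained kphi fB (x := x0).
  by apply: gap; rewrite px0.
pose r := Num.min (x0 - p) (q - x0).
have r0 : 0 < r by rewrite lt_min !subr_gt0 px.
have [rp rq] : r <= x0 - p /\ r <= q - x0 by rewrite /r !ge_min !lexx orbT.
(* Recentring the parabola from [p] at [x0] leaves the linear term [2 * k * (x0 - p)]; the slope of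
   the chord is subtracted. *)
apply: (@no_interior_maximum f B x0 t k r (2 * k * (x0 - p) - l) fB t0 k0 r0).
move=> x s xr s0; rewrite -Ft -/F.
have := max_average_ub kphi x fB s0; rewrite -/F.
have : W x <= W x0.
  by apply: Wmax; rewrite in_itv/=; move: xr; rewrite ler_norml; lra.
rewrite /W; lra.
Qed.

End maximum_principle.

(** * The Poisson, fractional Poisson and heat kernels *)

Section kernels.
Context {R : realType}.
Local Notation mu := (@lebesgue_measure R).
Implicit Types (f g phi : R -> R) (x z c al be : R).

Definition admissible_kernel phi : Prop :=
  exists phi' phi'' C a b D,
    averaging_kernel phi C /\ elliptic_kernel phi phi' phi'' a b D.

Lemma ge0_integral1 f : continuous f -> (forall z, 0 <= f z) ->
  (\int[mu]_z (f z)%:E = 1)%E -> integrableR f /\ \int[mu]_z f z = 1.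
Proof.
move=> cf f0 f1; split; last by rewrite /Rintegral f1.
apply/integrableP; split; first by apply/measurable_EFinP; exact: continuous_measurable_fun.
under eq_integral do rewrite gee0_abs ?lee_fin//.
by rewrite f1 ltry.
Qed.

(** Poisson is [be = 1] and fractional Poisson is [be = (2 - al) / 2]. *)
Definition power_kernel c be z : R := c * ((z ^+ 2 + 1) `^ be)^-1.

Definition power_kernel' c be z : R := - (2 * be * z) / (z ^+ 2 + 1) * power_kernel c be z.

Definition power_kernel'' c be z : R :=
  (- (2 * be) / (z ^+ 2 + 1) + (4 * be + 4 * be ^+ 2) * (z / (z ^+ 2 + 1)) ^+ 2)
  * power_kernel c be z.

Lemma sqr1_gt0 z : 0 < z ^+ 2 + 1.
Proof. by rewrite ltr_wpDl// sqr_ge0. Qed.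

Lemma is_derive_sqr1 z : is_derive z 1 (fun z => z ^+ 2 + 1) (2 * z).
Proof.
have d := is_derive1_pow 2 (@is_derive_id _ _ z 1).
have := is_derive1_add d (@is_derive_cst R R R 1 z 1).
by move=> d'; apply: is_derive_eq d' _; rewrite /= expr1 mulr1 addr0.
Qed.

Lemma is_derive_power_kernel c be z :
  is_derive z 1 (power_kernel c be) (power_kernel' c be z).
Proof.
have w0 := sqr1_gt0 z; have wn : z ^+ 2 + 1 != 0 by rewrite gt_eqF.
have -> : power_kernel c be = fun z => c * (z ^+ 2 + 1) `^ (- be).
  by apply/funext => x; rewrite powRN.
have := is_derive1_scale c (is_derive1_compose (is_derive_sqr1 z) (is_derive1_powR (- be) w0)).
move=> d; apply: is_derive_eq d _.
rewrite powRD ?wn ?implybT// powRN (powR_inv1 (ltW w0)).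
rewrite /power_kernel' /power_kernel; move: ((z ^+ 2 + 1) `^ be)^-1 => p.
field. exact: wn.
Qed.

Lemma is_derive_power_kernel' c be z :
  is_derive z 1 (power_kernel' c be) (power_kernel'' c be z).
Proof.
have w0 := sqr1_gt0 z; have wn : z ^+ 2 + 1 != 0 by rewrite gt_eqF.
have d1 := is_derive1_scale (- (2 * be)) (is_derive1_mul (@is_derive_id _ _ z 1)
  (@is_derive1_inv R (fun z => z ^+ 2 + 1) z _ wn (is_derive_sqr1 z))).
have := is_derive1_mul d1 (is_derive_power_kernel c be z).
have -> : (fun z => - (2 * be) * (z * (z ^+ 2 + 1)^-1) * power_kernel c be z) = power_kernel' c be.
  by apply/funext => x; rewrite /power_kernel'; ring.
move=> d; apply: is_derive_eq d _.
rewrite /power_kernel' /power_kernel''; move: (power_kernel c be z) => p.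
field. exact: wn.
Qed.

Lemma continuous_sqr1V : continuous (fun z : R => (z ^+ 2 + 1)^-1).
Proof.
by move=> z; apply: cvgV; [rewrite gt_eqF// sqr1_gt0|exact: is_derive1_continuous is_derive_sqr1 z].
Qed.

(** The equation is K_xx + K_tt + ((2 - 2 be) / t) K_t = 0: Laplace's equation for Poisson, and the
    extension equation with weight t^al in the fractional case. *)
Lemma elliptic_power_kernel c be : 0 <= c -> 1 / 2 <= be <= 1 ->
  elliptic_kernel (power_kernel c be) (power_kernel' c be) (power_kernel'' c be)
    1 (2 - 2 * be) (10 * c).
Proof.
move=> c0 /andP[be0 be1].
have cp := is_derive1_continuous (is_derive_power_kernel c be).
have pb z : 0 <= power_kernel c be z <= c.
  have := sqr1_gt0 z; have := sqr_ge0 z; move=> z0 w0.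
  have : 1 <= (z ^+ 2 + 1) `^ be.
    rewrite -[leLHS](powRr0 (z ^+ 2 + 1)) ler_powR//; lra.
  move=> w1; rewrite mulr_ge0 ?invr_ge0 ?powR_ge0//= ler_piMr// invf_le1//.
  exact: lt_le_trans w1.
split; [by []|exact: is_derive_power_kernel|exact: is_derive_power_kernel'|split|].
- move=> z; apply: cvgM; last exact: cp.
  have cv := @continuous_sqr1V z.
  apply: cvgD; first by apply: cvgM => //; exact: cvg_cst.
  apply: cvgM; first exact: cvg_cst.
  have cz : x / (x ^+ 2 + 1) @[x --> z] --> z / (z ^+ 2 + 1) by apply: cvgM => //; exact: cvg_id.
  by rewrite expr2; under eq_fun do rewrite expr2; exact: cvgM.
- move=> z; have /andP[p0 pc] := pb z.
  have w0 := sqr1_gt0 z; have wn : z ^+ 2 + 1 != 0 by rewrite gt_eqF.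
  (* In [u] and [v], which are nonnegative with sum 1, all factors become polynomials with
     coefficients of total size at most 2 + 4 + 4 = 10. *)
  pose v := (z ^+ 2 + 1)^-1; pose u := z ^+ 2 * v.
  have uv : u + v = 1 by rewrite /u /v -{2}[_^-1]mul1r -mulrDl mulfV.
  have v0 : 0 <= v by rewrite invr_ge0 ltW.
  have u0 : 0 <= u by rewrite mulr_ge0// sqr_ge0.
  have E1 : z * power_kernel' c be z = - (2 * be * u) * power_kernel c be z.
    rewrite /power_kernel' /u /v; ring.
  have E2 : power_kernel'' c be z =
      (- (2 * be) * v + (4 * be + 4 * be ^+ 2) * (u * v)) * power_kernel c be z.
    by rewrite /power_kernel'' /u /v; ring.
  have E3 : z ^+ 2 * power_kernel'' c be z =
      (- (2 * be) * u + (4 * be + 4 * be ^+ 2) * (u * u)) * power_kernel c be z.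
    by rewrite E2 /u; ring.
  have bp k : `|k| <= 10 -> `|k * power_kernel c be z| <= 10 * c.
    by move=> k10; rewrite normrM (ger0_norm p0) ler_pM.
  have u1 : u <= 1 by lra.
  have m01 (p q : R) : 0 <= p <= 1 -> 0 <= q <= 1 -> 0 <= p * q <= 1.
    by move=> /andP[p1 p2] /andP[q1 q2]; rewrite mulr_ge0//= mulr_ile1.
  have be01 : 0 <= be <= 1 by lra.
  have u01 : 0 <= u <= 1 by lra.
  have v01 : 0 <= v <= 1 by lra.
  have bu := m01 _ _ be01 u01; have bv := m01 _ _ be01 v01.
  have buu := m01 _ _ bu u01; have buv := m01 _ _ bu v01.
  have bbuu := m01 _ _ be01 buu; have bbuv := m01 _ _ be01 buv.
  split.
  + by rewrite -[X in `|X|]mul1r; apply: bp; rewrite normr1; lra.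
  + by rewrite E1; apply: bp; rewrite ler_norml; lra.
  + by rewrite E2; apply: bp; rewrite ler_norml; lra.
  + by rewrite E3; apply: bp; rewrite ler_norml; lra.
- move=> z; have wn : z ^+ 2 + 1 != 0 by rewrite gt_eqF// sqr1_gt0.
  rewrite /power_kernel'' /power_kernel'; move: (power_kernel c be z) => p.
  field. exact: wn.
Qed.

(** The exponent is at least 1/2, so the denominator dominates sqrt(z^2 + 1), hence both 1 and
    |z|. *)
Lemma averaging_power_kernel c be : 0 <= c -> 1 / 2 <= be <= 1 ->
  (\int[mu]_z (power_kernel c be z)%:E = 1)%E ->
  averaging_kernel (power_kernel c be) c.
Proof.
move=> c0 /andP[be0 be1] p1.
have cp := is_derive1_continuous (is_derive_power_kernel c be).
have p0 z : 0 <= power_kernel c be z by rewrite mulr_ge0 ?invr_ge0 ?powR_ge0.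
split => //; [by move=> z; rewrite /power_kernel sqrrN|exact: ge0_integral1|].
move=> z; have z0 := sqr_ge0 z.
have w1 : 1 <= z ^+ 2 + 1 by lra.
have wb : Num.sqrt (z ^+ 2 + 1) <= (z ^+ 2 + 1) `^ be.
  by rewrite -powR12_sqrt ?(ltW (sqr1_gt0 z))// ler_powR//; lra.
have s1 : 1 <= Num.sqrt (z ^+ 2 + 1) by have := ler_wsqrtr w1; rewrite sqrtr1.
have s2 : `|z| <= Num.sqrt (z ^+ 2 + 1).
  by rewrite -sqrtr_sqr; apply: ler_wsqrtr; rewrite lerDl.
have v0 : 0 < (z ^+ 2 + 1) `^ be by rewrite powR_gt0// sqr1_gt0.
split; first by rewrite ler_piMr// invf_le1//; exact: le_trans wb.
rewrite /power_kernel mulrCA ler_piMr// ler_pdivrMr// mul1r.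
exact: le_trans wb.
Qed.

Lemma admissible_fractional al phi : 0 < al < 1 ->
  is_fractional_poisson_kernel al phi -> admissible_kernel phi.
Proof.
move=> /andP[al0 al1] [c [c0 phiE n1]].
have be : 1 / 2 <= (2 - al) / 2 <= 1 by lra.
exists (power_kernel' c ((2 - al) / 2)), (power_kernel'' c ((2 - al) / 2)), c, 1,
  (2 - 2 * ((2 - al) / 2)), (10 * c).
have -> : phi = power_kernel c ((2 - al) / 2) by rewrite phiE.
split; last by apply: elliptic_power_kernel => //; exact: ltW.
apply: averaging_power_kernel => //; first exact: ltW.
rewrite -n1 /L1norm Lnorm1 phiE; apply: eq_integral => z _ /=.
by rewrite ger0_norm// mulr_ge0 ?(ltW c0)// invr_ge0 powR_ge0.
Qed.

Lemma admissible_poisson : admissible_kernel (@poisson_kernel R).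
Proof.
have be : 1 / 2 <= (1 : R) <= 1 by lra.
have pi0 : 0 <= pi^-1 :> R by rewrite invr_ge0 pi_ge0.
have E : @poisson_kernel R = power_kernel pi^-1 1.
  apply/funext => z; rewrite /poisson_kernel /power_kernel powRr1//.
  exact: ltW (sqr1_gt0 z).
exists (power_kernel' pi^-1 1), (power_kernel'' pi^-1 1), pi^-1, 1, (2 - 2 * 1), (10 * pi^-1).
rewrite E; split; last exact: elliptic_power_kernel.
apply: averaging_power_kernel => //; rewrite -E.
rewrite ge0_symfun_integralT.
- have -> : [set x : R | 0 <= x] = `[0, +oo[%classic.
    by apply/seteqP; split => x/=; rewrite in_itv/= andbT.
  rewrite /poisson_kernel; under eq_integral do rewrite EFinM addrC.
  rewrite ge0_integralZl//=.
  + rewrite integral0y_oneDsqr -!EFinM; congr EFin.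
    by rewrite mulrCA [2 * _]mulrC divfK ?pnatr_eq0// mulVf// gt_eqF// pi_gt0.
  + apply/measurable_EFinP; apply: measurable_funTS; apply: continuous_measurable_fun.
    exact: continuous_oneDsqrV.
  + by move=> z _; rewrite lee_fin invr_ge0 addrC ltW// sqr1_gt0.
- by move=> z; rewrite mulr_ge0// invr_ge0 ltW// sqr1_gt0.
- by rewrite E; exact: is_derive1_continuous (is_derive_power_kernel _ _).
- by move=> z; rewrite /poisson_kernel /= sqrrN.
Qed.

Lemma is_derive_heat_kernel z :
  is_derive z 1 (@heat_kernel R) (- (z / 2) * heat_kernel z) /\
  is_derive z 1 (fun z : R => - (z / 2) * heat_kernel z) ((z ^+ 2 / 4 - 1 / 2) * heat_kernel z).
Proof.
have d (x : R) : is_derive x 1 (@heat_kernel R) (- (x / 2) * heat_kernel x).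
  have d2 := is_derive1_scale (- 4^-1) (is_derive1_pow 2 (@is_derive_id _ _ x 1)).
  have := is_derive1_scale ((Num.sqrt (4 * pi))^-1)
    (is_derive1_compose d2 (is_derive_expR (- 4^-1 * x ^+ 2))).
  have -> : (fun z : R => (Num.sqrt (4 * pi))^-1 * expR (- 4^-1 * z ^+ 2)) = @heat_kernel R.
    by apply/funext => y; rewrite /heat_kernel mulNr [_^-1 * y ^+ 2]mulrC.
  move=> d3; apply: is_derive_eq d3 _.
  rewrite /heat_kernel mulNr [_^-1 * x ^+ 2]mulrC /= expr1 mulr1.
  by move: (expR _) (_^-1) => p q; field.
split=> //.
have d1 := is_derive1_mul (is_derive1_scale (- 2^-1) (@is_derive_id _ _ z 1)) (d z).
have -> : (fun z : R => - (z / 2) * heat_kernel z) = (fun x => - 2^-1 * x * heat_kernel x).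
  by apply/funext => x; rewrite -[- 2^-1 * x]mulrC mulrN.
by apply: is_derive_eq d1 _; move: (heat_kernel z) => p; field.
Qed.

(** It is the centred normal density of variance 2. *)
Lemma integral_heat_kernel : (\int[mu]_z (@heat_kernel R z)%:E = 1)%E.
Proof.
have s0 : Num.sqrt 2 != 0 :> R by rewrite gt_eqF// sqrtr_gt0.
have s2 : Num.sqrt 2 ^+ 2 = 2 :> R by rewrite sqr_sqrtr.
have E z : heat_kernel z = normal_pdf 0 (Num.sqrt 2) z :> R.
  rewrite (normal_pdfE 0 s0) /heat_kernel; congr (_ * _).
    by rewrite /normal_peak s2 -mulr_natr; congr ((Num.sqrt _)^-1); ring.
  by rewrite /normal_fun s2 subr0 mulNr (_ : 2 *+ 2 = 4)//; ring.
rewrite -(integral_normal_pdf 0 (Num.sqrt 2 : R)).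
by apply: eq_integral => z _; rewrite E.
Qed.

(** The dilation by [t] is the heat kernel at time t^2, so K_xx = K_t / (2 t), that is, a = 0 and b
    = -1/2. The constant 18 is ample for the largest factor: 18/64 exceeds the coefficient 1/4 of
    z^4. *)
Lemma admissible_heat : admissible_kernel (@heat_kernel R).
Proof.
pose c : R := (Num.sqrt (4 * pi))^-1; have c0 : 0 <= c by rewrite invr_ge0 sqrtr_ge0.
exists (fun z => - (z / 2) * heat_kernel z), (fun z => (z ^+ 2 / 4 - 1 / 2) * heat_kernel z), c, 0,
  (- (1 / 2)), (18 * c).
have ch : continuous (@heat_kernel R).
  exact: is_derive1_continuous (fun z => (is_derive_heat_kernel z).1).
have h0 z : 0 <= @heat_kernel R z by rewrite mulr_ge0 ?expR_ge0.
(* With [s = z ^+ 2 / 4]: [1 + s <= expR s] and [(1 + s / 2) ^+ 2 <= expR s]. *)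
have bnd z k : `|k| <= 18 * (1 + z ^+ 2 / 8) ^+ 2 -> `|k * heat_kernel z| <= 18 * c.
  move=> kb; rewrite normrM (ger0_norm (h0 z)) /heat_kernel mulrCA [leRHS]mulrC ler_wpM2l//.
  rewrite expRN ler_pdivrMr ?expR_gt0//; apply: le_trans kb _; rewrite ler_wpM2l//.
  have -> : z ^+ 2 / 4 = z ^+ 2 / 8 + z ^+ 2 / 8 by field.
  have := expR_ge1Dx (z ^+ 2 / 8); have : 0 <= 1 + z ^+ 2 / 8.
    by have := sqr_ge0 z; lra.
  by move=> p q; rewrite expRD expr2 ler_pM.
split.
- split => //; [by move=> z; rewrite /heat_kernel sqrrN|exact: ge0_integral1 integral_heat_kernel|].
  move=> z; have e1 : (1 + z ^+ 2 / 4) * expR (- (z ^+ 2 / 4)) <= 1.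
    by rewrite expRN ler_pdivrMr ?expR_gt0// mul1r expR_ge1Dx.
  have e0 : 0 <= expR (- (z ^+ 2 / 4)) by exact: expR_ge0.
  split; rewrite /heat_kernel -/c; first rewrite ler_piMr//.
    by apply: le_trans e1; rewrite ler_peMl//; have := sqr_ge0 z; lra.
  rewrite mulrCA ler_piMr//; apply: le_trans e1; rewrite ler_wpM2r//.
  by have := sqr_ge0 (`|z| - 2); rewrite sqrrB real_normK ?num_real//; lra.
- split.
  + by [].
  + by move=> z; have [] := is_derive_heat_kernel z.
  + by move=> z; have [] := is_derive_heat_kernel z.
  + split.
      move=> z; apply: cvgM; last exact: ch.
      apply: cvgB; last exact: cvg_cst.
      by apply: cvgM; [exact: exprn_continuous|exact: cvg_cst].
    move=> z; have z0 := sqr_ge0 z.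
    have E : (1 + z ^+ 2 / 8) ^+ 2 = 1 + z ^+ 2 / 4 + (z ^+ 2) ^+ 2 / 64 by field.
    have z4 := sqr_ge0 (z ^+ 2).
    split.
    * by rewrite -[X in `|X|]mul1r; apply: bnd; rewrite E normr1; lra.
    * rewrite mulrA; apply: bnd; rewrite E.
      have -> : z * - (z / 2) = - (z ^+ 2 / 2) by field.
      by rewrite ler_norml; lra.
    * by apply: bnd; rewrite E ler_norml; lra.
    * rewrite mulrA; apply: bnd; rewrite E mulrBr mulrA -expr2.
      by rewrite ler_norml; lra.
  + by move=> z; move: (heat_kernel z) => p; field.
Qed.

Lemma admissible_kernelP al phi : 0 < al < 1 ->
  [\/ phi = poisson_kernel, phi = heat_kernel | is_fractional_poisson_kernel al phi] ->
  admissible_kernel phi.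
Proof.
move=> al01 [->|->|]; [exact: admissible_poisson|exact: admissible_heat|].
exact: admissible_fractional.
Qed.

End kernels.

(** * Transfer to Sobolev functions and maximal functions *)

Section sobolev.
Context {R : realType}.
Local Notation mu := (@lebesgue_measure R).
Implicit Types (f g h u v F phi : R -> R) (x y z d : R).

Lemma L1norm_ae h g : measurable_fun setT h -> integrableR g ->
  {ae mu, forall x, h x = g x} -> L1norm h = (\int[mu]_x `|g x|)%:E.
Proof.
move=> mh ig hg; rewrite /L1norm Lnorm1 fineK; last first.
  exact: (integrable_fin_num measurableT (integrableR_norm ig)).
apply: ae_eq_integral => //.
- by apply/measurable_EFinP; exact: measurableT_comp.
- by apply/measurable_EFinP; apply: measurableT_comp => //; exact: integrableR_meas.
- by apply: aeS hg => x /= -> _.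
Qed.

Lemma measurable_weak_derivative F v : primitive F v ->
  measurable_fun setT (weak_derivative F).
Proof.
move=> pF; have [_ [] //] : is_weak_derivative F (weak_derivative F).
exact: (@xgetI _ (cst 0) [set g | is_weak_derivative F g] v (primitive_is_weak_derivative pF)).
Qed.

Lemma L1norm_weak_derivative F v : primitive F v ->
  L1norm (weak_derivative F) = (\int[mu]_x `|v x|)%:E.
Proof.
move=> pF; apply: L1norm_ae; [exact: measurable_weak_derivative pF|exact: pF.1|].
exact: weak_derivativeP.
Qed.

Lemma L1norm_weak_derivativeB F v G w : primitive F v -> primitive G w ->
  L1norm (fun x => weak_derivative F x - weak_derivative G x) =
  (\int[mu]_x `|v x - w x|)%:E.
Proof.
move=> pF pG; apply: (@L1norm_ae _ (fun x => v x - w x)).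
- by apply: measurable_funB; [exact: measurable_weak_derivative pF|
    exact: measurable_weak_derivative pG].
- by apply: integrableRB; [exact: pF.1|exact: pG.1].
- by apply: aeS (aeI (weak_derivativeP pF) (weak_derivativeP pG)) => x [-> ->].
Qed.

Lemma sobolev11_primitive u : sobolev11 u -> exists v, primitive u v.
Proof. by move=> [cu _ [g ug ig]]; exists g; exact: is_weak_derivative_primitive. Qed.

(** A value above [e] forces values of at least [e / 2] on an interval of length [d / 2], hence mass
    [e * d / 4], whereas the tails carry at most [e * d / 8]. *)
Lemma unifc_integrable_vanishing f : unifc f -> (forall x, 0 <= f x) -> integrableR f ->
  forall e : R, 0 < e -> exists M : R, forall x, M <= `|x| -> f x <= e.
Proof.
move=> uf f0 fi e e0; have e20 : 0 < e / 2 by rewrite divr_gt0.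
have [d d0 dP] := uf _ e20.
have t0 : 0 < e / 8 * d by rewrite mulr_gt0// divr_gt0.
have [M [L [n [w [[M0 _] _ [iw w0 wt] _ fw]]]]] := step_approximation fi t0.
exists (M + d) => x Mx; rewrite leNgt; apply/negP => fe.
have xd : x - d / 2 <= x by rewrite gerBl divr_ge0// ltW.
have big z : x - d / 2 <= z <= x -> - w z <= - (e / 2).
  move=> /andP[z1 z2]; have xz : `|x - z| < d by rewrite ltr_norml; lra.
  have zM : M <= `|z| by have := lerB_dist x z; lra.
  have := fw _ zM; have := dP _ _ xz; rewrite (ger0_norm (f0 z)) ler_norml; lra.
have iN : integrableR (fun z => - w z).
  have := integrableRZ (-1) iw; congr integrable; apply/funext => z /=.
  by rewrite mulN1r.
have := cumul_cst_le iN xd big; have := cumul_le_total iw xd w0.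
have E z : cumul (fun z => - w z) z = - cumul w z.
  by rewrite -mulN1r -cumulZ//; congr (cumul _ z); apply/funext => y; rewrite mulN1r.
by rewrite !E; lra.
Qed.

(** Compare [x] with a far point where |u| is below [e]. Applied to differences, this turns L1
    convergence of derivatives into uniform convergence. *)
Lemma norm_le_total_variation u v : primitive u v -> integrableR u ->
  forall x, `|u x| <= \int[mu]_z `|v z|.
Proof.
move=> pu iu x; have [iv uv] := pu; apply/ler_addgt0Pr => e e0.
have un := primitive_unifc (primitive_norm pu).
have [M MP] := unifc_integrable_vanishing un (fun z => normr_ge0 (u z)) (integrableR_norm iu) e0.
pose y := Num.min x (- `|M|).
have yx : y <= x by rewrite ge_min lexx.
have yM : M <= `|y|.
  have : y <= - `|M| by rewrite ge_min lexx orbT.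
  have := ler_norm M; have := ler_norm (- y); rewrite normrN; lra.
have := MP _ yM; have := norm_cumul iv yx.
have := cumul_le_total (integrableR_norm iv) yx (fun z => normr_ge0 (v z)).
by rewrite -uv; have := ler_normD (u x - u y) (u y); rewrite subrK; lra.
Qed.

Lemma profile_norm u v : primitive u v -> integrableR u ->
  profile (fun x => `|u x|) (\int[mu]_z `|v z|).
Proof.
move=> pu iu; split; first exact: primitive_unifc (primitive_norm pu).
- by move=> x; rewrite normr_ge0/=; exact: norm_le_total_variation.
- exact: integrableR_norm.
Qed.

Lemma maximal_function_primitive phi u v : admissible_kernel phi ->
  primitive u v -> integrableR u ->
  obstacle (fun x => `|u x|) (maximal_function phi u) /\
  exists V, primitive (maximal_function phi u) V.
Proof.
move=> [phi' [phi'' [C [a [b [D [kphi ephi]]]]]]] pu iu.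
have pr := profile_norm pu iu.
have ob := obstacle_max_average kphi ephi pr; split => //.
apply: obstacle_primitive ob (primitive_norm pu) _.
exists (\int[mu]_z `|v z|) => x.
apply: le_trans (_ : max_average phi (fun x => `|u x|) x <= _); first by rewrite gerBl.
by apply: max_average_le => t t0; exact: (average_le kphi x pr t0).
Qed.

(** L1 convergence of the derivatives controls |u_j| and, through [max_average_dist], the maximal
    functions uniformly; [absder_cvg] supplies the obstacle derivatives. *)
Lemma maximal_function_derivative_cvg phi (u_ v_ V_ : nat -> R -> R) u v V :
  admissible_kernel phi ->
  (forall j, primitive (u_ j) (v_ j)) -> primitive u v ->
  (forall j, integrableR (u_ j)) -> integrableR u ->
  (forall j, primitive (maximal_function phi (u_ j)) (V_ j)) ->
  primitive (maximal_function phi u) V ->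
  \int[mu]_x `|v_ j x - v x| @[j --> \oo] --> (0 : R) ->
  \int[mu]_x `|V_ j x - V x| @[j --> \oo] --> (0 : R).
Proof.
move=> ak pj pu ij iu Pj P vcvg.
have near0 (e : R) : 0 < e -> \forall j \near \oo, \int[mu]_x `|v_ j x - v x| <= e.
  by move=> e0; apply: (cvgr_le _ vcvg).
have dist j x : `|u_ j x - u x| <= \int[mu]_x `|v_ j x - v x|.
  apply: (norm_le_total_variation (primitiveB (pj j) pu)).
  exact: integrableRB.
have ndist j x : `|(`|u_ j x| - `|u x|)| <= \int[mu]_x `|v_ j x - v x|.
  exact: le_trans (ler_dist_dist _ _) (dist j x).
have ob j := (maximal_function_primitive ak (pj j) (ij j)).1.
have o := (maximal_function_primitive ak pu iu).1.
have [phi' [phi'' [C [a [b [D [kphi ephi]]]]]]] := ak.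
apply: (obstacle_stability ob o (fun j => primitive_norm (pj j)) (primitive_norm pu) Pj P).
- by [].
- apply: (max_average_vanishing kphi (profile_norm pu iu)).
  apply: unifc_integrable_vanishing => //; last exact: integrableR_norm.
  exact: primitive_unifc (primitive_norm pu).
- move=> e e0; have := near0 _ e0; apply: filterS => j je x.
  split; apply: le_trans je; first exact: ndist.
  exact: (max_average_dist kphi (profile_norm (pj j) (ij j)) (profile_norm pu iu)
    (fun y => ndist j (x + y))).
- apply: absder_cvg => // x; apply/cvgrPdist_le => e e0.
  have := near0 _ e0; apply: filterS => j je.
  by rewrite distrC; exact: le_trans (dist j x) je.
Qed.

End sobolev.

Theorem theorem1 (R : realType) (alpha : R) (halpha : 0 < alpha < 1)
    (phi : R -> R)
    (hphi : [\/ phi = poisson_kernel, phi = heat_kernel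
              | is_fractional_poisson_kernel alpha phi]) :
  (forall u : R -> R, sobolev11 u ->
     exists2 g : R -> R, is_weak_derivative (maximal_function phi u) g &
       lebesgue_measure.-integrable [set: R] (EFin \o g)) /\
  (forall (u_ : nat -> R -> R) (u : R -> R),
     (forall j, sobolev11 (u_ j)) -> sobolev11 u ->
     sobolev11_norm (fun x => u_ j x - u x) @[j --> \oo] --> 0%E ->
     L1norm (fun x => weak_derivative (maximal_function phi (u_ j)) x
                    - weak_derivative (maximal_function phi u) x)
       @[j --> \oo] --> 0%E).
Proof.
have ak := admissible_kernelP halpha hphi; split.
- move=> u su; have [v pu] := sobolev11_primitive su; have [_ iu _] := su.
  have [_ [V PV]] := maximal_function_primitive ak pu iu.
  by exists V; [exact: primitive_is_weak_derivative|exact: PV.1].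
- move=> u_ u sj su ucvg; have [v pu] := sobolev11_primitive su; have [_ iu _] := su.
  have ij j : integrableR (u_ j) by have [] := sj j.
  have [v_ pj] := choice (fun j => sobolev11_primitive (sj j)).
  have [V_ PV] := choice (fun j => (maximal_function_primitive ak (pj j) (ij j)).2).
  have [_ [V P]] := maximal_function_primitive ak pu iu.
  (* The chosen weak derivatives agree almost everywhere with [V_ j] and [V], so the norm can be
     computed from these. *)
  under eq_fun do rewrite (L1norm_weak_derivativeB (PV _) P).
  apply: cvg_EFin; first by apply: nearW.
  apply: (maximal_function_derivative_cvg ak pj pu ij iu PV P).
  (* The derivative part of the Sobolev norm is squeezed between 0 and the whole norm. *)
  have cE : (\int[lebesgue_measure]_x `|v_ j x - v x|)%:E @[j --> \oo] --> 0%E.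
    apply: squeeze_cvge (cvg_cst _) ucvg; apply: nearW => j.
    rewrite lee_fin Rintegral_ge0//= /sobolev11_norm.
    rewrite (L1norm_weak_derivative (primitiveB (pj j) pu)) leeDr//.
    exact: Lnorm_ge0.
  exact: (fine_cvg cE).
Qed.
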